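(* Let $G$ be a finite group and let $\mathfrak{o}$ be a complete discrete valuation ring with field of fractions $F$, such that $|G|$ is invertible in $F$. Let $\Lambda := \mathfrak{o}[G]$ and let $\Gamma\subset F[G]$ be a nice Fitting order over $\mathfrak{o}$ containing $\Lambda$, with decomposition $\Gamma = \bigoplus_{i=1}^k\Gamma_i$ and associated $n_i, s_i, \mathfrak{o}_i$ and $\mathfrak{D}^{-1}(\mathfrak{o}_i/\mathfrak{o})$ as defined in the context. Let $$\mathcal{J} = \bigoplus_{i=1}^k\frac{|G|}{n_is_i}\mathfrak{D}^{-1}(\mathfrak{o}_i/\mathfrak{o}).$$ Then for any finitely generated $\Lambda$-module $M$ we have $$\mathcal{J}\cdot\mathrm{Fit}^{\max}_{\Lambda}(M)\subset\mathcal{J}\cdot\mathrm{Fit}^{\max}_{\Gamma}(\Gamma\otimes_{\Lambda}M)\subset\mathrm{Ann}_{\zeta(\Lambda)}(M).$$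
   Context: Modules are left modules; $\zeta(\cdot)$ denotes the centre of a ring. A nice Fitting order over $\mathfrak{o}$ in $A:=F[G]$ is an $\mathfrak{o}$-order in $F[G]$ that is a finite direct sum of rings each of which is either a maximal $\mathfrak{o}$-order or a matrix ring over a commutative ring. Write $\Gamma = \bigoplus_{i=1}^k\Gamma_i$, where each $\Gamma_i$ is isomorphic either to a matrix ring $M_{n_i\times n_i}(\mathfrak{o}_i)$ over a commutative ring $\mathfrak{o}_i$ (not necessarily integrally closed), in which case put $s_i=1$, or to a matrix ring $M_{n_i\times n_i}(\mathfrak{o}_{D_i})$ over the valuation ring $\mathfrak{o}_{D_i}$ of a skewfield $D_i$, in which case put $\mathfrak{o}_i := \zeta(\Gamma_i) = \zeta(\mathfrak{o}_{D_i})$ and let $s_i$ be the Schur index of $D_i$ (so $D_i$ has dimension $s_i^2$ over its centre). In both cases $\mathfrak{o}_i$ is a commutative noetherian complete local ring, assumed indecomposable. Put $F_i := F\otimes_{\mathfrak{o}}\mathfrak{o}_i$ (not necessarily a field), so $\zeta(A)=\bigoplus_i F_i$, and $$\mathfrak{D}^{-1}(\mathfrak{o}_i/\mathfrak{o}) := \{x\in F_i\mid\mathrm{Tr}_{F_i/F}(x\mathfrak{o}_i)\subset\mathfrak{o}\},$$ where $\mathrm{Tr}_{F_i/F}$ is the ordinary trace. The reduced norm $\mathrm{nr}: M_{b\times b}(A)\to\zeta(A)$ is defined componentwise on the simple components of $A$. For an $\mathfrak{o}$-order $\Lambda$ in $A$ put $\mathcal{U}(\Lambda) := \langle \mathrm{nr}(H)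 \mid H \in \mathrm{GL}_b(\Lambda), b\in\mathbb{N}\rangle_{\zeta(\Lambda)} \subset \zeta(A)$, the $\zeta(\Lambda)$-span. For a finite presentation $\Lambda^a \xrightarrow{h} \Lambda^b \twoheadrightarrow M$, identify $h$ with a matrix in $M_{a\times b}(\Lambda)$ (acting by right multiplication on row vectors), let $S_b(h)$ be the set of its $b\times b$ submatrices when $a\ge b$, and put $\mathrm{Fit}_\Lambda(h) := \langle \mathrm{nr}(H) \mid H\in S_b(h)\rangle_{\mathcal{U}(\Lambda)}$ if $a\ge b$ and $\mathrm{Fit}_\Lambda(h) := 0$ if $a<b$. Then $\mathrm{Fit}^{\max}_\Lambda(M)$ is the unique maximal element with respect to inclusion (which exists) among all $\mathrm{Fit}_\Lambda(h)$, $h$ running through the finite presentations of $M$; likewise for $\Gamma$. *)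

(* Defs.v *)
From HB Require Import structures.
From mathcomp Require Import all_boot all_order all_algebra all_fingroup all_field.
From mathcomp Require Import boolp classical_sets.

Set Implicit Arguments.
Unset Strict Implicit.
Unset Printing Implicit Defensive.

Import Order.TTheory GRing.Theory Num.Theory.

Local Open Scope classical_set_scope.
Local Open Scope ring_scope.

(* A type alias, so that the product is convolution and not the pointwise
   product that MathComp puts on finite functions. *)
Definition grpalg (F : fieldType) (gT : finGroupType) : Type := {ffun gT -> F^o}.

Section GroupAlgebra.
Variables (F : fieldType) (gT : finGroupType).
Local Notation A := (grpalg F gT).
Implicit Types x y z : A.

HB.instance Definition _ := Vector.copy A {ffun gT -> F^o}.

Definition grpalg_coef x (g : gT) : F := (x : {ffun gT -> F^o}) g.

Definition grpalg_one : A := [ffun g : gT => (g == 1%g)%:R : F^o].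
Definition grpalg_mul x y : A :=
  [ffun g : gT => \sum_(h : gT) grpalg_coef x h * grpalg_coef y (h^-1 * g)%g : F^o].

Lemma grpalg_eqP x y : (forall g, grpalg_coef x g = grpalg_coef y g) -> x = y.
Proof. by move=> H; apply/ffunP => g; apply: H. Qed.

Lemma grpalg_coefD x y g :
  grpalg_coef (x + y) g = grpalg_coef x g + grpalg_coef y g.
Proof. by rewrite /grpalg_coef ffunE. Qed.

Lemma grpalg_coefN x g : grpalg_coef (- x) g = - grpalg_coef x g.
Proof. by rewrite /grpalg_coef ffunE. Qed.

Lemma grpalg_coefZ (c : F) x g : grpalg_coef (c *: x) g = c * grpalg_coef x g.
Proof. by rewrite /grpalg_coef ffunE. Qed.

Lemma grpalg_coef_one g : grpalg_coef grpalg_one g = (g == 1%g)%:R.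
Proof. by rewrite /grpalg_coef ffunE. Qed.

Lemma grpalg_coef_mul x y g :
  grpalg_coef (grpalg_mul x y) g =
  \sum_(h : gT) grpalg_coef x h * grpalg_coef y (h^-1 * g)%g.
Proof. by rewrite /grpalg_coef ffunE. Qed.

Fact grpalg_mulA : associative grpalg_mul.
Proof.
move=> x y z; apply: grpalg_eqP => g; rewrite !grpalg_coef_mul.
under eq_bigr => h _ do rewrite grpalg_coef_mul big_distrr /=.
under [RHS]eq_bigr => h _ do rewrite grpalg_coef_mul big_distrl /=.
rewrite [RHS]exchange_big /=; apply: eq_bigr => h _.
rewrite [RHS](reindex_inj (mulgI h)) /=; apply: eq_bigr => k _.
by rewrite mulrA mulKg invMg mulgA.
Qed.

Fact grpalg_mul1l : left_id grpalg_one grpalg_mul.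
Proof.
move=> x; apply: grpalg_eqP => g; rewrite grpalg_coef_mul (bigD1 1%g) //= big1.
  by rewrite grpalg_coef_one eqxx mul1r addr0 invg1 mul1g.
by move=> h /negPf hn; rewrite grpalg_coef_one hn mul0r.
Qed.

Fact grpalg_mul1r : right_id grpalg_one grpalg_mul.
Proof.
move=> x; apply: grpalg_eqP => g; rewrite grpalg_coef_mul (bigD1 g) //= big1.
  by rewrite grpalg_coef_one mulVg eqxx mulr1 addr0.
move=> h hn; rewrite grpalg_coef_one -eq_mulVg1.
by rewrite (negPf hn) mulr0.
Qed.

Fact grpalg_mulDl : left_distributive grpalg_mul +%R.
Proof.
move=> x y z; apply: grpalg_eqP => g.
rewrite grpalg_coefD !grpalg_coef_mul -big_split; apply: eq_bigr => h _ /=.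
by rewrite grpalg_coefD mulrDl.
Qed.

Fact grpalg_mulDr : right_distributive grpalg_mul +%R.
Proof.
move=> x y z; apply: grpalg_eqP => g.
rewrite grpalg_coefD !grpalg_coef_mul -big_split; apply: eq_bigr => h _ /=.
by rewrite grpalg_coefD mulrDr.
Qed.

Fact grpalg_oner_neq0 : grpalg_one != 0.
Proof.
apply/eqP => /(congr1 (grpalg_coef^~ 1%g)).
by rewrite grpalg_coef_one eqxx /grpalg_coef ffunE => /eqP; rewrite oner_eq0.
Qed.

HB.instance Definition _ := GRing.Zmodule_isNzRing.Build A
  grpalg_mulA grpalg_mul1l grpalg_mul1r grpalg_mulDl grpalg_mulDr
  grpalg_oner_neq0.

Fact grpalg_scaleAl (c : F) x y : c *: (x * y) = (c *: x) * y.
Proof.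
apply: grpalg_eqP => g; rewrite grpalg_coefZ !grpalg_coef_mul big_distrr /=.
by apply: eq_bigr => h _; rewrite grpalg_coefZ mulrA.
Qed.

HB.instance Definition _ := GRing.Lmodule_isLalgebra.Build F A grpalg_scaleAl.

Fact grpalg_scaleAr (c : F) x y : c *: (x * y) = x * (c *: y).
Proof.
apply: grpalg_eqP => g; rewrite grpalg_coefZ !grpalg_coef_mul big_distrr /=.
by apply: eq_bigr => h _; rewrite grpalg_coefZ mulrCA.
Qed.

HB.instance Definition _ := GRing.Lalgebra_isAlgebra.Build F A grpalg_scaleAr.
HB.instance Definition _ := Algebra_isFalgebra.Build F A.

Definition grpring_pred (O : subringClosed F) : {pred A} :=
  [pred x : A | [forall g, grpalg_coef x g \in O]].

Fact grpring_subring_closed (O : subringClosed F) : subring_closed (grpring_pred O).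
Proof.
split=> [|x y /forallP hx /forallP hy|x y /forallP hx /forallP hy]; apply/forallP => g.
- by rewrite grpalg_coef_one; case: (_ == _); rewrite ?rpred1 ?rpred0.
- by rewrite grpalg_coefD grpalg_coefN rpredB ?hx ?hy.
- by rewrite grpalg_coef_mul rpred_sum // => h _; rewrite rpredM ?hx ?hy.
Qed.

HB.instance Definition _ (O : subringClosed F) :=
  GRing.isSubringClosed.Build A (grpring_pred O)
    (grpring_subring_closed O).

Definition grpring (O : subringClosed F) : subringClosed A := grpring_pred O.

End GroupAlgebra.

Arguments grpring {F} gT O.

Section SubringType.
Variables (A : nzRingType) (L : subringClosed A).

Record subring_of : Type := Subring_of {
  subring_val :> A;
  _ : subring_val \in L }.

HB.instance Definition _ := [isSub for subring_val].
HB.instance Definition _ := [Choice of subring_of by <:].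
HB.instance Definition _ := [SubChoice_isSubNzRing of subring_of by <:].

End SubringType.

Definition subring_widen (A : nzRingType) (L L' : subringClosed A)
    (LL' : {subset L <= L'}) (x : subring_of L) : subring_of L' :=
  Subring_of (LL' _ (valP x)).

(* Finite sums of products r * s; with R a set of scalars this is the R-span of
   S, and for two submodules of a commutative ring it is their product. *)
Definition mul_span (A : nzRingType) (R S : set A) : set A :=
  [set x | exists n (r s : 'I_n -> A),
     [/\ forall i, R (r i), forall i, S (s i) & x = \sum_(i < n) r i * s i]].

Definition centre (A : nzRingType) (S : set A) : set A :=
  [set x | S x /\ forall y, S y -> x * y = y * x].

Definition scalars (F : fieldType) (A : falgType F) (O : set F) : set A :=
  [set c%:A | c in O].
Arguments scalars {F} A O.

(* The F-subspace spanned by a subset; characterised by mem_Fspan. *)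
Definition Fspan (F : fieldType) (A : falgType F) (S : set A) : {vspace A} :=
  xget 0%VS [set U : {vspace A} | forall x, x \in U <-> mul_span (scalars A setT) S x].

Lemma mem_Fspan (F : fieldType) (A : falgType F) (S : set A) (x : A) :
  x \in Fspan S <-> mul_span (scalars A setT) S x.
Proof.
suff /cid[U HU] : exists U : {vspace A},
    forall y, y \in U <-> mul_span (scalars A setT) S y.
  by rewrite /Fspan; case: xgetP => [V _ HV|/(_ U)/(_ HU)].
pose P d := `[< exists2 s : seq A, (forall a, a \in s -> S a) & \dim <<s>>%VS = d >].
have exP : exists d, P d.
  by exists 0%N; apply/asboolP; exists [::] => //; rewrite span_nil dimv0.
have bP d : P d -> (d <= \dim {:A})%N.
  by move=> /asboolP[s _ <-]; apply: dimvS; apply: subvf.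
case: (ex_maxnP exP bP) => d /asboolP[s sS ds] dmax.
have Ss a : S a -> a \in <<s>>%VS.
  move=> Sa; have /dmax : P (\dim <<a :: s>>%VS).
    apply/asboolP; exists (a :: s) => // b; rewrite inE => /orP[/eqP->//|].
    exact: sS.
  have sub : (<<s>> <= <<a :: s>>)%VS by rewrite span_cons addvSr.
  rewrite -ds => le; have /eqP -> : <<s>>%VS == <<a :: s>>%VS by rewrite eqEdim sub.
  by rewrite memv_span // mem_head.
exists <<s>>%VS => y; split.
  move=> /(coord_span (X := in_tuple s)) ->.
  exists (size s), (fun i => (coord (in_tuple s) i y)%:A), (fun i => (in_tuple s)`_i).
  split=> [i|i|]; first by eexists; last by [].
    by apply: sS; rewrite mem_nth.
  by apply: eq_bigr => i _; rewrite -scalerAl mul1r.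
move=> [n [r [t [Rr St ->]]]]; apply: rpred_sum => i _.
by have [c _ <-] := Rr i; rewrite -scalerAl mul1r memvZ ?Ss.
Qed.

(* The value v 0 is irrelevant; it stands for infinity. *)
Definition discrete_valuation (D : unitRingType) (v : D -> int) : Prop :=
  [/\ forall n : int, exists2 x : D, x != 0 & v x = n,
      forall x y : D, x != 0 -> y != 0 -> v (x * y) = v x + v y
    & forall x y : D, x != 0 -> y != 0 -> x + y != 0 ->
        Num.min (v x) (v y) <= v (x + y)].

Definition val_ge (D : unitRingType) (v : D -> int) (N : int) : set D :=
  [set x | x = 0 \/ N <= v x].

Definition valuation_ring (D : unitRingType) (v : D -> int) (V : set D) : Prop :=
  discrete_valuation v /\ V = val_ge v 0.

(* O is a discrete valuation ring with field of fractions F, complete for the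
   topology defined by the powers {v >= N} of its maximal ideal. *)
Definition complete_dvr (F : fieldType) (O : subringClosed F) : Prop :=
  exists v : F -> int, valuation_ring v [set` O] /\
    forall u : nat -> F, (forall n, u n \in O) ->
      (forall N : nat, exists n0, forall m n, (n0 <= m)%N -> (n0 <= n)%N ->
          val_ge v N%:Z (u m - u n)) ->
      exists2 l : F, l \in O &
        forall N : nat, exists n0, forall n, (n0 <= n)%N -> val_ge v N%:Z (u n - l).

Section Orders.
Variables (F : fieldType) (O : subringClosed F) (A : falgType F).

(* S is an O-order in the F-algebra eA with unit e (e a central idempotent). *)
Definition is_order (e : A) (S : set A) : Prop :=
  [/\ S e,
      forall x y, S x -> S y -> S (x - y) /\ S (x * y),
      exists n (b : 'I_n -> A), S = mul_span (scalars A [set` O]) (range b)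
    & mul_span (scalars A setT) S = [set e * x | x in setT]].

Definition is_maximal_order (e : A) (S : set A) : Prop :=
  is_order e S /\ forall S', is_order e S' -> S `<=` S' -> S' = S.

Definition component (S : set A) (e : A) : set A := [set e * x | x in S].

(* phi is an isomorphism of the matrix ring M_n(R) onto S, a ring with unit e. *)
Definition matrix_iso (R : nzRingType) (n : nat) (phi : 'M[R]_n -> A)
    (e : A) (S : set A) : Prop :=
  [/\ forall X Y, phi (X + Y) = phi X + phi Y,
      forall X Y, phi (X *m Y) = phi X * phi Y,
      phi 1%:M = e,
      injective phi
    & range phi = S].

(* The ring S is the direct sum of its components S e_i. *)
Definition ring_decomposition (S : set A) (k : nat) (e : 'I_k -> A) : Prop :=
  [/\ forall i, centre S (e i),
      forall i j, e i * e j = if i == j then e i else 0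
    & \sum_(i < k) e i = 1].

Definition nice_Fitting_order (Gam : subringClosed A) : Prop :=
  is_order 1 [set` Gam] /\
  exists k (e : 'I_k -> A), ring_decomposition [set` Gam] e /\
    forall i, is_maximal_order (e i) (component [set` Gam] (e i)) \/
      exists (R : comNzRingType) n (phi : 'M[R]_n -> A),
        (0 < n)%N /\ matrix_iso phi (e i) (component [set` Gam] (e i)).

(* The ring S with unit e is M_n(o) for a commutative ring; o is identified with
   the scalar matrices, a subset of A. *)
Definition commutative_type (e : A) (S : set A) (n s : nat) (o : set A) : Prop :=
  exists (R : comNzRingType) (phi : 'M[R]_n -> A),
    [/\ (0 < n)%N, matrix_iso phi e S, o = [set phi c%:M | c in setT] & s = 1%N].

(* The ring S with unit e is M_n(V), where V is the valuation ring of a skewfield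
   D, for a valuation extending (up to normalisation) that of F. *)
Definition skewfield_type (e : A) (S : set A) (n s : nat) (o : set A) : Prop :=
  exists (D : falgType F) (w : D -> int) (V : subringClosed D)
         (phi : 'M[subring_of V]_n -> A),
    [/\ [/\ forall x : D, x != 0 -> x \is a GRing.unit,
            valuation_ring w [set` V]
          & forall c : F, (c%:A : D) \in V <-> c \in O],
        [/\ (0 < n)%N, matrix_iso phi e S
          & forall (c : F) (x : subring_of V), val x = c%:A ->
              phi x%:M = c *: e],
        o = centre S
      & \dim {:D} = (s ^ 2 * \dim 'Z({:D}))%N].

Definition Fitting_decomposition (Gam : subringClosed A) (k : nat)
    (e : 'I_k -> A) (n s : 'I_k -> nat) (o : 'I_k -> set A) : Prop :=
  [/\ ring_decomposition [set` Gam] e,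
      forall i, let Gi := component [set` Gam] (e i) in
        commutative_type (e i) Gi (n i) (s i) (o i) \/
        skewfield_type (e i) Gi (n i) (s i) (o i)
    & forall i, e i <> 0 /\
        forall x, o i x -> x * x = x -> x = 0 \/ x = e i].

(* Trace of multiplication by x on a subspace U stable under it. *)
Definition trace_on (U : {vspace A}) (x : A) : F :=
  \sum_(i < \dim U) coord (vbasis U) i (x * (vbasis U)`_i).

(* F (x) o is identified with the F-span of o in A. *)
Definition inv_different (o : set A) : set A :=
  [set x | x \in Fspan o /\ forall y, o y -> trace_on (Fspan o) (x * y) \in O].

Definition Jideal (N : nat) (k : nat) (n s : 'I_k -> nat) (o : 'I_k -> set A) : set A :=
  [set x | exists2 y : 'I_k -> A, forall i, inv_different (o i) (y i) &
     x = \sum_(i < k) (N%:R / (n i * s i)%:R : F) *: y i].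

End Orders.

Section ReducedNorm.
Variables (F : fieldType) (A : falgType F).

(* For A semisimple these e correspond to the simple components eA. *)
Definition primitive_central_idempotent (e : A) : Prop :=
  [/\ centre setT e, e * e = e, e <> 0 &
      forall f : A, centre setT f -> f * f = f -> f * e = f -> f = 0 \/ f = e].

(* psi factors through the simple component B = eA and its E-linear extension is
   an isomorphism of E (x)_K B onto M_m(E), where K is the centre of B; K embeds
   in E since psi maps it to scalar matrices. Only surjectivity has to be
   required, because E (x)_K B is simple. *)
Definition is_splitting (e : A) (E : fieldType) (m : nat)
    (psi : {rmorphism A -> 'M[E]_m}) : Prop :=
  [/\ (0 < m)%N, psi e = 1%:M &
      forall N : 'M[E]_m, exists l (c : 'I_l -> E) (a : 'I_l -> A),
        N = \sum_(i < l) c i *: psi (a i)].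

Definition is_nr (b : nat) (H : 'M[A]_b) (z : A) : Prop :=
  centre setT z /\
  forall e, primitive_central_idempotent e ->
  forall (E : fieldType) m (psi : {rmorphism A -> 'M[E]_m}), is_splitting e psi ->
    psi z = (\det (\mxblock_(i < b, j < b) psi (H i j)))%:M.

Definition nr (b : nat) (H : 'M[A]_b) : A := xget 0 (is_nr H).

End ReducedNorm.

Section Fitting.
Variables (F : fieldType) (A : falgType F) (L : subringClosed A).
Local Notation Lam := (subring_of L).

Definition nrL (b : nat) (H : 'M[Lam]_b) : A := nr (map_mx val H).

Definition U_ring : set A :=
  mul_span (centre [set` L])
    [set x | exists b (H H' : 'M[Lam]_b),
       [/\ H *m H' = 1%:M, H' *m H = 1%:M & x = nrL H]].

Definition Fit_mx (a b : nat) (h : 'M[Lam]_(a, b)) : set A :=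
  if (b <= a)%N then
    mul_span U_ring
      [set nrL (rowsub f h) | f in [set f : 'I_b -> 'I_a | {homo f : i j / (i < j)%N}]]
  else [set 0].

Definition finitely_generated (M : lmodType Lam) : Prop :=
  exists b (p : {linear 'rV[Lam]_b -> M}), forall x, exists v, p v = x.

Definition is_presentation (M : lmodType Lam) (a b : nat) (h : 'M[Lam]_(a, b)) : Prop :=
  exists p : {linear 'rV[Lam]_b -> M},
    (forall x, exists v, p v = x) /\
    (forall v, p v = 0 <-> exists u : 'rV[Lam]_a, v = u *m h).

Definition Fit_family (M : lmodType Lam) : set (set A) :=
  [set I | exists a b (h : 'M[Lam]_(a, b)), is_presentation M h /\ I = Fit_mx h].

Definition is_maximal_in (C : set (set A)) (I : set A) : Prop :=
  C I /\ forall I', C I' -> I `<=` I' -> I' = I.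

(* The maximal element exists and is unique when M has a finite presentation;
   the default value set0 is then irrelevant. *)
Definition Fitmax (M : lmodType Lam) : set A := xget set0 (is_maximal_in (Fit_family M)).

Definition Ann_centre (M : lmodType Lam) : set A :=
  [set x | centre [set` L] x /\
           exists2 l : Lam, val l = x & forall m : M, l *: m = 0].

End Fitting.

Section Tensor.
Variables (A : nzRingType) (L L' : subringClosed A) (LL' : {subset L <= L'}).
Variables (M : lmodType (subring_of L)).

Definition balanced (P : zmodType) (f : subring_of L' -> M -> P) : Prop :=
  [/\ forall g g' m, f (g + g') m = f g m + f g' m,
      forall g m m', f g (m + m') = f g m + f g m'
    & forall g l m, f (g * subring_widen LL' l) m = f g (l *: m)].

(* The left L'-module N, with t g m standing for g (x) m, is the tensor product
   of L' and M over L. *)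
Definition is_tensor (N : lmodType (subring_of L')) (t : subring_of L' -> M -> N) : Prop :=
  [/\ balanced t,
      forall g g' m, t (g * g') m = g *: t g' m,
      forall (P : zmodType) (f : subring_of L' -> M -> P), balanced f ->
        exists u : {additive N -> P}, forall g m, u (t g m) = f g m
    & forall (P : zmodType) (u u' : {additive N -> P}),
        (forall g m, u (t g m) = u' (t g m)) -> u =1 u'].

End Tensor.

(* Main.v *)
(* Over a splitting field E of G, every nonzero element of A = F[G] is detected by some
   absolutely irreducible psi : A -> M_m(E), and psi (nr H) = det (psi H).

   Fit_Gamma(N) annihilates N: for a square H over Gamma there is an adjoint Y over Gamma
   with Y H = nr H. On a component M_n(o_i) with o_i commutative, Y comes from the
   adjugate. On a component M_n(o_D), psi (Y) is a polynomial in psi (H) whose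
   coefficients are, up to sign, those of the characteristic polynomial of psi (H); these
   are integral over o, which forces the entries of Y, elements of the skewfield D, to be
   integral over o and hence to lie in the valuation ring o_D.

   J Gamma lies in Lambda: the coefficient of x at 1 is |G|^-1 times its regular trace,
   each component is free of rank (n_i s_i)^2 over F_i, and the reduced trace maps
   Gamma_i to o_i. Hence r in J induces a map Gamma (x) M -> M, g (x) m |-> (r g) m,
   which carries annihilators of Gamma (x) M to annihilators of M.

   Finally a presentation of M over Lambda also presents Gamma (x) M over Gamma, and the
   family of all Fit_Gamma(h) is directed and consists of o-submodules of the noetherian
   o-module Gamma, so that Fit^max over Gamma is its greatest element. *)
Require Import Defs.
From mathcomp Require Import all_boot all_order all_algebra all_fingroup all_field.
From mathcomp Require Import boolp classical_sets.
From HB Require Import structures.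
From mathcomp Require Import pgroup mxrepresentation generic_quotient ring_quotient.
Set Implicit Arguments.
Unset Strict Implicit.
Unset Printing Implicit Defensive.
Import Order.TTheory GRing.Theory Num.Theory.
Local Open Scope classical_set_scope.
Local Open Scope ring_scope.

(** * Representations over a splitting field *)

(** No Wedderburn decomposition of A is used. Statements about eA are tested through the
    representations [abs_rep], known only by the fact that the E-span of psi(A) is the full matrix
    ring, and [nr] enters only through its characterising property [is_nr].

    The obstacle is a skewfield component: the characteristic polynomial of psi(H) has coefficients
    in E, not in F, and integral elements of a noncommutative ring need not form a ring. Integrality
    is therefore proved for eigenvalues, acting on finitely generated O-modules of row vectors, and
    is brought back to D because a singular f(d) must vanish there.

    The factor |G|/(n_i s_i) balances two traces. Let t be the coefficient at 1 and r = n_i s_i.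
    Freeness of rank r^2 gives |G| t(x) = r^2 Tr(x) for x in F_i, while r t(y gamma) = t(y zeta) for
    the reduced trace zeta of gamma. Hence (|G|/r) t(y gamma) = Tr(y zeta), which lies in o when y
    is in the inverse different. *)

Lemma classically_elim (T : Type) (P : Prop) : classically T -> (T -> P) -> P.
Proof. by move=> /(_ `[< P >]) cT TP; apply/asboolP/cT => /TP/asboolP. Qed.

Section GroupAlgebraRepresentation.
Variables (F : fieldType) (gT : finGroupType) (E : fieldType).
Variables (sigma : {rmorphism F -> E}) (m : nat).
Variable rho : mx_representation E [set: gT]%SET m.
Local Notation A := (grpalg F gT).

Definition grpalg_repr (x : A) : 'M[E]_m :=
  \sum_(g : gT) sigma (grpalg_coef x g) *: rho g.

Fact grpalg_repr_zmod : zmod_morphism grpalg_repr.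
Proof.
move=> x y; rewrite /grpalg_repr -sumrB; apply: eq_bigr => g _.
by rewrite grpalg_coefD grpalg_coefN rmorphB scalerBl.
Qed.

Fact grpalg_repr_monoid : monoid_morphism grpalg_repr.
Proof.
split=> [|x y].
  rewrite /grpalg_repr (bigD1 1%g) //= big1 ?addr0.
    by rewrite grpalg_coef_one eqxx rmorph1 scale1r repr_mx1.
  by move=> g /negPf ng; rewrite grpalg_coef_one ng rmorph0 scale0r.
rewrite /grpalg_repr -mulmxE mulmx_suml.
transitivity (\sum_h \sum_g
    (sigma (grpalg_coef x h) * sigma (grpalg_coef y (h^-1 * g)%g)) *: rho g).
  rewrite exchange_big; apply: eq_bigr => g _.
  rewrite grpalg_coef_mul rmorph_sum scaler_suml; apply: eq_bigr => h _.
  by rewrite rmorphM.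
apply: eq_bigr => h _; rewrite (reindex_inj (mulgI h)) mulmx_sumr.
apply: eq_bigr => k _; rewrite mulKg repr_mxM ?inE // -scalemxAl -scalemxAr.
by rewrite scalerA.
Qed.

HB.instance Definition _ :=
  GRing.isZmodMorphism.Build A 'M[E]_m grpalg_repr grpalg_repr_zmod.
HB.instance Definition _ :=
  GRing.isMonoidMorphism.Build A 'M[E]_m grpalg_repr grpalg_repr_monoid.

Lemma grpalg_reprZ c x : grpalg_repr (c *: x) = sigma c *: grpalg_repr x.
Proof.
rewrite /grpalg_repr scaler_sumr; apply: eq_bigr => g _.
by rewrite grpalg_coefZ rmorphM scalerA.
Qed.

End GroupAlgebraRepresentation.

Definition grpalg_delta (F : fieldType) (gT : finGroupType) (g : gT) : grpalg F gT :=
  [ffun h : gT => (h == g)%:R : F^o].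

Section GroupAlgebraDelta.
Variables (F : fieldType) (gT : finGroupType).
Local Notation A := (grpalg F gT).

Lemma grpalg_coef_delta (g h : gT) :
  grpalg_coef (grpalg_delta F g) h = (h == g)%:R.
Proof. by rewrite /grpalg_coef ffunE. Qed.

Lemma grpalg_coef_sum (I : Type) (r : seq I) (P : pred I) (f : I -> A) g :
  grpalg_coef (\sum_(i <- r | P i) f i) g = \sum_(i <- r | P i) grpalg_coef (f i) g.
Proof.
elim/big_rec2: _ => [|i y x _ IH]; first by rewrite /grpalg_coef ffunE.
by rewrite grpalg_coefD IH.
Qed.

Lemma grpalg_sum_delta (x : A) : x = \sum_g grpalg_coef x g *: grpalg_delta F g.
Proof.
apply: grpalg_eqP => h; rewrite grpalg_coef_sum (bigD1 h) //= big1 ?addr0.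
  by rewrite grpalg_coefZ grpalg_coef_delta eqxx mulr1.
by move=> g /negPf ng; rewrite grpalg_coefZ grpalg_coef_delta eq_sym ng mulr0.
Qed.

Lemma grpalg_coef_mul_delta (x : A) g h :
  grpalg_coef (x * grpalg_delta F g) h = grpalg_coef x (h * g^-1)%g.
Proof.
rewrite grpalg_coef_mul (bigD1 (h * g^-1)%g) //= big1 ?addr0.
  by rewrite grpalg_coef_delta invMg invgK -mulgA mulVg mulg1 eqxx mulr1.
move=> k nk; rewrite grpalg_coef_delta; case: eqP => [e|]; last by rewrite mulr0.
by move: nk; rewrite -e invMg invgK mulKVg eqxx.
Qed.

Lemma grpalg_deltaM (g h : gT) :
  grpalg_delta F g * grpalg_delta F h = grpalg_delta F (g * h)%g.
Proof.
apply: grpalg_eqP => k; rewrite grpalg_coef_mul_delta !grpalg_coef_delta.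
by rewrite (canF_eq (mulgKV h)).
Qed.

Lemma grpalg_delta1 : grpalg_delta F 1%g = 1 :> A.
Proof. by []. Qed.

Lemma grpalg_repr_delta (E : fieldType) (sigma : {rmorphism F -> E}) m
    (rho : mx_representation E [set: gT]%SET m) g :
  grpalg_repr sigma rho (grpalg_delta F g) = rho g.
Proof.
rewrite /grpalg_repr (bigD1 g) //= big1 ?addr0.
  by rewrite grpalg_coef_delta eqxx rmorph1 scale1r.
by move=> h /negPf nh; rewrite grpalg_coef_delta nh rmorph0 scale0r.
Qed.

End GroupAlgebraDelta.

(* Scalar extensions of absolutely irreducible representations of an algebra:
   the E-span of the image is the whole matrix ring (Burnside). *)
Record abs_rep (F : fieldType) (A : falgType F) := AbsRep {
  rep_field : fieldType;
  rep_scalar : {rmorphism F -> rep_field};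
  rep_dim : nat;
  rep_fun :> {rmorphism A -> 'M[rep_field]_rep_dim};
  rep_dim_gt0 : (0 < rep_dim)%N;
  rep_funZ : forall c x, rep_fun (c *: x) = rep_scalar c *: rep_fun x;
  rep_span : forall N : 'M_rep_dim, exists l (c : 'I_l -> rep_field) (a : 'I_l -> A),
    N = \sum_(i < l) c i *: rep_fun (a i) }.

(** The regular representation over a splitting field is faithful on A, and by Maschke it is a sum
    of simple submodules, so x acts nontrivially on one of them. Over a splitting field that
    submodule is absolutely irreducible, which supplies [rep_span]. *)
Lemma exists_abs_rep (F : fieldType) (gT : finGroupType) (x : grpalg F gT) :
  #|gT|%:R != 0 :> F -> x != 0 -> exists psi : abs_rep (grpalg F gT), psi x != 0.
Proof.
move=> cardG x0; apply: (classically_elim (@group_splitting_field_exists gT [set: gT]%SET F)).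
case=> E sigma splitE.
have cardGE : #|[set: gT]%SET|%:R != 0 :> E by rewrite cardsT -(rmorph_nat sigma) fmorph_eq0.
pose R := regular_repr E [set: gT]%SET.
pose Mx := grpalg_repr sigma R x.
have nzM : Mx != 0.
  apply: contra_neq x0 => Mx0; apply: grpalg_eqP => g.
  rewrite /grpalg_coef ffunE -/(grpalg_coef x g); apply/eqP.
  rewrite -(fmorph_eq0 sigma); apply/eqP.
  have /rowP/(_ 0) := congr1 (gring_proj g) Mx0.
  rewrite linear_sum (bigD1 g) //= big1 ?addr0.
    by rewrite linearZ /= gring_projE ?inE // eqxx linear0 !mxE eqxx mulr1.
  by move=> h /negPf nh; rewrite linearZ /= gring_projE ?inE // eq_sym nh scaler0.
have pG : pgroup (negn [pchar E]) [set: gT]%SET by rewrite /pgroup pcharf'_nat.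
have := mx_reducible_semisimple (mxmodule1 R) (mx_Maschke_pchar R pG).
move/classically_elim; apply; case => I W /= simW defW _.
have [i nzWi] : exists i, W i *m Mx != 0.
  apply: contrapT => noW; case/negP: nzM; rewrite -submx0 -[Mx]mul1mx.
  rewrite -(eqmxMr Mx defW) sumsmxMr.
  by apply/sumsmx_subP => i _; rewrite submx0; apply: contrapT => /negP Wi; apply: noW; exists i.
pose rho := submod_repr (mxsimple_module (simW i)).
have /splitE absrho : mx_irreducible rho by apply/submod_mx_irr.
have [m0 [a_ defa]] := mx_abs_irrP absrho.
have spanr (N : 'M_(\rank (W i))) : exists l (c : 'I_l -> E) (a : 'I_l -> grpalg F gT),
    N = \sum_(i < l) c i *: grpalg_repr sigma rho (a i).
  exists #|[set: gT]%SET|, (fun j => a_ (enum_val j) N), (fun j => grpalg_delta F (enum_val j)).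
  rewrite {1}(defa N) big_enum_val; apply: eq_bigr => j _.
  by rewrite grpalg_repr_delta.
exists (AbsRep m0 (@grpalg_reprZ _ _ _ sigma _ rho) spanr) => /=.
apply: contra_neq nzWi => rho0.
rewrite -{1}[W i](in_submodK (submx_refl _)) /Mx /grpalg_repr mulmx_sumr.
transitivity (val_submod (in_submod (W i) (W i) *m grpalg_repr sigma rho x)).
  rewrite /grpalg_repr mulmx_sumr linear_sum; apply: eq_bigr => g _.
  by rewrite -!scalemxAr linearZ /= val_submodJ ?inE.
by rewrite rho0 mulmx0 linear0.
Qed.

(** Commutation with the matrix unit at (j, 0) already compares the entry at (i, j) with the one at
    (0, 0). *)
Lemma center_mx_scalar (R : comNzRingType) (m : nat) (X : 'M[R]_m) :
  (forall N, X *m N = N *m X) -> is_scalar_mx X.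
Proof.
case: m X => [|m] X cX; first by rewrite [X]flatmx0 mx0_is_scalar.
apply/is_scalar_mxP; exists (X ord0 ord0); apply/matrixP => i j.
have /matrixP/(_ i ord0) := cX (delta_mx j ord0); rewrite !mxE.
rewrite (bigD1 j) //= big1 ?addr0; last first.
  by move=> k /negPf nk; rewrite mxE nk mulr0.
rewrite mxE !eqxx mulr1 => ->.
have [->|ne] := eqVneq i j; last first.
  by rewrite big1 // => k _; rewrite mxE (negPf ne) mul0r.
rewrite (bigD1 ord0) //= big1 ?addr0; last first.
  by move=> k /negPf nk; rewrite mxE nk andbF mul0r.
by rewrite mxE !eqxx mul1r mulr1n.
Qed.

Section AbsRep.
Variables (F : fieldType) (A : falgType F) (psi : abs_rep A).
Local Notation E := (rep_field psi).
Local Notation m := (rep_dim psi).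

Definition blockrep b1 b2 (H : 'M[A]_(b1, b2)) :
    'M[E]_(\sum_(i < b1) m, \sum_(j < b2) m) :=
  \mxblock_(i < b1, j < b2) psi (H i j).

Lemma blockrepM b1 b2 b3 (H : 'M[A]_(b1, b2)) (H' : 'M[A]_(b2, b3)) :
  blockrep (H *m H') = blockrep H *m blockrep H'.
Proof.
rewrite /blockrep mul_mxblock; apply: eq_mxblock => i j.
by rewrite mxE rmorph_sum; apply: eq_bigr => k _; rewrite rmorphM.
Qed.

Lemma blockrep_scalar b x a : psi x = a%:M -> blockrep (x%:M : 'M_b) = a%:M.
Proof.
move=> psix; rewrite -(mxdiagZ (p_ := fun=> m)); apply: eq_mxblock => i j.
rewrite mxE; case: eqP => _; first by rewrite mulr1n psix conform_mx_id.
by rewrite mulr0n rmorph0.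
Qed.

Lemma abs_rep_psi1 : psi 1 = 1%:M. Proof. exact: rmorph1. Qed.

Lemma abs_rep_inj1 a b : a%:M = b%:M :> 'M[E]_m -> a = b.
Proof.
move=> /matrixP; have := rep_dim_gt0 psi; case: m => // m' _ /(_ ord0 ord0).
by rewrite !mxE !mulr1n.
Qed.

Lemma abs_rep_center x : (forall y, x * y = y * x) -> exists a, psi x = a%:M.
Proof.
move=> cx; apply/is_scalar_mxP/center_mx_scalar => N.
have [l [c [a ->]]] := rep_span N.
rewrite mulmx_sumr mulmx_suml; apply: eq_bigr => i _.
by rewrite -scalemxAr -scalemxAl !mulmxE -!rmorphM cx.
Qed.

Lemma abs_rep_idem f : (forall y, f * y = y * f) -> f * f = f ->
  psi f = 0 \/ psi f = 1%:M.
Proof.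
move=> /abs_rep_center[a psif] ff.
have /abs_rep_inj1/eqP : (a * a)%:M = a%:M :> 'M[E]_m.
  by rewrite scalar_mxM -psif mulmxE -rmorphM ff.
rewrite -subr_eq0 -{3}[a]mulr1 -mulrBr mulf_eq0 subr_eq0 psif.
by case/orP=> /eqP ->; [left; rewrite raddf0 | right].
Qed.

Lemma abs_rep_nz f : psi f = 1%:M -> f <> 0.
Proof.
move=> + f0; rewrite f0 raddf0 -[0](raddf0 (@scalar_mx E m)) => /abs_rep_inj1/eqP.
by rewrite eq_sym oner_eq0.
Qed.

(** [is_nr] speaks only of primitive central idempotents, so one is needed on which psi is the
    identity. Take a central idempotent f with psi f = 1 and fA of least dimension: for a central
    idempotent g with g f = g, psi g is 0 or 1, and minimality gives f - g = f or g = f. *)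
Lemma exists_primitive_abs_rep :
  exists2 eps, primitive_central_idempotent eps & psi eps = 1%:M.
Proof.
pose P (f : A) := [/\ forall y, f * y = y * f, f * f = f & psi f = 1%:M].
pose mu (f : A) := \dim (limg (amull f)).
have exP : exists n, `[< exists2 f, P f & mu f = n >].
  exists (mu 1); apply/asboolP; exists 1 => //; split; rewrite ?rmorph1 ?mulr1 //.
  by move=> y; rewrite mulr1 mul1r.
case: (ex_minnP exP) => n /asboolP[f [cf ff psif] muf] minf.
have main g : (forall y, g * y = y * g) -> g * g = g -> g * f = g ->
    psi g = 1%:M -> g = f.
  move=> cg gg gf psig.
  have sub : (limg (amull g) <= limg (amull f))%VS.
    apply/subvP => _ /memv_imgP[v _ ->]; apply/memv_imgP.
    by exists (g * v); rewrite ?memvf // !lfunE /= mulrA cf gf.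
  have /eqP eqW : limg (amull g) == limg (amull f).
    rewrite eqEdim sub -/(mu f) muf; apply: minf; apply/asboolP.
    by exists g.
  have : f \in limg (amull f).
    by apply/memv_imgP; exists 1; rewrite ?memvf // lfunE /= mulr1.
  rewrite -eqW => /memv_imgP[v _]; rewrite lfunE /= => fv.
  by rewrite -gf {1}fv mulrA gg.
exists f => //; split=> //; first exact: abs_rep_nz psif.
move=> g [_ cg] gg gf; have cg' y : g * y = y * g by apply: cg.
have [psig|psig] := abs_rep_idem cg' gg; last by right; apply: main.
left; have fg : f * g = g by rewrite cf.
suff : f - g = f by move/(canRL (subrK _)) => e; apply: (addrI f); rewrite addr0.
apply: main.
- by move=> y; rewrite mulrBl mulrBr cf cg'.
- by rewrite mulrBl !mulrBr ff fg gf gg subrr subr0.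
- by rewrite mulrBl ff gf.
- by rewrite raddfB /= psif psig subr0.
Qed.

Lemma is_nr_abs_rep b (H : 'M[A]_b) z :
  is_nr H z -> psi z = (\det (blockrep H))%:M.
Proof.
case=> _ nrz; have [eps prim psie] := exists_primitive_abs_rep.
apply: (nrz eps prim); split=> //; first exact: rep_dim_gt0.
exact: rep_span.
Qed.

End AbsRep.

(** * Integrality over the valuation ring *)

Fact subring_of_mulC (F : fieldType) (O : subringClosed F) :
  commutative (@GRing.mul (subring_of O)).
Proof. by move=> x y; apply: val_inj; rewrite !rmorphM mulrC. Qed.

HB.instance Definition _ (F : fieldType) (O : subringClosed F) :=
  GRing.PzRing_hasCommutativeMul.Build (subring_of O) (@subring_of_mulC F O).

Lemma char_poly_polyOver (R : comNzRingType) (S : subringClosed R) n (M : 'M[R]_n) :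
  (forall i j, M i j \in S) -> char_poly M \is a polyOver S.
Proof.
move=> MS; rewrite /char_poly /determinant rpred_sum // => s _.
rewrite rpredM ?rpred_sign ?rpred_prod // => i _.
by rewrite !mxE rpredB ?polyOverC ?MS // rpredMn ?polyOverX.
Qed.

Lemma exists_irreducible_factor (E : fieldType) (p : {poly E}) :
  (1 < size p)%N -> exists2 q, irreducible_poly q & q %| p.
Proof.
move=> p1; pose P n := `[< exists q : {poly E}, [/\ (1 < size q)%N, q %| p & size q = n] >].
have exP : exists n, P n by exists (size p); apply/asboolP; exists p; rewrite dvdpp.
case: (ex_minnP exP) => n /asboolP[q [q1 qp sq]] minq.
exists q => //; split=> // r r1 rq; rewrite -dvdp_size_eqp // eqn_leq.
have p0 : p != 0 by rewrite -size_poly_gt0 ltnW.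
have q0 : q != 0 by rewrite -size_poly_gt0 ltnW.
have r0 : r != 0 by apply: contraNneq q0 => r0; rewrite -dvd0p -r0.
rewrite dvdp_leq //= sq minq //; apply/asboolP; exists r.
by rewrite ltn_neqAle eq_sym r1 size_poly_gt0 r0 (dvdp_trans rq qp).
Qed.

(** Adjoin a root of an irreducible factor and divide it out. Once a characteristic polynomial
    splits, the integrality of its coefficients can be checked on eigenvalues, each of which has an
    eigenvector. *)
Lemma exists_splitting_field (E : fieldType) (p : {poly E}) : p \is monic ->
  exists (E' : fieldType) (iota : {rmorphism E -> E'}) (rs : seq E'),
    map_poly iota p = \prod_(r <- rs) ('X - r%:P).
Proof.
have [n] := ubnP (size p); elim: n E p => // n IH E p spn pm.
have [p1|p1] := leqP (size p) 1.
  exists E, idfun, [::]; rewrite big_nil map_poly_id //.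
  by move: pm; rewrite (size1_polyC p1) monicE lead_coefC => /eqP ->.
have [q irrq qp] := exists_irreducible_factor p1.
have [L _ [z rootz _]] := irredp_FAdjoin irrq.
have rootpz : root (map_poly (in_alg L) p) z.
  by move: rootz; rewrite -!dvdp_XsubCl => /dvdp_trans -> //; rewrite dvdp_map.
have [r rE] := factor_theorem _ _ rootpz.
have rm : r \is monic.
  by rewrite -(monicMr _ (monicXsubC z)) -rE monic_map.
have sr : (size r < n)%N.
  have := congr1 (fun u : {poly L} => size u) rE.
  rewrite /= size_map_poly size_Mmonic ?monicXsubC ?monic_neq0 // size_XsubC addn2 /= => e.
  by rewrite -ltnS -e.
have [E' [iota [rs e]]] := IH L r sr rm.
exists E', (iota \o in_alg L), (iota z :: rs).
rewrite big_cons map_poly_comp rE rmorphM /= e mulrC.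
by rewrite rmorphB /= map_polyX map_polyC.
Qed.

Section Integrality.
Variables (F : fieldType) (O : subringClosed F).

Definition integral_over (E : fieldType) (sigma : {rmorphism F -> E}) (u : E) : Prop :=
  integralOver (sigma \o (val : subring_of O -> F)) u.

Definition integral_pred (E : fieldType) (sigma : {rmorphism F -> E}) : {pred E} :=
  [pred u | `[< integral_over sigma u >]].

Fact integral_pred_subring_closed (E : fieldType) (sigma : {rmorphism F -> E}) :
  subring_closed (integral_pred sigma).
Proof.
split=> [|u v /asboolP u_ /asboolP v_|u v /asboolP u_ /asboolP v_]; apply/asboolP.
- exact: integral1.
- exact: integral_sub.
- exact: integral_mul.
Qed.

Lemma integral_memP (E : fieldType) (sigma : {rmorphism F -> E}) u :
  reflect (integral_over sigma u) (u \in integral_pred sigma).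
Proof. exact: asboolP. Qed.

HB.instance Definition _ (E : fieldType) (sigma : {rmorphism F -> E}) :=
  GRing.isSubringClosed.Build E (integral_pred sigma)
    (integral_pred_subring_closed sigma).

Lemma integral_overP (E : fieldType) (sigma : {rmorphism F -> E}) u :
  integral_over sigma u <->
  exists p : {poly F}, [/\ p \is monic, p \is a polyOver O & root (map_poly sigma p) u].
Proof.
split=> [[p pm pu]|[p [pm /polyOverP pO pu]]].
  exists (map_poly val p); split; first exact: monic_map.
    by apply/polyOverP => i; rewrite coef_map; apply: valP.
  by rewrite -map_poly_comp.
pose q : {poly subring_of O} := \poly_(i < size p) Subring_of (pO i).
have qE : map_poly (val : subring_of O -> F) q = p.
  apply/polyP => i; rewrite coef_map /= coef_poly; case: ltnP => // le.
  by rewrite nth_default.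
exists q; last by rewrite map_poly_comp qE.
apply/monicP/val_inj.
by rewrite -(lead_coef_map_inj (f := val) val_inj) ?qE ?rmorph0 //; apply/monicP.
Qed.

Lemma integral_over_base (E : fieldType) (sigma : {rmorphism F -> E}) c :
  c \in O -> integral_over sigma (sigma c).
Proof. by move=> cO; apply: (integral_id (sigma \o val) (Subring_of cO)). Qed.

Lemma integral_over_inj (E E' : fieldType) (sigma : {rmorphism F -> E})
    (iota : {rmorphism E -> E'}) u :
  integral_over (iota \o sigma) (iota u) <-> integral_over sigma u.
Proof.
split=> /integral_overP[p [pm pO pu]]; apply/integral_overP; exists p; split=> //.
  by move: pu; rewrite map_poly_comp fmorph_root.
by rewrite map_poly_comp fmorph_root.
Qed.

(** The determinant trick: a nonzero coordinate of the family u is an eigenvector, with eigenvalue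
    a, of the transpose of C. So a is a root of a monic polynomial with integral coefficients, and
    integrality is transitive. *)
Lemma integral_eigenvalue (E : fieldType) (sigma : {rmorphism F -> E}) (I : finType) n
    (u : I -> 'rV[E]_n) (a : E) (C : I -> I -> E) :
    (forall t, a *: u t = \sum_r C t r *: u r) ->
    (exists t, u t != 0) -> (forall t r, integral_over sigma (C t r)) ->
  integral_over sigma a.
Proof.
move=> auC [t0 /rV0Pn[j0 utj]] intC.
pose M : 'M[E]_#|I| := \matrix_(i, j) C (enum_val j) (enum_val i).
have eigM : eigenvalue M a.
  apply/eigenvalueP; exists (\row_i u (enum_val i) 0 j0); last first.
    by apply/rV0Pn; exists (enum_rank t0); rewrite mxE enum_rankK.
  apply/rowP => j; rewrite !mxE; have /rowP/(_ j0) := auC (enum_val j).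
  rewrite mxE summxE => ->.
  rewrite (reindex (enum_val (A := I))) /=; last exact/onW_bij/enum_val_bij.
  apply: eq_bigr => i _.
  by rewrite !mxE mulrC.
have /polyOverP MS : char_poly M \is a polyOver (integral_pred sigma).
  by apply: char_poly_polyOver => i j; rewrite mxE; apply/integral_memP/intC.
apply: (@integral_root_monic _ _ (sigma \o val) _ (char_poly M)).
- exact: char_poly_monic.
- by rewrite -eigenvalue_root_char.
- by apply/integral_poly => i; apply/integral_memP/MS.
Qed.

End Integrality.

Definition alg_horner (F : fieldType) (A : falgType F) (f : {poly F}) (x : A) : A :=
  \sum_(i < size f) f`_i *: x ^+ i.

Section OrderIntegrality.
Variables (F : fieldType) (O : subringClosed F) (A : falgType F).
Variables (Gam : subringClosed A) (N : nat) (g : 'I_N -> A).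
Hypothesis gGam : forall t, g t \in Gam.
Hypothesis gspan : forall x, x \in Gam ->
  exists c : 'I_N -> F, (forall t, c t \in O) /\ x = \sum_t c t *: g t.
Variable psi : abs_rep A.
Local Notation E := (rep_field psi).
Local Notation sigma := (rep_scalar psi).
Local Notation m := (rep_dim psi).

Lemma exists_coordinates : exists cf : A -> 'I_N -> F,
  forall x, x \in Gam -> (forall t, cf x t \in O) /\ x = \sum_t cf x t *: g t.
Proof.
suff H : forall x, exists c : 'I_N -> F, x \in Gam ->
    (forall t, c t \in O) /\ x = \sum_t c t *: g t.
  by have [cf cfP] := choice H; exists cf.
move=> x; case: (boolP (x \in Gam)) => [/gspan[c cP]|xn]; first by exists c.
by exists (fun=> 0).
Qed.

Lemma map_repZ (E' : fieldType) (iota : {rmorphism E -> E'}) c x :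
  map_mx iota (psi (c *: x)) = iota (sigma c) *: map_mx iota (psi x).
Proof. by rewrite rep_funZ map_mxZ. Qed.

Lemma map_rep_sum (E' : fieldType) (iota : {rmorphism E -> E'}) (c : 'I_N -> F) (h : 'I_N -> A) :
  map_mx iota (psi (\sum_t c t *: h t)) =
  \sum_t iota (sigma (c t)) *: map_mx iota (psi (h t)).
Proof. by rewrite !rmorph_sum; apply: eq_bigr => t _; apply: map_repZ. Qed.

(** An eigenvector v of psi(H) is cut into rows v_p of length m. The rows v_p psi(g_t) span a
    finitely generated O-module stable under the eigenvalue a, since a v_q is the sum of the v_p
    psi(H_pq) and each H_pq g_t is an O-combination of the generators of Gam. So all eigenvalues are
    integral, and with them the coefficients. *)
Lemma integral_char_poly b (H : 'M[A]_b) k : (forall i j, H i j \in Gam) ->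
  integral_over O sigma (char_poly (blockrep psi H))`_k.
Proof.
move=> HG; have [cf cfP] := exists_coordinates.
have [E' [iota [rs chi]]] := exists_splitting_field (char_poly_monic (blockrep psi H)).
apply/(integral_over_inj O sigma iota); apply/integral_memP.
rewrite -(coef_map iota) chi.
move: k; apply/(polyOverP (S := integral_pred O (iota \o sigma))); rewrite big_seq;
  apply: rpred_prod => a ars; rewrite polyOverXsubC; apply/integral_memP.
have : eigenvalue (map_mx iota (blockrep psi H)) a.
  by rewrite eigenvalue_root_char -map_char_poly chi root_prod_XsubC.
case/eigenvalueP => v vH v0.
pose vv p := submxrow (q_ := fun=> m) v p.
have vE : v = \mxrow_p vv p by rewrite submxrowK.
have vvH q : a *: vv q = \sum_p vv p *m map_mx iota (psi (H p q)).
  have : \mxrow_q (\sum_p vv p *m map_mx iota (psi (H p q))) = \mxrow_q (a *: vv q).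
    rewrite -mul_mxrow_mxblock -vE.
    rewrite -[RHS](_ : a *: v = _); last by rewrite {1}vE; apply/rowP => j; rewrite !mxE.
    by rewrite -vH; congr (_ *m _); apply/matrixP => i j; rewrite !mxE.
  by move/eq_mxrowP => ->.
pose u (pt : 'I_b * 'I_N) := vv pt.1 *m map_mx iota (psi (g pt.2)).
apply: (integral_eigenvalue (u := u) (C := fun qt pr =>
   iota (sigma (cf (H pr.1 qt.1 * g qt.2) pr.2)))).
- case=> q t /=; rewrite /u /= scalemxAl vvH mulmx_suml -(pair_bigA _ (fun p r =>
    iota (sigma (cf (H p q * g t) r)) *: (vv p *m map_mx iota (psi (g r))))) /=.
  apply: eq_bigr => p _; have HgG : H p q * g t \in Gam by rewrite rpredM.
  rewrite -mulmxA -map_mxM mulmxE -rmorphM {1}(cfP _ HgG).2 map_rep_sum mulmx_sumr.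
  by apply: eq_bigr => r _; rewrite -scalemxAr.
(* Not all these rows vanish: 1 lies in Gam, so each v_p is a combination of the v_p psi(g_t). *)
- apply: contrapT => u0; case/negP: v0; apply/eqP; rewrite vE.
  suff vv0 p : vv p = 0 by apply/rowP => j; rewrite mxE vv0 !mxE.
  rewrite -[vv p]mulmx1 -(map_mx1 iota) -(abs_rep_psi1 psi) (cfP _ (rpred1 _)).2.
  rewrite map_rep_sum mulmx_sumr big1 // => t _; rewrite -scalemxAr.
  suff -> : vv p *m map_mx iota (psi (g t)) = 0 by rewrite scaler0.
  by apply: contrapT => /eqP u0'; apply: u0; exists (p, t).
- case=> q t [p r] /=; apply: integral_over_base.
  by apply: (cfP _ _).1; rewrite rpredM.
Qed.

(** Here x need not lie in Gam, but an eigenvalue a of psi(x) is still integral, by letting a act on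
    the rows v psi(g_t) attached to an eigenvector v. A monic f over O with root a then makes
    psi(f(x)) kill v. *)
Lemma integral_combination (x : A) l (c : 'I_l -> E) (gam : 'I_l -> A) :
    (forall s, integral_over O sigma (c s)) -> (forall s, gam s \in Gam) ->
    psi x = \sum_s c s *: psi (gam s) ->
  exists f : {poly F}, [/\ f \is monic, f \is a polyOver O
    & \det (psi (alg_horner f x)) = 0].
Proof.
move=> intc gamG psix; have [cf cfP] := exists_coordinates.
have [E' [iota [rs chi]]] := exists_splitting_field (char_poly_monic (psi x)).
have [a ars] : exists a, a \in rs.
  have := congr1 (fun p : {poly E'} => size p) chi.
  rewrite /= size_map_poly size_char_poly size_prod_XsubC.
  by case: rs {chi} => [|a rs _]; [have := rep_dim_gt0 psi; case: m | exists a; rewrite mem_head].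
have : eigenvalue (map_mx iota (psi x)) a.
  by rewrite eigenvalue_root_char -map_char_poly chi root_prod_XsubC.
case/eigenvalueP => v vx v0.
have inta : integral_over O (iota \o sigma) a.
  pose u t := v *m map_mx iota (psi (g t)).
  apply: (integral_eigenvalue (u := u) (C := fun t r =>
     \sum_s iota (c s) * iota (sigma (cf (gam s * g t) r)))).
  - move=> t; rewrite /u scalemxAl -vx psix raddf_sum mulmx_sumr mulmx_suml.
    under [RHS]eq_bigr do rewrite scaler_suml.
    rewrite exchange_big; apply: eq_bigr => s _.
    have HgG : gam s * g t \in Gam by rewrite rpredM.
    rewrite /= map_mxZ -scalemxAr -scalemxAl -mulmxA -map_mxM mulmxE -rmorphM.
    rewrite {1}(cfP _ HgG).2 map_rep_sum mulmx_sumr scaler_sumr.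
    by apply: eq_bigr => r _; rewrite -scalemxAr scalerA.
  - apply: contrapT => u0; case/negP: v0; apply/eqP.
    rewrite -[v]mulmx1 -(map_mx1 iota) -(abs_rep_psi1 psi) (cfP _ (rpred1 _)).2.
    rewrite map_rep_sum mulmx_sumr big1 // => t _; rewrite -scalemxAr.
    suff -> : v *m map_mx iota (psi (g t)) = 0 by rewrite scaler0.
    by apply: contrapT => /eqP u0'; apply: u0; exists t.
  - move=> t r; apply/integral_memP; apply: rpred_sum => s _; apply: rpredM; apply/integral_memP.
      exact/integral_over_inj.
    by apply: integral_over_base; apply: (cfP _ _).1; rewrite rpredM.
have [f [fm fO fa]] := (integral_overP _ _ _).1 inta.
exists f; split=> //; apply/eqP; rewrite -(fmorph_eq0 iota) -det_map_mx.
apply/det0P; exists v => //.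
have vxi i : v *m map_mx iota (psi (x ^+ i)) = a ^+ i *: v.
  elim: i => [|i IH]; first by rewrite !expr0 rmorph1 map_mx1 mulmx1 scale1r.
  by rewrite exprSr rmorphM -mulmxE map_mxM mulmxA IH -scalemxAl vx scalerA -exprSr.
rewrite /alg_horner !rmorph_sum mulmx_sumr.
under eq_bigr => i _ do rewrite /= map_repZ -scalemxAr vxi scalerA.
rewrite -scaler_suml; move: fa; rewrite /root horner_coef.
rewrite size_map_poly => /eqP; under eq_bigr do rewrite coef_map /=.
by move=> ->; rewrite scale0r.
Qed.

End OrderIntegrality.

(** * Components that are matrix rings over a commutative ring *)

Section MatrixUnits.
Variables (F : fieldType) (A : falgType F) (R : nzRingType) (n : nat).
Variables (phi : 'M[R]_n -> A) (e : A) (S : set A).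
Hypothesis iso : matrix_iso phi e S.
Hypothesis ec : forall x, e * x = x * e.

Definition munit (k l : 'I_n) : A := phi (delta_mx k l).
(** The classical coordinate of x at (k, l): the result commutes with all matrix units, and on phi X
    it is the scalar matrix of the entry X_kl. The formula makes sense on all of A, so taking
    coordinates needs no denominators. *)
Definition mentry (k l : 'I_n) (x : A) : A := \sum_r munit r k * x * munit l r.

Lemma miso_add X Y : phi (X + Y) = phi X + phi Y. Proof. by case: iso. Qed.

Lemma miso_mul X Y : phi (X *m Y) = phi X * phi Y. Proof. by case: iso. Qed.

Lemma miso_one : phi 1%:M = e. Proof. by case: iso. Qed.

Lemma miso_inj : injective phi. Proof. by case: iso. Qed.

Lemma miso_zero : phi 0 = 0.
Proof. by apply: (addrI (phi 0)); rewrite -miso_add !addr0. Qed.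

Lemma miso_sum (I : Type) (r : seq I) (P : pred I) (X : I -> 'M_n) :
  phi (\sum_(i <- r | P i) X i) = \sum_(i <- r | P i) phi (X i).
Proof.
elim/big_rec2: _ => [|i y x _ <-]; first exact: miso_zero.
by rewrite miso_add.
Qed.

Lemma miso_natmul X k : phi (X *+ k) = phi X *+ k.
Proof. by elim: k => [|k IH]; rewrite ?mulr0n ?miso_zero // !mulrS miso_add IH. Qed.

Lemma miso_opp X : phi (- X) = - phi X.
Proof. by apply: (addIr (phi X)); rewrite -miso_add !addNr miso_zero. Qed.

Lemma miso_mull X : e * phi X = phi X.
Proof. by rewrite -miso_one -miso_mul mul1mx. Qed.

Lemma miso_mulr X : phi X * e = phi X.
Proof. by rewrite -ec miso_mull. Qed.

Lemma miso_image X : S (phi X).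
Proof. by case: iso => _ _ _ _ <-; exists X. Qed.

Lemma miso_preimage x : S x -> exists X, phi X = x.
Proof. by case: iso => _ _ _ _ <- [X _ <-]; exists X. Qed.

Lemma munitM k l k' l' : munit k l * munit k' l' = munit k l' *+ (l == k').
Proof. by rewrite /munit -miso_mul mul_delta_mx_cond miso_natmul. Qed.

Lemma sum_munit : \sum_k munit k k = e.
Proof. by rewrite /munit -miso_sum -miso_one mx1_sum_delta. Qed.

Lemma mul_mentry_munit p q k l x : mentry k l x * munit p q = munit p k * x * munit l q.
Proof.
rewrite /mentry mulr_suml (bigD1 p) //= big1 ?addr0 => [|r rp].
  by rewrite -!mulrA munitM eqxx.
by rewrite -!mulrA munitM (negPf rp) !mulr0.
Qed.

Lemma mentry_decomp x : x * e = \sum_k \sum_l mentry k l x * munit k l.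
Proof.
have -> : x * e = e * x * e by rewrite ec -mulrA -miso_one -miso_mul mul1mx.
rewrite -{1}sum_munit !mulr_suml; apply: eq_bigr => k _.
rewrite -sum_munit mulr_sumr; apply: eq_bigr => l _.
by rewrite mul_mentry_munit.
Qed.

Lemma mentry_phi k l X : mentry k l (phi X) = phi (X k l)%:M.
Proof.
rewrite /mentry /munit; under eq_bigr do rewrite -!miso_mul.
rewrite -miso_sum; congr phi; apply/matrixP => i j; rewrite summxE !mxE.
rewrite (bigD1 i) //= big1 ?addr0 => [|r ri]; last first.
  by rewrite -mulmxA !mxE big1 // => t _; rewrite mxE eq_sym (negPf ri) mul0r.
rewrite !mxE (bigD1 l) //= big1 ?addr0 => [|r rl]; last first.
  by rewrite !mxE (negPf rl) mulr0.
rewrite !mxE (bigD1 k) //= big1 ?addr0 => [|r rl]; last first.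
  by rewrite !mxE (negPf rl) andbF mul0r.
by rewrite !mxE !eqxx mul1r eq_sym; case: eqP; rewrite ?mulr1 ?mulr0.
Qed.

Lemma mentryD k l x y : mentry k l (x + y) = mentry k l x + mentry k l y.
Proof. by rewrite /mentry -big_split; apply: eq_bigr => r _; rewrite mulrDr mulrDl. Qed.

Lemma mentryZ k l c x : mentry k l (c *: x) = c *: mentry k l x.
Proof.
by rewrite /mentry scaler_sumr; apply: eq_bigr => r _; rewrite -scalerAr -scalerAl.
Qed.

Lemma mentryM k l y x : (forall p q, y * munit p q = munit p q * y) ->
  mentry k l (y * x) = y * mentry k l x.
Proof.
by move=> yc; rewrite /mentry mulr_sumr; apply: eq_bigr => r _; rewrite !mulrA yc.
Qed.

Lemma mentry_munit k l p q : mentry k l (munit p q) = e *+ ((k == p) && (l == q)).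
Proof.
rewrite mentry_phi mxE; case: andP => _; first by rewrite miso_one.
by rewrite raddf0 miso_zero.
Qed.

Lemma mentry_mule k l x : mentry k l (x * e) = mentry k l x.
Proof.
rewrite /mentry; apply: eq_bigr => r _.
by rewrite mulrA -[_ * e * _]mulrA /munit miso_mull.
Qed.

Lemma mentry_mul_munit k l p q y : y * e = y ->
    (forall p q, y * munit p q = munit p q * y) ->
  mentry k l (y * munit p q) = y *+ ((k, l) == (p, q)).
Proof.
by move=> ye yc; rewrite mentryM // mentry_munit mulrnAr ye xpair_eqE.
Qed.

End MatrixUnits.

Lemma miso_component (F : fieldType) (A : falgType F) (R : nzRingType) (n : nat)
    (phi : 'M[R]_n -> A) (e : A) (Gam : subringClosed A) x :
    matrix_iso phi e (component [set` Gam] e) -> (forall x, e * x = x * e) ->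
  x \in Gam -> exists X, x * e = phi X.
Proof.
move=> iso ec xG; have [|X XE] := miso_preimage (x := e * x) iso; first by exists x.
by exists X; rewrite XE ec.
Qed.

(** Lets an F-linear identity on A be checked on elements of the lattice, where phi is available. *)
Definition full_lattice (F : fieldType) (A : falgType F) (S : {pred A}) : Prop :=
  forall x : A, exists2 a : F, a != 0 & a *: x \in S.

(** The sizes p and q are equal only through the existence of P and Q, hence the rectangular
    types. *)
Lemma det_similar (R : comNzRingType) p q (P : 'M[R]_(p, q)) (Q : 'M[R]_(q, p))
    (M : 'M[R]_q) (M' : 'M[R]_p) :
  P *m Q = 1%:M -> Q *m P = 1%:M -> P *m M = M' *m P -> \det M = \det M'.
Proof.
move=> PQ QP; have pq : p = q.
  by apply/anti_leq; rewrite (mulmx1_min PQ) (mulmx1_min QP).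
subst q => PM; have : \det P * \det M = \det M' * \det P by rewrite -!det_mulmx PM.
have PQ1 : \det P * \det Q = 1 by rewrite -det_mulmx PQ det1.
by move/(congr1 ( *%R^~ (\det Q))); rewrite /= mulrAC PQ1 mul1r -mulrA PQ1 mulr1.
Qed.

Section CommutativeComponent.
Variables (F : fieldType) (A : falgType F) (R : comNzRingType) (n : nat).
Variables (phi : 'M[R]_n -> A) (e : A) (Gam : subringClosed A).
Hypothesis n0 : (0 < n)%N.
Hypothesis iso : matrix_iso phi e (component [set` Gam] e).
Hypothesis ec : forall x, e * x = x * e.
Hypothesis ee : e * e = e.
Hypothesis Gam_full : full_lattice Gam.

Lemma miso_scalar_center r x : phi r%:M * x = x * phi r%:M.
Proof.
have [a a0 axG] := Gam_full x; have [X XE] := miso_component iso ec axG.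
apply: (scalerI a0); rewrite scalerAr scalerAl.
have -> : phi r%:M * (a *: x) = phi r%:M * phi X.
  by rewrite -XE -ec mulrA (miso_mulr iso ec).
have -> : a *: x * phi r%:M = phi X * phi r%:M.
  by rewrite -XE -mulrA (miso_mull iso).
by rewrite -!(miso_mul iso) scalar_mxC.
Qed.

Section Splitting.
Variable psi : abs_rep A.
Hypothesis psie : psi e = 1%:M.
Local Notation E := (rep_field psi).
Local Notation m := (rep_dim psi).

Lemma exists_center_morph : exists rho : {rmorphism R -> E},
  forall r, psi (phi r%:M) = (rho r)%:M.
Proof.
have /choice[rho rhoP] : forall r, exists a, psi (phi r%:M) = a%:M.
  by move=> r; apply: abs_rep_center => x; apply: miso_scalar_center.
have rhoB : zmod_morphism rho.
  move=> x y; apply: (@abs_rep_inj1 _ _ psi); rewrite [RHS]raddfB /= -!rhoP.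
  by rewrite (raddfB (@scalar_mx R n)) /= (miso_add iso) (miso_opp iso) rmorphB.
have rhoM : monoid_morphism rho.
  split=> [|x y]; apply: (@abs_rep_inj1 _ _ psi); rewrite -rhoP.
    by rewrite (miso_one iso).
  by rewrite !scalar_mxM -!rhoP (miso_mul iso) rmorphM.
pose Z := GRing.isZmodMorphism.Build R E rho rhoB.
pose Mm := GRing.isMonoidMorphism.Build R E rho rhoM.
pose rhom : {rmorphism R -> E} := HB.pack rho Z Mm.
by exists rhom.
Qed.

(* The rows v E_0k, for a nonzero row v = v E_00, span a psi-stable subspace. *)
Lemma exists_intertwiner (rho : {rmorphism R -> E}) :
    (forall r, psi (phi r%:M) = (rho r)%:M) ->
  exists (P : 'M[E]_(n, m)) (Q : 'M[E]_(m, n)),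
    [/\ P *m Q = 1%:M, Q *m P = 1%:M
      & forall X, P *m psi (phi X) = map_mx rho X *m P].
Proof.
move=> rhoP; pose k0 := Ordinal n0; pose U := munit phi.
(* psi cannot kill E_00: each E_kk is E_k0 E_00 E_0k, and these sum to e with psi e = 1. *)
have [i vi] : exists i, row i (psi (U k0 k0)) != 0.
  apply: contrapT => nov; have U0 : psi (U k0 k0) = 0.
    apply/row_matrixP => i; rewrite row0; apply: contrapT => /eqP ri; apply: nov.
    by exists i.
  have /(congr1 psi) := sum_munit iso; rewrite psie rmorph_sum big1.
    by rewrite -[0](raddf0 (@scalar_mx E m)) => /abs_rep_inj1/eqP; rewrite eq_sym oner_eq0.
  move=> k _; rewrite -[munit phi k k](_ : U k k0 * U k0 k0 * U k0 k = _).
    by rewrite !rmorphM U0 mulr0 mul0r.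
  by rewrite !(munitM iso) !eqxx.
set v := row i _ in vi.
have vU : v *m psi (U k0 k0) = v.
  by rewrite /v -row_mul mulmxE -rmorphM (munitM iso) eqxx.
pose P : 'M[E]_(n, m) := \matrix_k (v *m psi (U k0 k)).
have PX X : P *m psi (phi X) = map_mx rho X *m P.
  apply/row_matrixP => k; rewrite !row_mul rowK -mulmxA mulmxE -rmorphM.
  have -> : U k0 k * phi X = \sum_l phi (X k l)%:M * U k0 l.
    rewrite /U /munit -(miso_mul iso); under eq_bigr do rewrite -(miso_mul iso).
    rewrite -(miso_sum iso); congr phi; apply/matrixP => p q.
    rewrite !mxE summxE (bigD1 k) //= big1 ?addr0 => [|l lk]; last first.
      by rewrite mxE (negPf lk) andbF mul0r.
    rewrite (bigD1 q) //= big1 ?addr0 => [|l lq]; last first.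
      by rewrite mul_scalar_mx !mxE [q == l]eq_sym (negPf lq) andbF mulr0.
    rewrite mul_scalar_mx !mxE !eqxx !andbT mulrC.
    by [].
  rewrite rmorph_sum mulmx_sumr mulmx_sum_row; apply: eq_bigr => l _.
  by rewrite rmorphM rhoP -mulmxE mul_scalar_mx -scalemxAr rowK !mxE.
have rowP0 : row k0 P = v by rewrite rowK vU.
have stabP x : (P *m psi x <= P)%MS.
  have [a a0 axG] := Gam_full x; have [X XE] := miso_component iso ec axG.
  have sa0 : rep_scalar psi a != 0 by rewrite fmorph_eq0.
  rewrite -[psi x](scalerK sa0) -rep_funZ -[psi (a *: x)]mulmx1 -psie mulmxE -rmorphM XE.
  by rewrite -scalemxAr scalemx_sub // PX submxMl.
(* The E-span of psi(A) is the whole matrix ring, so the row space of P, which is stable and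
   contains v, is everything. *)
have stabN N : (P *m N <= P)%MS.
  have [l [c [a ->]]] := rep_span N; rewrite mulmx_sumr summx_sub // => j _.
  by rewrite -scalemxAr scalemx_sub.
have vfree : row_free v by rewrite /row_free rank_rV vi.
have Pfull : row_full P.
  rewrite -sub1mx; apply/row_subP => j.
  rewrite -[row j _]mul1mx -(mulmxVp vfree) -mulmxA.
  by rewrite -{1}rowP0 rowE -mulmxA (submx_trans _ (stabN (pinvmx v *m row j 1%:M))) // submxMl.
(* In a relation u P = 0, right multiplication by psi(E_l0) leaves u_l v. *)
have Pfree : row_free P.
  apply/inj_row_free => u uP; apply/rowP => l; rewrite mxE.
  have : u *m P *m psi (U l k0) = 0 by rewrite uP mul0mx.
  rewrite -mulmxA PX mulmxA => /eqP.
  have -> : u *m map_mx rho (delta_mx l k0) *m P = u 0 l *: v.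
    rewrite -rowP0 rowE scalemxAl; congr (_ *m _); rewrite map_delta_mx.
    apply/rowP => j; rewrite !mxE (bigD1 l) //= big1 ?addr0 => [|j' j'l].
      by rewrite !mxE eqxx.
    by rewrite mxE (negPf j'l) mulr0.
  by rewrite scaler_eq0 (negPf vi) orbF => /eqP.
exists P, (pinvmx P); split=> //; first exact: mulmxVp.
exact: mulVpmx.
Qed.

(** The intertwiner P, repeated along the diagonal, conjugates the block matrix of psi(H) into the
    image under rho of an nb by nb matrix over R. So the reduced norm is an ordinary determinant
    over R. *)
Lemma det_blockrep_miso b (H : 'M[A]_b) (X : 'I_b -> 'I_b -> 'M[R]_n) :
    (forall i j, H i j * e = phi (X i j)) ->
  psi (phi (\det (\mxblock_(i < b, j < b) X i j))%:M) = (\det (blockrep psi H))%:M.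
Proof.
move=> HX; have [rho rhoP] := exists_center_morph.
have [P [Q [PQ QP PX]]] := exists_intertwiner rhoP.
rewrite rhoP -det_map_mx; congr _%:M; apply/esym.
have diagM (p q r : nat) (M : 'M[E]_(p, q)) (M' : 'I_b -> 'I_b -> 'M[E]_(q, r)) :
    \mxblock_(i < b, j < b) (M *+ (i == j)) *m \mxblock_(i < b, j < b) M' i j =
    \mxblock_(i < b, j < b) (M *m M' i j).
  rewrite mul_mxblock; apply: eq_mxblock => i j.
  rewrite (bigD1 i) //= big1 ?addr0 => [|k ki]; first by rewrite eqxx mulr1n.
  by rewrite eq_sym (negPf ki) mulr0n mul0mx.
have oneE p : \mxblock_(i < b, j < b) ((1%:M : 'M[E]_p) *+ (i == j)) = 1%:M.
  rewrite -(mxdiagZ (p_ := fun=> p)); apply: eq_mxblock => i j.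
  by case: eqP => _; rewrite ?mulr0n // mulr1n conform_mx_id.
have mulnE p q r (M : 'M[E]_(p, q)) (M' : 'M[E]_(q, r)) (c : bool) :
  M *m (M' *+ c) = (M *m M') *+ c by case: c; rewrite ?mulr1n // !mulr0n mulmx0.
apply: (@det_similar _ _ _ (\mxblock_(i < b, j < b) (P *+ (i == j)))
          (\mxblock_(i < b, j < b) (Q *+ (i == j)))).
- by rewrite diagM // -oneE; apply: eq_mxblock => i j; rewrite mulnE PQ.
- by rewrite diagM // -oneE; apply: eq_mxblock => i j; rewrite mulnE QP.
- rewrite diagM // -[map_mx _ _](_ : \mxblock_(i < b, j < b) map_mx rho (X i j) = _);
    last by apply/matrixP => i j; rewrite !mxE.
  rewrite mul_mxblock; apply: eq_mxblock => i j.
  rewrite (bigD1 j) //= big1 ?addr0 => [|k kj].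
    by rewrite eqxx mulr1n -PX -HX rmorphM psie mulr1.
  by rewrite (negPf kj) mulr0n mulmx0.
Qed.

End Splitting.

Hypothesis sep : forall x : A, x != 0 -> exists psi : abs_rep A, psi x != 0.
Hypothesis eGam : e \in Gam.

Lemma component_sub x : component [set` Gam] e x -> x \in Gam.
Proof. by case=> y yG <-; rewrite rpredM. Qed.

Lemma commutative_adjoint b (H : 'M[A]_b) z :
    (forall i j, H i j \in Gam) -> is_nr H z ->
  exists Y : 'M[A]_b,
    [/\ forall i j, Y i j \in Gam, Y *m H = (z * e)%:M & z * e \in Gam].
Proof.
move=> HG nrz.
have HXf (ij : 'I_b * 'I_b) : exists X, H ij.1 ij.2 * e = phi X.
  exact: miso_component iso ec _.
have [Xf XfP] := choice HXf.
pose X i j := Xf (i, j); have HX i j : H i j * e = phi (X i j) by rewrite (XfP (i, j)).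
pose XX := \mxblock_(i < b, j < b) X i j; pose d := \det XX.
have zd : z * e = phi d%:M.
  (* The identity is tested on every [abs_rep]: where psi e = 0 both sides vanish, and where psi e =
     1 both are the determinant of the block matrix. *)
  apply/eqP; rewrite -subr_eq0; apply: contraT => /sep[psi].
  rewrite raddfB /= rmorphM.
  have [p0|p1] := abs_rep_idem psi ec ee.
    by rewrite -(miso_mull iso d%:M) rmorphM p0 mulr0 mul0r subr0 eqxx.
  by rewrite p1 mulr1 (is_nr_abs_rep psi nrz) (det_blockrep_miso p1 HX) subrr eqxx.
have phiG Z : phi Z \in Gam by apply: component_sub; apply: (miso_image iso).
pose Y : 'M[A]_b := \matrix_(i, j) phi (submxblock (\adj XX) i j).
exists Y; split=> [i j||]; [by rewrite mxE | | by rewrite zd].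
apply/matrixP => i j; rewrite !mxE.
transitivity (phi (\sum_k (submxblock (\adj XX) i k *m X k j))).
  rewrite (miso_sum iso); apply: eq_bigr => k _.
  by rewrite mxE (miso_mul iso) -HX -ec mulrA (miso_mulr iso ec).
have : \mxblock_(i < b, j < b) \sum_k (submxblock (\adj XX) i k *m X k j) =
       \mxblock_(i < b, j < b) ((d%:M : 'M[R]_n) *+ (i == j)).
  rewrite -mul_mxblock submxblockK mul_adj_mx -(mxdiagZ (p_ := fun=> n)).
  apply: eq_mxblock => p q.
  by case: eqP => _; rewrite ?mulr0n // mulr1n conform_mx_id.
by move/eq_mxblockP => ->; rewrite (miso_natmul iso) zd.
Qed.

End CommutativeComponent.

(** * Traces and the conductor *)

Section LinearForms.
Variables (F : fieldType) (A : falgType F).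

Definition lin_form (xi : A -> F) : Prop := forall c x y, xi (c *: x + y) = c * xi x + xi y.

Lemma lin_formZ xi c x : lin_form xi -> xi (c *: x) = c * xi x.
Proof.
move=> xil; have xi0 : xi 0 = 0.
  have := xil 1 0 0; rewrite scale1r addr0 mul1r => x0.
  by apply: (addrI (xi 0)); rewrite -x0 addr0.
by rewrite -[c *: x]addr0 xil xi0 addr0.
Qed.

Lemma lin_form_sum xi (I : Type) (r : seq I) (P : pred I) (f : I -> A) : lin_form xi ->
  xi (\sum_(i <- r | P i) f i) = \sum_(i <- r | P i) xi (f i).
Proof.
move=> xil; elim/big_rec2: _ => [|i y x _ <-].
  by rewrite -(scale0r (0 : A)) lin_formZ // mul0r.
by rewrite -[f i]scale1r xil mul1r scale1r.
Qed.

(** The transition matrix from X to X' has a one-sided inverse, which bounds #|J| by #|J'|; symmetry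
    gives the other bound. *)
Lemma dual_family_card (J J' : finType) (X : J -> A) (xi : J -> A -> F)
    (X' : J' -> A) (xi' : J' -> A -> F) :
    (forall j, lin_form (xi j)) -> (forall j, lin_form (xi' j)) ->
    (forall j, X j = \sum_i xi' i (X j) *: X' i) ->
    (forall j, X' j = \sum_i xi i (X' j) *: X i) ->
    (forall i j, xi i (X j) = (i == j)%:R) -> (forall i j, xi' i (X' j) = (i == j)%:R) ->
  #|J| = #|J'|.
Proof.
move=> xil xil' XX' X'X dX dX'.
have half (K K' : finType) (Y : K -> A) (Y' : K' -> A) (eta : K -> A -> F) (eta' : K' -> A -> F) :
    (forall j, lin_form (eta j)) -> (forall j, Y j = \sum_i eta' i (Y j) *: Y' i) ->
    (forall i j, eta i (Y j) = (i == j)%:R) -> (#|K| <= #|K'|)%N.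
  move=> etal YY' dY.
  pose M : 'M[F]_(#|K|, #|K'|) := \matrix_(i, j) eta' (enum_val j) (Y (enum_val i)).
  pose M' : 'M[F]_(#|K'|, #|K|) := \matrix_(i, j) eta (enum_val j) (Y' (enum_val i)).
  apply: (@mulmx1_min _ _ _ M M'); apply/matrixP => i j; rewrite !mxE.
  rewrite -(inj_eq enum_val_inj) eq_sym -dY {1}(YY' (enum_val i)) (lin_form_sum _ _ _ (etal _)).
  rewrite (reindex (enum_val (A := K'))) /=; last exact/onW_bij/enum_val_bij.
  by apply: eq_bigr => k _; rewrite !mxE lin_formZ.
by apply/anti_leq; rewrite (half _ _ _ _ _ _ xil XX' dX) (half _ _ _ _ _ _ xil' X'X dX').
Qed.

(* eA is a free left U-module with basis a; kappa gives the coordinates. *)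
Definition free_over (e : A) (U : {vspace A}) (I : finType) (a : I -> A)
    (kappa : I -> A -> A) : Prop :=
  [/\ forall k c x y, kappa k (c *: x + y) = c *: kappa k x + kappa k y,
      forall k x, kappa k x \in U,
      forall x, x * e = \sum_k kappa k x * a k
    & forall k j y, y \in U -> kappa k (y * a j) = y *+ (k == j)].

Section FreeOver.
Variables (e : A) (U : {vspace A}) (I : finType) (a : I -> A) (kappa : I -> A -> A).
Hypothesis fr : free_over e U a kappa.
Local Notation f l := ((vbasis U)`_l).

Definition fvec (kl : I * 'I_(\dim U)) : A := f kl.2 * a kl.1.
Definition fform (kl : I * 'I_(\dim U)) (x : A) : F := coord (vbasis U) kl.2 (kappa kl.1 x).

Lemma vbasis_memE (l : 'I_(\dim U)) : f l \in U.
Proof. by rewrite vbasis_mem // mem_nth // size_tuple. Qed.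

Lemma fform_lin kl : lin_form (fform kl).
Proof. by case: fr => kl_lin _ _ _ c x y; rewrite /fform kl_lin linearP. Qed.

Lemma fvec_decomp x : x * e = \sum_kl fform kl x *: fvec kl.
Proof.
case: fr => _ kU xe _; rewrite xe -(pair_bigA _ (fun k l => fform (k, l) x *: fvec (k, l))) /=.
apply: eq_bigr => k _; rewrite {1}(coord_vbasis (kU k x)) mulr_suml.
by apply: eq_bigr => l _; rewrite scalerAl.
Qed.

Lemma fform_fvec kl kl' : fform kl (fvec kl') = (kl == kl')%:R.
Proof.
case: fr => _ _ _ dual; case: kl kl' => [k l] [k' l'].
rewrite /fform /fvec /= dual ?vbasis_memE // xpair_eqE; case: eqP => [_|_].
  by rewrite mulr1n coord_free ?(basis_free (vbasisP U)) // eq_sym.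
by rewrite mulr0n linear0.
Qed.

End FreeOver.

(** Both sides are the dimension of eA over F, counted with two bases. The lemma serves to compare
    the centre with the embedded skewfield. *)
Lemma free_over_dim e (U U' : {vspace A}) (I I' : finType) (a : I -> A) (a' : I' -> A)
    kappa kappa' :
    (forall x, e * x = x * e) -> e * e = e ->
    (forall x, x \in U -> x * e = x) -> (forall x, x \in U' -> x * e = x) ->
    free_over e U a kappa -> free_over e U' a' kappa' ->
  (#|I| * \dim U = #|I'| * \dim U')%N.
Proof.
move=> ec ee Ue Ue' fr fr'.
rewrite -[\dim U]card_ord -[\dim U']card_ord -!card_prod.
have fe (V : {vspace A}) (K : finType) (b : K -> A) kl : (forall x, x \in V -> x * e = x) ->
    fvec (U := V) b kl * e = fvec b kl.
  by move=> Ve; rewrite /fvec -mulrA -ec mulrA Ve ?vbasis_memE.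
apply: (dual_family_card (fform_lin fr) (fform_lin fr') _ _ (fform_fvec fr) (fform_fvec fr')).
- by move=> j; rewrite -{1}(fe _ _ _ _ Ue) (fvec_decomp fr').
- by move=> j; rewrite -{1}(fe _ _ _ _ Ue') (fvec_decomp fr).
Qed.

End LinearForms.

Section RegularTrace.
Variables (F : fieldType) (gT : finGroupType).
Local Notation A := (grpalg F gT).
Local Notation t x := (grpalg_coef x 1%g).

Lemma grpalg_coef1_mulC (x y : A) : t (x * y) = t (y * x).
Proof.
rewrite !grpalg_coef_mul (reindex_inj invg_inj) /=; apply: eq_bigr => h _.
by rewrite invgK !mulg1 mulrC.
Qed.

Lemma grpalg_coef1E (x : A) g : grpalg_coef x g = t (x * grpalg_delta F g^-1%g).
Proof. by rewrite grpalg_coef_mul_delta mul1g invgK. Qed.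

(* X need not be a basis: any family with X-expansions of the image of x computes
   the trace of multiplication by x, which on the basis of group elements is |G| x(1). *)
Lemma regular_trace (I : finType) (X : I -> A) (xi : I -> A -> F) (x : A) :
    (forall i, lin_form (xi i)) -> (forall v, x * v = \sum_i xi i (x * v) *: X i) ->
  \sum_i xi i (x * X i) = #|gT|%:R * t x.
Proof.
move=> xil frame.
transitivity (\sum_g grpalg_coef (x * grpalg_delta F g) g); last first.
  rewrite (eq_bigr (fun=> t x)) => [|g _]; last by rewrite grpalg_coef_mul_delta mulgV.
  by rewrite sumr_const mulr_natl.
under [RHS]eq_bigr => g _ do rewrite frame grpalg_coef_sum.
rewrite exchange_big; apply: eq_bigr => i _.
rewrite {1}[X i]grpalg_sum_delta mulr_sumr lin_form_sum //; apply: eq_bigr => g _.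
by rewrite -scalerAr lin_formZ // grpalg_coefZ mulrC.
Qed.

(** Multiplication by x acts on each summand U a_k as it does on U itself, so the regular trace
    consists of #|I| copies of the trace on U. *)
Lemma free_over_trace e (U : {vspace A}) (I : finType) (a : I -> A) kappa x :
    (forall y, y \in U -> forall z, y * z = z * y) ->
    (forall y, y \in U -> y * e = y) ->
    (forall y z, y \in U -> z \in U -> y * z \in U) ->
    free_over e U a kappa -> x \in U ->
  #|gT|%:R * t x = #|I|%:R * trace_on U x.
Proof.
move=> Uc Ue Um fr xU.
rewrite -(regular_trace (X := fvec a) (fform_lin fr)); last first.
  by move=> v; rewrite -(fvec_decomp fr) (Uc _ xU) -mulrA Ue.
rewrite -(pair_bigA _ (fun k l => fform kappa (k, l) (x * fvec a (k, l)))) /=.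
rewrite (eq_bigr (fun=> trace_on U x)) => [|k _]; first by rewrite sumr_const mulr_natl.
rewrite /trace_on; apply: eq_bigr => l _; rewrite /fform /fvec /= mulrA.
by case: fr => _ _ _ ->; rewrite ?eqxx ?mulr1n // Um // vbasis_memE.
Qed.

(** Here zeta stands for the reduced trace of gam and r^2 for the rank of eA over its centre; the
    two types of component differ only in how zeta and the basis a are obtained. *)
Lemma inv_different_conductor (O : subringClosed F) (Gam : set A) (e : A) (o : set A)
    (r : nat) (I : finType) (a : I -> A) kappa (y gam : A) :
    #|I| = (r ^ 2)%N -> free_over e (Fspan o) a kappa ->
    (forall y, y \in Fspan o -> forall z, y * z = z * y) ->
    (forall y, y \in Fspan o -> y * e = y) ->
    (forall y z, y \in Fspan o -> z \in Fspan o -> y * z \in Fspan o) ->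
    (forall gam, Gam gam -> exists2 zeta, o zeta &
       forall y, y \in Fspan o -> r%:R * t (y * gam) = t (y * zeta)) ->
    inv_different O o y -> Gam gam ->
  t ((#|gT|%:R / r%:R) *: y * gam) \in O.
Proof.
move=> cI fr Uc Ue Um zetaP [yU yO] gamG.
rewrite -scalerAl grpalg_coefZ.
(* If r = 0 in F, then |G| / r = 0 and the claim is void. *)
have [->|r0] := eqVneq (r%:R : F) 0; first by rewrite invr0 mulr0 mul0r rpred0.
have [zeta oz tz] := zetaP _ gamG.
have zU : zeta \in Fspan o.
  apply/mem_Fspan; exists 1%N, (fun=> 1), (fun=> zeta).
  split=> // [i|]; first by exists 1; rewrite ?scale1r.
  by rewrite big_ord1 mul1r.
have := free_over_trace Uc Ue Um fr (Um _ _ yU zU).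
rewrite -tz // cI natrX => eq_t.
suff -> : #|gT|%:R / r%:R * t (y * gam) = trace_on (Fspan o) (y * zeta) by apply: yO.
apply: (mulfI (expf_neq0 2 r0)); rewrite -eq_t expr2 -mulrA.
by rewrite [_ / _]mulrC -[_ * _ * t _]mulrA (mulVKf r0) mulrCA.
Qed.

End RegularTrace.

Lemma central_mul (A : pzRingType) (x y : A) : (forall z, x * z = z * x) ->
  (forall z, y * z = z * y) -> forall z, (x * y) * z = z * (x * y).
Proof. by move=> xc yc z; rewrite -mulrA yc mulrA (xc z) mulrA. Qed.

Section Fspan.
Variables (F : fieldType) (A : falgType F) (S : set A).

Lemma Fspan_ind (P : A -> Prop) : P 0 -> (forall c x y, P x -> P y -> P (c *: x + y)) ->
  (forall x, S x -> P x) -> forall x, x \in Fspan S -> P x.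
Proof.
move=> P0 Plin PS x /mem_Fspan[n [r [s [rF sS ->]]]].
apply: big_rec => // i y _ Py; have [c _ <-] := rF i.
by rewrite -scalerAl mul1r; apply: Plin => //; apply: PS.
Qed.

Lemma Fspan_mem x : S x -> x \in Fspan S.
Proof.
move=> Sx; apply/mem_Fspan; exists 1%N, (fun=> 1), (fun=> x).
by split=> // [i|]; [exists 1; rewrite ?scale1r | rewrite big_ord1 mul1r].
Qed.

Lemma Fspan_scale c x : c != 0 -> S (c *: x) -> x \in Fspan S.
Proof. by move=> c0 /Fspan_mem Sx; rewrite -[x](scalerK c0) memvZ. Qed.

Lemma Fspan_central : (forall x, S x -> forall z, x * z = z * x) ->
  forall x, x \in Fspan S -> forall z, x * z = z * x.
Proof.
move=> Sc; apply: Fspan_ind => // [z|c x y xc yc z]; first by rewrite mul0r mulr0.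
by rewrite mulrDl mulrDr -scalerAl -scalerAr xc yc.
Qed.

Lemma Fspan_unit e : (forall x, S x -> x * e = x) -> forall x, x \in Fspan S -> x * e = x.
Proof.
move=> Se; apply: Fspan_ind => // [|c x y xe ye]; first by rewrite mul0r.
by rewrite mulrDl -scalerAl xe ye.
Qed.

Lemma Fspan_mul : (forall x y, S x -> S y -> S (x * y)) ->
  forall x y, x \in Fspan S -> y \in Fspan S -> x * y \in Fspan S.
Proof.
move=> Sm x y xS yS; move: x xS; apply: Fspan_ind => [|c x x' xy x'y|x Sx].
- by rewrite mul0r mem0v.
- by rewrite mulrDl -scalerAl memvD // memvZ.
move: y yS; apply: Fspan_ind => [|c y y' xy xy'|y Sy].
- by rewrite mulr0 mem0v.
- by rewrite mulrDr -scalerAr memvD // memvZ.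
- exact/Fspan_mem/Sm.
Qed.

End Fspan.

Section CommutativeTrace.
Variables (F : fieldType) (gT : finGroupType) (R : comNzRingType) (n : nat).
Local Notation A := (grpalg F gT).
Local Notation t x := (grpalg_coef x 1%g).
Variables (phi : 'M[R]_n -> A) (e : A) (Gam : subringClosed A).
Hypothesis iso : matrix_iso phi e (component [set` Gam] e).
Hypothesis ec : forall x, e * x = x * e.
Hypothesis Gam_full : full_lattice Gam.
Let o : set A := [set phi c%:M | c in setT].

Lemma commutative_Fspan_center y : y \in Fspan o -> forall z, y * z = z * y.
Proof.
by apply: Fspan_central => _ [c _ <-] z; apply: (miso_scalar_center iso ec Gam_full).
Qed.

Lemma commutative_Fspan_unit y : y \in Fspan o -> y * e = y.
Proof. by apply: Fspan_unit => _ [c _ <-]; rewrite (miso_mulr iso ec). Qed.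

Lemma commutative_Fspan_mul y z :
  y \in Fspan o -> z \in Fspan o -> y * z \in Fspan o.
Proof.
apply: Fspan_mul => _ _ [c _ <-] [d _ <-]; exists (c * d) => //.
by rewrite scalar_mxM (miso_mul iso).
Qed.

Lemma commutative_free_over :
  free_over e (Fspan o) (fun kl : 'I_n * 'I_n => munit phi kl.1 kl.2)
    (fun kl => mentry phi kl.1 kl.2).
Proof.
split=> [[k l] c x y|[k l] x|x|[k l] [p q] y yo] /=.
- by rewrite mentryD mentryZ.
- have [a a0 axG] := Gam_full x; have [X XE] := miso_component iso ec axG.
  apply: (Fspan_scale a0); exists (X k l) => //.
  by rewrite -(mentry_phi iso) -XE (mentry_mule iso) mentryZ.
- by rewrite (mentry_decomp iso ec) pair_bigA.
- rewrite (mentry_mul_munit iso) ?commutative_Fspan_unit // => p' q'.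
  exact: commutative_Fspan_center.
Qed.

(** Take for zeta the scalar matrix of the trace of X. Since t is symmetric, for central w it kills
    w E_kl off the diagonal and takes the same value on every w E_kk. *)
Lemma commutative_reduced_trace gam : gam \in Gam -> exists2 zeta, o zeta &
  forall y, y \in Fspan o -> n%:R * t (y * gam) = t (y * zeta).
Proof.
move=> gG; have [X XE] := miso_component iso ec gG.
exists (phi (\tr X)%:M); first by exists (\tr X).
move=> y yo; have yc := commutative_Fspan_center yo.
have ye := commutative_Fspan_unit yo.
have tE w k l : (forall z, w * z = z * w) -> w * e = w ->
    n%:R * t (w * munit phi k l) = t w *+ (k == l).
  move=> wc we; have [->|kl] := eqVneq k l.
    rewrite mulr1n -{2}we -(sum_munit iso) mulr_sumr grpalg_coef_sum.
    rewrite (eq_bigr (fun=> t (w * munit phi l l)));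
      first by rewrite sumr_const card_ord mulr_natl.
    move=> j _; have -> : munit phi j j = munit phi j l * munit phi l j.
      by rewrite (munitM iso) eqxx.
    by rewrite mulrA grpalg_coef1_mulC mulrA -wc -mulrA (munitM iso) eqxx.
  have -> : munit phi k l = munit phi k k * munit phi k l by rewrite (munitM iso) eqxx.
  rewrite mulrA grpalg_coef1_mulC mulrA -wc -mulrA (munitM iso) eq_sym (negPf kl) !mulr0n.
  by rewrite mulr0 /grpalg_coef ffunE mulr0.
have gE : y * gam = \sum_k \sum_l (y * phi (X k l)%:M) * munit phi k l.
  rewrite -{1}ye -mulrA ec XE -{1}(miso_mulr iso ec X) (mentry_decomp iso ec) mulr_sumr.
  apply: eq_bigr => k _; rewrite mulr_sumr; apply: eq_bigr => l _.
  by rewrite (mentry_phi iso) mulrA.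
have -> : phi (\tr X)%:M = \sum_k phi (X k k)%:M.
  by rewrite -(miso_sum iso) /mxtrace raddf_sum.
rewrite gE mulr_sumr !grpalg_coef_sum mulr_sumr; apply: eq_bigr => k _.
rewrite grpalg_coef_sum mulr_sumr (bigD1 k) //= big1 ?addr0 => [|l lk].
  rewrite tE ?eqxx ?mulr1n // => [z|]; last by rewrite -mulrA (miso_mulr iso ec).
  by apply: central_mul => // z'; apply: (miso_scalar_center iso ec Gam_full).
rewrite tE ?[k == l]eq_sym ?(negPf lk) // => [z|]; last by rewrite -mulrA (miso_mulr iso ec).
by apply: central_mul => // z'; apply: (miso_scalar_center iso ec Gam_full).
Qed.

End CommutativeTrace.

(** * Components that are matrix rings over the valuation ring of a skewfield *)

Section FractionField.
Variables (F : fieldType) (O : subringClosed F).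

Lemma common_denominator (I : finType) (c : I -> F) :
    (forall x : F, x \in O \/ x^-1 \in O) ->
  exists a : F, [/\ a != 0, a \in O & forall i, a * c i \in O].
Proof.
move=> Oval.
suff [a [a0 aO ac]] : exists a : F,
    [/\ a != 0, a \in O & forall i, i \in enum I -> a * c i \in O].
  by exists a; split=> // i; apply: ac; rewrite mem_enum.
elim: (enum I) => [|j s [a [a0 aO ac]]]; first by exists 1; rewrite oner_neq0 rpred1.
have [cO|cO] := Oval (c j).
  exists a; split=> // i; rewrite inE => /orP[/eqP->|/ac//]; exact: rpredM.
have [c0|c0] := eqVneq (c j) 0.
  by exists a; split=> // i; rewrite inE => /orP[/eqP->|/ac//]; rewrite c0 mulr0 rpred0.
exists (a * (c j)^-1); split; first by rewrite mulf_neq0 ?invr_eq0.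
  exact: rpredM.
move=> i; rewrite inE => /orP[/eqP->|/ac acO]; first by rewrite mulfVK.
by rewrite mulrAC rpredM.
Qed.

Lemma complete_dvr_valuation : complete_dvr O ->
  exists v : F -> int, valuation_ring v [set` O].
Proof. by case=> v [vO _]; exists v. Qed.

End FractionField.

Section ValuationRing.
Variables (D : unitRingType) (w : D -> int) (V : subringClosed D).
Hypothesis Dunit : forall x : D, x != 0 -> x \is a GRing.unit.
Hypothesis wV : valuation_ring w [set` V].

Lemma valuation_ringE x : x \in V <-> x = 0 \/ 0 <= w x.
Proof. by case: wV => _ VE; have : [set` V] x <-> val_ge w 0 x by rewrite VE. Qed.

Lemma valuationM x y : x != 0 -> y != 0 -> w (x * y) = w x + w y.
Proof. by case: wV => -[_ wM _] _; apply: wM. Qed.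

Lemma valuation1 : w 1 = 0.
Proof.
apply: (addrI (w 1)); rewrite addr0.
by rewrite -valuationM ?oner_neq0 // mulr1.
Qed.

Lemma skewfield_mulf_neq0 (x y : D) : x != 0 -> y != 0 -> x * y != 0.
Proof. by move=> x0 y0; rewrite mulrI_eq0 //; apply/mulrI/Dunit. Qed.

Lemma valuationV x : x != 0 -> w x^-1 = - w x.
Proof.
move=> x0; apply: (addrI (w x)); rewrite -valuationM ?invr_eq0 //.
by rewrite divrr ?Dunit // valuation1 subrr.
Qed.

Lemma valuation_total x : x \in V \/ x^-1 \in V.
Proof.
have [->|x0] := eqVneq x 0; first by left; apply: rpred0.
case: (leP 0 (w x)) => wx; [left|right]; apply/valuation_ringE; right => //.
by rewrite valuationV // oppr_ge0 ltW.
Qed.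

Lemma exists_uniformizer : exists p : D, [/\ p != 0, p \in V & p^-1 \notin V].
Proof.
case: wV => -[/(_ 1)[p p0 wp] _ _] _; exists p; split=> //.
  by apply/valuation_ringE; right; rewrite wp.
apply/negP => /valuation_ringE[/eqP|]; first by rewrite invr_eq0 (negPf p0).
by rewrite valuationV // wp.
Qed.

Lemma valuationX x k : x != 0 -> w (x ^+ k) = w x *+ k.
Proof.
move=> x0; elim: k => [|k IH]; first by rewrite expr0 valuation1.
rewrite exprS valuationM // ?IH ?mulrS //.
by elim: k {IH} => [|k IH]; rewrite ?expr0 ?oner_neq0 // exprS skewfield_mulf_neq0.
Qed.

End ValuationRing.

Section SkewfieldOrder.
Variables (F : fieldType) (O : subringClosed F) (D : falgType F) (w : D -> int).
Variable V : subringClosed D.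
Hypothesis Dunit : forall x : D, x != 0 -> x \is a GRing.unit.
Hypothesis wV : valuation_ring w [set` V].
Hypothesis VO : forall c : F, (c%:A : D) \in V <-> c \in O.
Hypothesis Ouni : exists p : F, [/\ p != 0, p \in O & p^-1 \notin O].

Lemma scale_in_valuation_ring c x : c \in O -> x \in V -> c *: x \in V.
Proof. by move=> /VO cV xV; rewrite -[x]mul1r scalerAl rpredM. Qed.

Lemma valuation_ring_full : full_lattice V.
Proof.
move=> x; have [p [p0 pO pVO]] := Ouni.
have sc0 c : c != 0 -> c%:A != 0 :> D by move=> c0; rewrite scaler_eq0 negb_or c0 oner_neq0.
have [->|x0] := eqVneq x 0; first by exists 1; rewrite ?oner_neq0 // scaler0 rpred0.
(* [VO] carries p^-1 outside O to p^-1 outside V, which excludes the value 0. *)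
have wp : 0 < w p%:A.
  rewrite lt_neqAle; apply/andP; split; last first.
    have /(valuation_ringE wV)[/eqP|//] : (p%:A : D) \in V by apply/VO.
    by rewrite (negPf (sc0 _ p0)).
  apply: contraNneq pVO => wp; apply/VO/(valuation_ringE wV); right.
  have -> : (p^-1)%:A = (p%:A)^-1 :> D.
    by apply: (mulrI (Dunit (sc0 _ p0)));
      rewrite divrr ?Dunit ?sc0 // -scalerAl mul1r scalerA divff // scale1r.
  by rewrite (valuationV Dunit wV) ?sc0 // -wp oppr0.
(* Each factor p raises the value by at least 1, so |w x| factors suffice. *)
exists (p ^+ `|w x|); first exact: expf_neq0.
apply/(valuation_ringE wV); right.
have -> : p ^+ `|w x| *: x = (p%:A) ^+ `|w x| * x.
  by rewrite -(rmorphXn (in_alg D)) /= -scalerAl mul1r.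
have pX0 : (p%:A : D) ^+ `|w x| != 0.
  by rewrite -(rmorphXn (in_alg D)) sc0 // expf_neq0.
rewrite (valuationM wV) // (valuationX Dunit wV) ?sc0 // -lerBlDr sub0r.
apply: (le_trans (y := (`|w x|%N : int))); first by rewrite abszE -normrN ler_norm.
by rewrite -mulr_natr natz -[leLHS]mul1r ler_wpM2r // -gtz0_ge1.
Qed.

Lemma valuation_ring_int_closed (f : {poly F}) (d : D) :
  f \is monic -> f \is a polyOver O -> alg_horner f d = 0 -> d \in V.
Proof.
move=> fm /polyOverP fO fd; have [//|dV] := valuation_total Dunit wV d.
have [->|d0] := eqVneq d 0; first exact: rpred0.
have du := Dunit d0.
have := fd; rewrite /alg_horner.
have sf : (0 < size f)%N by rewrite size_poly_gt0 monic_neq0.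
have lc : f`_(size f).-1 = 1 by rewrite -lead_coefE (monicP fm).
rewrite -(prednK sf); case: (size f).-1 lc => [|N] lc.
  by rewrite big_ord1 expr0 lc scale1r => /eqP; rewrite oner_eq0.
rewrite big_ord_recr /= lc scale1r; move/(canRL (addKr _)); rewrite addr0 => dN.
(* If d is not in V then d^-1 is, and d = d^(N+1) d^-N is a polynomial in d^-1. *)
suff -> : d = - \sum_(i < N.+1) f`_i *: (d^-1) ^+ (N - i).
  by rewrite rpredN rpred_sum // => i _; rewrite scale_in_valuation_ring // rpredX.
have dVX k : d ^+ k * d^-1 ^+ k = 1.
  by rewrite -exprMn_comm ?divrr ?expr1n //; apply: commrV.
transitivity (d ^+ N.+1 * d^-1 ^+ N); first by rewrite exprS -mulrA dVX mulr1.
rewrite dN mulNr mulr_suml; congr (- _); apply: eq_bigr => i _.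
have -> : d^-1 ^+ N = d^-1 ^+ i * d^-1 ^+ (N - i) by rewrite -exprD subnKC // -ltnS.
by rewrite -scalerAl mulrA dVX mul1r.
Qed.

End SkewfieldOrder.

Section SkewfieldScalars.
Variables (F : fieldType) (O : subringClosed F) (A : falgType F) (Gam : subringClosed A).
Variables (e : A) (D : falgType F) (V : subringClosed D).
Variables (n : nat) (phi : 'M[subring_of V]_n -> A).
Hypothesis n0 : (0 < n)%N.
Hypothesis iso : matrix_iso phi e (component [set` Gam] e).
Hypothesis phiF : forall (c : F) (x : subring_of V), val x = c%:A -> phi x%:M = c *: e.
Hypothesis Oval : forall x : F, x \in O \/ x^-1 \in O.
Hypothesis VO : forall c : F, (c%:A : D) \in V <-> c \in O.
Hypothesis Vfull : full_lattice V.
Hypothesis ec : forall x, e * x = x * e.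

Let valM (x y : subring_of V) : val (x * y) = val x * val y :> D. Proof. exact: rmorphM. Qed.

Let phis (x : subring_of V) := phi x%:M.

Let phisM x y : phis (x * y) = phis x * phis y.
Proof. by rewrite /phis scalar_mxM (miso_mul iso). Qed.

Let phisZ (c : F) x y : val y = c *: val x -> phis y = c *: phis x.
Proof.
have phisZO b (u v : subring_of V) : b \in O -> val v = b *: val u -> phis v = b *: phis u.
  move=> /VO bV vE; have -> : v = Subring_of bV * u.
    by apply: val_inj; rewrite vE rmorphM /= -scalerAl mul1r.
  by rewrite phisM /phis (@phiF b) // -scalerAl (miso_mull iso).
move=> yE; have [//|cO] := Oval c; first by move/phisZO; apply.
have [c0|c0] := eqVneq c 0; first by apply: phisZO => //; rewrite c0 rpred0.
have : phis x = c^-1 *: phis y by apply: phisZO => //; rewrite yE scalerA mulVf // scale1r.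
by move=> ->; rewrite scalerA divff // scale1r.
Qed.

Let phis_sum (I : Type) (r : seq I) (P : pred I) (x : I -> subring_of V) :
  phis (\sum_(i <- r | P i) x i) = \sum_(i <- r | P i) phis (x i).
Proof. by rewrite /phis raddf_sum (miso_sum iso). Qed.

(** phi is only a ring morphism, defined over V. An F-linear relation is multiplied by a common
    denominator of its coefficients, after which [phiF] turns scalars of O into scalars on eA. *)
Let phis_lin (I : finType) (c : I -> F) (x : I -> subring_of V) y :
  val y = \sum_i c i *: val (x i) -> phis y = \sum_i c i *: phis (x i).
Proof.
move=> yE; have [a [a0 aO ac]] := common_denominator c Oval.
have acV i : (a * c i)%:A \in V by apply/VO.
apply: (scalerI a0); have aV : a%:A \in V by apply/VO.
rewrite -(@phisZ a y (Subring_of aV * y)) ?rmorphM /= -?scalerAl ?mul1r //.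
have -> : Subring_of aV * y = \sum_i Subring_of (acV i) * x i.
  apply: val_inj; rewrite [LHS]valM [val (Subring_of aV)](_ : _ = a%:A) // -scalerAl mul1r.
  rewrite yE scaler_sumr rmorph_sum.
  by apply: eq_bigr => i _; rewrite rmorphM /= -scalerAl mul1r scalerA.
rewrite phis_sum scaler_sumr; apply: eq_bigr => i _; rewrite scalerA.
by apply: phisZ; rewrite rmorphM /= -scalerAl mul1r.
Qed.

(** A basis of D is scaled into V, mapped by phi and scaled back; agreement with phi on all of V is
    [phis_lin]. *)
Lemma exists_skewfield_embedding :
  exists delta : 'Hom(D, A), forall x : subring_of V, delta (val x) = phi x%:M.
Proof.
pose b := vbasis {:D}.
have /choice[a aP] : forall t : 'I_(\dim {:D}), exists a : F, a != 0 /\ a *: b`_t \in V.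
  by move=> t; have [a a0 aV] := Vfull b`_t; exists a.
pose x t : subring_of V := Subring_of (aP t).2.
pose del (y : D) : A := \sum_t (coord b t y / a t) *: phis (x t).
have del_lin : linear del.
  move=> c y z; rewrite /del scaler_sumr -big_split; apply: eq_bigr => t _ /=.
  by rewrite linearP mulrDl scalerDl scalerA mulrA.
pose delL : {linear D -> A} := HB.pack del (GRing.isLinear.Build F D A _ del del_lin).
exists (linfun delL) => y; rewrite lfunE /=; apply/esym/phis_lin.
rewrite {1}(coord_vbasis (memvf (val y))); apply: eq_bigr => t _ /=.
by rewrite scalerA mulfVK // (aP t).1.
Qed.

Section Embedding.
Variable delta : 'Hom(D, A).
Hypothesis deltaV : forall x : subring_of V, delta (val x) = phi x%:M.

Lemma deltaM x y : delta (x * y) = delta x * delta y.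
Proof.
have [a a0 axV] := Vfull x; have [b b0 byV] := Vfull y.
have : delta ((a *: x) * (b *: y)) = delta (a *: x) * delta (b *: y).
  have := deltaV (Subring_of axV * Subring_of byV).
  rewrite rmorphM /= scalar_mxM (miso_mul iso) -!deltaV.
  by [].
rewrite -scalerAl -scalerAr !linearZ /= -scalerAl -scalerAr.
by move/(scalerI a0)/(scalerI b0).
Qed.

Lemma delta1 : delta 1 = e.
Proof. by rewrite -(rmorph1 (val : subring_of V -> D)) deltaV (miso_one iso). Qed.

Lemma delta_inj x : delta x = 0 -> x = 0.
Proof.
move=> dx; have [a a0 axV] := Vfull x.
have : phi (Subring_of axV)%:M = phi 0.
  by rewrite -deltaV /= linearZ /= dx scaler0 (miso_zero iso).
move/(miso_inj iso)/matrixP/(_ (Ordinal n0) (Ordinal n0)); rewrite !mxE eqxx mulr1n.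
move/(congr1 val); rewrite [RHS](rmorph0 (val : subring_of V -> D)) => /eqP.
by rewrite scaler_eq0 (negPf a0) => /eqP.
Qed.

Lemma delta_unit x : delta x * e = delta x.
Proof. by rewrite -delta1 -deltaM mulr1. Qed.

Lemma delta_munit x k l : delta x * munit phi k l = munit phi k l * delta x.
Proof.
have [a a0 axV] := Vfull x; apply: (scalerI a0).
have dax : a *: delta x = phi (Subring_of axV)%:M by rewrite -deltaV /= linearZ.
rewrite scalerAl scalerAr dax /munit.
rewrite -!(miso_mul iso); congr phi; apply/matrixP => i j.
rewrite mul_scalar_mx !mxE (bigD1 j) //= big1 ?addr0 => [|r rj].
  by rewrite !mxE eqxx mulr1n; case: andP => _; rewrite ?mulr1 ?mul1r ?mulr0 ?mul0r.
by rewrite !mxE (negPf rj) mulr0n mulr0.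
Qed.

Hypothesis Gam_full : full_lattice Gam.

Lemma mentry_delta k l x : exists d, mentry phi k l x = delta d.
Proof.
have [a a0 axG] := Gam_full x; have [X XE] := miso_component iso ec axG.
exists (a^-1 *: val (X k l)); rewrite linearZ /= deltaV -(mentry_phi iso) -XE.
by rewrite (mentry_mule iso) mentryZ scalerA mulVf // scale1r.
Qed.

Lemma central_delta x : (forall y, x * y = y * x) ->
  exists d, x * e = delta d /\ forall d', d * d' = d' * d.
Proof.
move=> xc; have [d dE] := mentry_delta (Ordinal n0) (Ordinal n0) (x * e).
have xe : x * e = delta d.
  rewrite -dE (mentryM _ _ _ (y := x)) //; congr (x * _).
  by rewrite -(miso_one iso) (mentry_phi iso) mxE eqxx.
exists d; split=> // d'; apply/eqP; rewrite -subr_eq0; apply/eqP/delta_inj.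
by rewrite linearB /= !deltaM -xe (central_mul xc ec) subrr.
Qed.

Lemma delta_central d : (forall d', d * d' = d' * d) -> forall x, delta d * x = x * delta d.
Proof.
move=> dc x; have dmx k l : delta d * mentry phi k l x = mentry phi k l x * delta d.
  by have [d' ->] := mentry_delta k l x; rewrite -!deltaM dc.
transitivity (delta d * (x * e)); first by rewrite -ec mulrA delta_unit.
transitivity ((x * e) * delta d); last by rewrite -mulrA ec delta_unit.
rewrite (mentry_decomp iso ec) mulr_sumr mulr_suml; apply: eq_bigr => k _.
rewrite mulr_sumr mulr_suml; apply: eq_bigr => l _.
by rewrite mulrA dmx -!mulrA delta_munit.
Qed.

Hypothesis Dunit : forall x : D, x != 0 -> x \is a GRing.unit.

(** Takes the place of the simplicity of eA: a nonzero entry of x is delta d with d invertible, and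
    psi cannot kill it because psi e = 1. *)
Lemma abs_rep_component_inj (psi : abs_rep A) x :
  psi e = 1%:M -> x * e = x -> psi x = 0 -> x = 0.
Proof.
move=> psie xe psix; rewrite -xe (mentry_decomp iso ec) big1 // => k _.
rewrite big1 // => l _; have [d dE] := mentry_delta k l x.
have pm : psi (mentry phi k l x) = 0.
  by rewrite rmorph_sum big1 // => r _; rewrite !rmorphM psix mulr0 mul0r.
have [d00|d0] := eqVneq d 0; first by rewrite dE d00 linear0 mul0r.
have /(congr1 psi) : delta d * delta d^-1 = e by rewrite -deltaM divrr ?Dunit // delta1.
rewrite rmorphM -dE pm mul0r psie -[0](raddf0 (@scalar_mx _ _)) => /abs_rep_inj1/eqP.
by rewrite eq_sym oner_eq0.
Qed.

End Embedding.
End SkewfieldScalars.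

(** Cayley-Hamilton solved for its constant term. The left factor plays the part of the adjugate; as
    a polynomial in B it is visibly built from the images of powers of H. *)
Lemma adjugate_char_poly (R : comNzRingType) N (B : 'M[R]_N) :
  (\sum_(i < N) (- ((-1) ^+ N * (char_poly B)`_i.+1)) *: B ^+ i) *m B = (\det B)%:M.
Proof.
case: N B => [|N] B; first by apply/matrixP => -[].
have : horner_mx B (\poly_(i < N.+2) (char_poly B)`_i) = 0.
  by rewrite -(size_char_poly B) coefK Cayley_Hamilton.
rewrite poly_def rmorph_sum big_ord_recl /= horner_mxZ rmorphXn /= horner_mx_X expr0.
move/(canRL (addKr _)); rewrite addr0 => CH.
have -> : \det B = (-1) ^+ N.+1 * (char_poly B)`_0.
  by rewrite char_poly_det mulrA -exprMn mulrNN mulr1 expr1n mul1r.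
rewrite scalar_mxM mul_scalar_mx -scalemx1 -[X in _ *: X]opprK -CH mulmx_suml scalerN
  scaler_sumr -sumrN.
apply: eq_bigr => i _; rewrite horner_mxZ rmorphXn /= horner_mx_X -scalemxAl mulmxE -exprSr.
by rewrite scalerA scaleNr.
Qed.

Lemma linear_inj_surj (F : fieldType) (W : vectType F) (f : W -> W) :
  linear f -> (forall x, f x = 0 -> x = 0) -> forall y, exists x, f x = y.
Proof.
move=> flin finj y.
pose fL : {linear W -> W} := HB.pack f (GRing.isLinear.Build F W W _ f flin).
have ker0 : lker (linfun fL) == 0%VS.
  rewrite -subv0; apply/subvP => x; rewrite memv_ker lfunE /= memv0 => /eqP fx.
  by apply/eqP/finj.
by exists (((linfun fL)^-1)%VF y); have := lker0_lfunVK ker0 y; rewrite lfunE.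
Qed.

Section SkewfieldAdjoint.
Variables (F : fieldType) (O : subringClosed F) (A : falgType F) (Gam : subringClosed A).
Variables (N : nat) (g : 'I_N -> A).
Hypothesis gGam : forall t, g t \in Gam.
Hypothesis gspan : forall x, x \in Gam ->
  exists c : 'I_N -> F, (forall t, c t \in O) /\ x = \sum_t c t *: g t.
Variables (e : A) (D : falgType F) (w : D -> int) (V : subringClosed D).
Variables (n : nat) (phi : 'M[subring_of V]_n -> A) (delta : 'Hom(D, A)).
Hypothesis n0 : (0 < n)%N.
Hypothesis iso : matrix_iso phi e (component [set` Gam] e).
Hypothesis ec : forall x, e * x = x * e.
Hypothesis ee : e * e = e.
Hypothesis eGam : e \in Gam.
Hypothesis Gam_full : full_lattice Gam.
Hypothesis Vfull : full_lattice V.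
Hypothesis Dunit : forall x : D, x != 0 -> x \is a GRing.unit.
Hypothesis wV : valuation_ring w [set` V].
Hypothesis VO : forall c : F, (c%:A : D) \in V <-> c \in O.
Hypothesis deltaV : forall x : subring_of V, delta (val x) = phi x%:M.
Variable psi : abs_rep A.
Hypothesis psie : psi e = 1%:M.
Local Notation E := (rep_field psi).
Local Notation sigma := (rep_scalar psi).
Local Notation m := (rep_dim psi).

Let psi_inj x : x * e = x -> psi x = 0 -> x = 0.
Proof. exact: (abs_rep_component_inj iso Vfull ec deltaV Gam_full Dunit psie). Qed.

(* psi (delta d) has an eigenvalue that is a root of some monic f over O, so f(d) is
   not invertible; in the skewfield D this means f(d) = 0. *)
Lemma delta_integral d l (c : 'I_l -> E) (gam : 'I_l -> A) :
    (forall s, integral_over O sigma (c s)) -> (forall s, gam s \in Gam) ->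
    psi (delta d) = \sum_s c s *: psi (gam s) -> d \in V.
Proof.
move=> intc gamG dE.
have [f [fm fO fdet]] := integral_combination gGam gspan intc gamG dE.
apply: (valuation_ring_int_closed Dunit wV VO fm fO); apply: contrapT => /eqP fd0.
have fdE : psi (alg_horner f (delta d)) = psi (delta (alg_horner f d)).
  rewrite /alg_horner linear_sum !rmorph_sum; apply: eq_bigr => i _.
  rewrite linearZ /= !rep_funZ; congr (_ *: _).
  case: (nat_of_ord i) => [|j].
    by rewrite !expr0 (delta1 iso deltaV) psie rmorph1.
  congr (psi _); elim: j => [|j IH]; first by rewrite !expr1.
  by rewrite exprS IH -(deltaM iso Vfull deltaV) -exprS.
have /(congr1 (fun M => \det M)) :
    psi (alg_horner f (delta d)) *m psi (delta (alg_horner f d)^-1) = 1%:M.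
  rewrite fdE mulmxE -rmorphM -(deltaM iso Vfull deltaV) divrr ?Dunit //.
  by rewrite (delta1 iso deltaV).
by rewrite det_mulmx fdet mul0r det1 => /eqP; rewrite eq_sym oner_eq0.
Qed.

Lemma delta_Gam d : d \in V -> delta d \in Gam.
Proof.
move=> dV; rewrite -[d]/(val (Subring_of dV)) deltaV.
exact/(component_sub eGam)/(miso_image iso).
Qed.

Lemma munit_Gam k l : munit phi k l \in Gam.
Proof. exact/(component_sub eGam)/(miso_image iso). Qed.

(** Right multiplication by H on row vectors over eA is injective, because psi is injective on eA
    and psi(H) is invertible; finite dimension makes it surjective. Adding the identity on the (1 -
    e)-part turns it into an endomorphism of a full power of A. *)
Lemma component_solve b (H : 'M[A]_b) z : \det (blockrep psi H) != 0 ->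
  exists Y : 'M[A]_b, (forall i j, Y i j * e = Y i j) /\ Y *m H = (z * e)%:M.
Proof.
move=> detH.
pose f (v : {ffun 'I_b -> A}) : {ffun 'I_b -> A} :=
  [ffun j => \sum_k v k * e * H k j + v j * (1 - e)].
have flin : linear f.
  move=> c u v; apply/ffunP => j; rewrite !ffunE scalerDr scaler_sumr addrACA -big_split.
  congr (_ + _); last by rewrite mulrDl scalerAl.
  by apply: eq_bigr => k _; rewrite !ffunE /= !mulrDl -!scalerAl.
have oe : (1 - e) * e = 0 by rewrite mulrBl mul1r ee subrr.
have fe v j : f v j * e = \sum_k v k * e * H k j.
  rewrite ffunE mulrDl -[v j * _ * e]mulrA oe mulr0 addr0 mulr_suml.
  by apply: eq_bigr => k _; rewrite -mulrA -[H k j * e]ec mulrA -[v k * e * e]mulrA ee.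
have fo v j : f v j * (1 - e) = v j * (1 - e).
  have eo : e * (1 - e) = 0 by rewrite mulrBr mulr1 ee subrr.
  have oo : (1 - e) * (1 - e) = 1 - e by rewrite mulrBl mul1r eo subr0.
  have oc x : x * (1 - e) = (1 - e) * x by rewrite mulrBr mulrBl mulr1 mul1r ec.
  rewrite ffunE mulrDl mulr_suml big1 ?add0r -?[LHS]mulrA ?oo // => k _.
  by rewrite -mulrA oc mulrA -[v k * e * _]mulrA eo mulr0 mul0r.
have finj v : f v = 0 -> v = 0.
  move=> fv0; have ve j : v j * e = v j.
    have := fo v j; rewrite fv0 ffunE mul0r mulrBr mulr1 => /esym/eqP.
    by rewrite subr_eq0 => /eqP.
  pose vr : 'M[A]_(1, b) := \row_k v k.
  have vrH : vr *m H = 0.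
    apply/rowP => j; rewrite !mxE; have := fe v j; rewrite fv0 ffunE mul0r => fej.
    rewrite [RHS]fej.
    by apply: eq_bigr => k _; rewrite mxE ve.
  have : blockrep psi vr = 0.
    apply: (@row_free_inj _ _ _ _ (blockrep psi H));
      first by rewrite row_free_unit unitmxE unitfE.
    rewrite /= -blockrepM vrH mul0mx -mxblock0; apply: eq_mxblock => i j.
    by rewrite mxE rmorph0.
  rewrite /blockrep -mxblock0 => /eq_mxblockP v0; apply/ffunP => k; rewrite ffunE.
  by apply: psi_inj => //; have := v0 0 k; rewrite mxE.
have sol i : exists v : {ffun 'I_b -> A}, f v = [ffun j => z * e *+ (i == j)].
  exact: linear_inj_surj.
have [v vE] := choice sol.
exists (\matrix_(i, k) (v i k * e)); split=> [i j|].
  by rewrite mxE -mulrA ee.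
apply/matrixP => i j; rewrite !mxE.
under eq_bigr do rewrite mxE.
by rewrite -fe vE ffunE mulrnAl -mulrA ee.
Qed.

(** Y is first found with entries in eA. Cancelling the invertible B identifies psi(Y) with the
    polynomial of [adjugate_char_poly], so each matrix entry of Y is a delta d to which
    [delta_integral] applies. *)
Lemma skewfield_adjoint b (H : 'M[A]_b) z :
    (forall i j, H i j \in Gam) -> is_nr H z ->
  exists Y : 'M[A]_b,
    [/\ forall i j, Y i j \in Gam, Y *m H = (z * e)%:M & z * e \in Gam].
Proof.
move=> HG nrz; have psiz := is_nr_abs_rep psi nrz.
have zc : forall y, z * y = y * z by case: nrz => -[_ zc] _ y; apply: zc.
(* When psi(H) is singular, z e = 0 by injectivity of psi on eA, and Y = 0 serves. *)
have [detH|detH] := eqVneq (\det (blockrep psi H)) 0.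
  have ze : z * e = 0.
    apply: psi_inj; first by rewrite -mulrA ee.
    by rewrite rmorphM psiz detH psie mulr1 raddf0.
  exists 0; rewrite mul0mx ze raddf0; split=> // [i j|]; last exact: rpred0.
  by rewrite mxE rpred0.
have [Y [Ye YH]] := component_solve z detH.
pose B := blockrep psi H; pose chi := char_poly B.
set M := (\sum_(i < b) m)%N in B chi.
pose q i := - ((-1) ^+ M * chi`_i.+1).
have intq i : integral_over O sigma (q i).
  apply/integral_memP; rewrite rpredN rpredM ?rpredX ?rpredN ?rpred1 //.
  exact/integral_memP/(integral_char_poly gGam gspan).
have HXG k i j : (H ^+ k) i j \in Gam.
  elim: k i j => [|k IH] i j.
    by rewrite expr0 mxE; case: eqP => _; rewrite ?rpred1 ?rpred0.
  by rewrite exprS mxE rpred_sum // => r _; rewrite rpredM.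
have BX k : B ^+ k = blockrep psi (H ^+ k).
  elim: k => [|k IH]; first by rewrite !expr0 (blockrep_scalar _ (abs_rep_psi1 psi)).
  by rewrite exprS IH -mulmxE -blockrepM exprS.
have psiY i j : psi (Y i j) = \sum_(k < M) q k *: psi ((H ^+ k) i j).
  have : blockrep psi Y = \sum_(k < M) q k *: B ^+ k.
    apply: (@row_free_inj _ _ _ _ B); first by rewrite row_free_unit unitmxE unitfE.
    rewrite /= adjugate_char_poly -blockrepM YH; apply: blockrep_scalar.
    by rewrite rmorphM psiz psie mulr1.
  have -> : \sum_(k < M) q k *: B ^+ k =
      \mxblock_(i < b, j < b) (\sum_(k < M) q k *: psi ((H ^+ k) i j)).
    apply/matrixP => i' j'; rewrite summxE mxE summxE; apply: eq_bigr => k _.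
    by rewrite BX !mxE.
  by rewrite /blockrep => /eq_mxblockP ->.
have YG i j : Y i j \in Gam.
  rewrite -Ye (mentry_decomp iso ec) rpred_sum // => k _; rewrite rpred_sum // => l _.
  rewrite rpredM ?munit_Gam //; have [d dE] := mentry_delta iso ec deltaV Gam_full k l (Y i j).
  rewrite dE delta_Gam //.
  apply: (delta_integral (c := fun r : 'I_M => q r)
    (gam := fun r => mentry phi k l ((H ^+ r) i j))) => //.
    by move=> r; rewrite rpred_sum // => s _; rewrite !rpredM ?munit_Gam.
  rewrite -dE /mentry rmorph_sum; under [RHS]eq_bigr do rewrite rmorph_sum scaler_sumr.
  rewrite exchange_big; apply: eq_bigr => s _; rewrite !rmorphM psiY mulr_sumr mulr_suml.
  by apply: eq_bigr => r _; rewrite !rmorphM -!mulmxE -scalemxAr -scalemxAl.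
exists Y; split=> //.
have [d [dE _]] := central_delta n0 iso Vfull ec deltaV Gam_full zc.
rewrite dE delta_Gam //.
(* psi(z e) is the scalar matrix of det B, which up to sign is the constant coefficient of the
   characteristic polynomial; hence a single term with gam = 1. *)
apply: (delta_integral (c := fun r : 'I_1 => \det B) (gam := fun r => 1)) => [r|r|].
- apply/integral_memP; have -> : \det B = (-1) ^+ M * chi`_0.
    by rewrite char_poly_det mulrA -exprMn mulrNN mulr1 expr1n mul1r.
  rewrite rpredM ?rpredX ?rpredN ?rpred1 //.
  exact/integral_memP/(integral_char_poly gGam gspan).
- exact: rpred1.
- by rewrite big_ord1 -dE rmorphM psiz psie mulr1 rmorph1 scalemx1.
Qed.

End SkewfieldAdjoint.

(** * The reduced trace of a skewfield component *)

Lemma det_mem (R : comNzRingType) (S : subringClosed R) n (M : 'M[R]_n) :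
  (forall i j, M i j \in S) -> \det M \in S.
Proof.
by move=> MS; rewrite /determinant rpred_sum // => s _; rewrite rpredM ?rpred_sign ?rpred_prod.
Qed.

Lemma invmx_mem (E : fieldType) (S : subringClosed E) n (M : 'M[E]_n) :
    (forall x, x \in S -> x^-1 \in S) -> (forall i j, M i j \in S) ->
  forall i j, invmx M i j \in S.
Proof.
move=> Sinv MS i j; rewrite /invmx; case: ifP => _ //.
rewrite !mxE rpredM ?Sinv ?det_mem // /cofactor rpredM ?rpredX ?rpredN ?rpred1 //.
by apply: det_mem => p q; rewrite !mxE.
Qed.

Section TraceForm.
Variables (F : fieldType) (A : falgType F) (psi : abs_rep A).
Local Notation E := (rep_field psi).
Local Notation m := (rep_dim psi).

Lemma exists_matrix_basis : exists a : 'I_(m * m) -> A,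
  (\matrix_k mxvec (psi (a k)) : 'M[E]_(m * m)) \in unitmx.
Proof.
pose b := vbasis {:A}.
pose M : 'M[E]_(\dim {:A}, m * m) := \matrix_t mxvec (psi b`_t).
have fullM : row_full M.
  rewrite -sub1mx; apply/row_subP => i.
  have [l [c [a aE]]] := rep_span (vec_mx (row i 1%:M) : 'M[E]_m).
  rewrite -[row i _]vec_mxK aE linear_sum summx_sub // => j _.
  rewrite linearZ /= scalemx_sub // {1}(coord_vbasis (memvf (a j))) rmorph_sum linear_sum.
  rewrite summx_sub // => t _; rewrite rep_funZ linearZ scalemx_sub //=.
  by rewrite -[mxvec _](rowK (fun t : 'I_(\dim {:A}) => mxvec (psi b`_t))) row_sub.
exists (fun k => b`_(fullrankfun fullM k)); rewrite -row_full_unit.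
have := fullrowsub_full fullM; congr row_full.
by apply/row_matrixP => k; rewrite row_rowsub !rowK.
Qed.

Lemma trace_form_nondegenerate (X : 'M[E]_m) :
  (forall x, \tr (X *m psi x) = 0) -> X = 0.
Proof.
move=> trX; have trN N : \tr (X *m N) = 0.
  have [l [c [a ->]]] := rep_span N; rewrite mulmx_sumr raddf_sum big1 // => i _.
  by rewrite -scalemxAr /= mxtraceZ trX mulr0.
apply/matrixP => i j; rewrite mxE -[RHS](trN (delta_mx j i)) /mxtrace.
rewrite (bigD1 i) //= big1 ?addr0 => [|k ki].
  rewrite mxE (bigD1 j) //= big1 ?addr0 => [|k kj]; first by rewrite mxE !eqxx mulr1.
  by rewrite mxE (negPf kj) mulr0.
by rewrite mxE big1 // => p _; rewrite mxE (negPf ki) andbF mulr0.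
Qed.

(** A relation between the rows of the Gram matrix yields a matrix orthogonal, for the trace form,
    to all psi(a_l) and hence to all of psi(A). *)
Lemma gram_unit (a : 'I_(m * m) -> A) :
    (\matrix_k mxvec (psi (a k)) : 'M[E]_(m * m)) \in unitmx ->
  \matrix_(k, l) \tr (psi (a k * a l)) \in unitmx.
Proof.
set B := \matrix_k _ => uB; rewrite -row_free_unit; apply/inj_row_free => u ug.
have uE : \sum_k u 0 k *: psi (a k) = vec_mx (u *m B).
  by rewrite mulmx_sum_row linear_sum; apply: eq_bigr => k _; rewrite linearZ /= rowK mxvecK.
have spanB x : exists c : 'rV[E]_(m * m), psi x = \sum_l c 0 l *: psi (a l).
  exists (mxvec (psi x) *m invmx B).
  apply: (can_inj mxvecK); rewrite linear_sum -[LHS](mulmxKV uB) mulmx_sum_row.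
  by apply: eq_bigr => l _; rewrite linearZ /= rowK.
suff uB0 : vec_mx (u *m B) = 0 :> 'M[E]_m.
  apply: (row_free_inj (A := B)); first by rewrite row_free_unit.
  by rewrite mul0mx -[LHS]vec_mxK uB0 linear0.
rewrite -uE; apply: trace_form_nondegenerate => x.
have [c ->] := spanB x.
rewrite mulmx_sumr raddf_sum big1 // => l _; rewrite -scalemxAr /= mxtraceZ.
have /rowP/(_ l) := ug; rewrite !mxE => ugl.
rewrite mulmx_suml raddf_sum [X in _ * X](_ : _ = 0) ?mulr0 //= -[RHS]ugl.
by apply: eq_bigr => k _; rewrite -scalemxAl mxtraceZ !mxE rmorphM.
Qed.

End TraceForm.

Section GroupAverage.
Variables (F : fieldType) (gT : finGroupType).
Local Notation A := (grpalg F gT).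
Local Notation t x := (grpalg_coef x 1%g).
Hypothesis cardG : #|gT|%:R != 0 :> F.
Local Notation dg := (grpalg_delta F).

(** The projection of A onto its centre by averaging over conjugation. On a component split by psi,
    m times it is the reduced trace. *)
Definition grpalg_avg (x : A) : A :=
  #|gT|%:R^-1 *: \sum_g dg g * x * dg g^-1%g.

Lemma grpalg_avg_lin c x y : grpalg_avg (c *: x + y) = c *: grpalg_avg x + grpalg_avg y.
Proof.
rewrite /grpalg_avg [c *: (_ *: _)]scalerA [c * _]mulrC -scalerA -scalerDr; congr (_ *: _).
rewrite scaler_sumr -big_split.
by apply: eq_bigr => g _; rewrite mulrDr mulrDl -scalerAr -scalerAl.
Qed.

Lemma grpalg_avg_central x y : grpalg_avg x * y = y * grpalg_avg x.
Proof.
rewrite [y]grpalg_sum_delta mulr_sumr mulr_suml; apply: eq_bigr => h _.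
rewrite -scalerAr -[_ * grpalg_avg x]scalerAl; congr (_ *: _).
rewrite /grpalg_avg -scalerAl -scalerAr; congr (_ *: _).
rewrite mulr_suml mulr_sumr (reindex_inj (mulgI h)) /=; apply: eq_bigr => g _.
rewrite -[LHS]mulrA grpalg_deltaM invMg -mulgA mulVg mulg1.
by rewrite -grpalg_deltaM !mulrA.
Qed.

Lemma grpalg_coef1_avg x y : (forall z, y * z = z * y) -> t (y * grpalg_avg x) = t (y * x).
Proof.
move=> yc; rewrite /grpalg_avg -scalerAr grpalg_coefZ mulr_sumr grpalg_coef_sum.
rewrite (eq_bigr (fun=> t (y * x))) => [|g _]; last first.
  rewrite [LHS](grpalg_coef1_mulC y) -!mulrA [LHS]grpalg_coef1_mulC -(yc (dg g^-1%g)).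
  by rewrite -!mulrA grpalg_deltaM mulVg grpalg_delta1 mulr1 [LHS]grpalg_coef1_mulC.
by rewrite sumr_const mulrnAr -mulrnAl -[_^-1 *+ _]mulr_natr mulVf // mul1r.
Qed.

Lemma trace_avg (psi : abs_rep A) x a : psi (grpalg_avg x) = a%:M ->
  \tr (psi x) = (rep_dim psi)%:R * a.
Proof.
move=> psix; have <- : \tr (psi (grpalg_avg x)) = (rep_dim psi)%:R * a.
  by rewrite psix mxtrace_scalar mulr_natl.
rewrite /grpalg_avg rep_funZ mxtraceZ !rmorph_sum raddf_sum /=.
rewrite (eq_bigr (fun=> \tr (psi x))) => [|g _]; last first.
  rewrite !rmorphM -!mulmxE mxtrace_mulC mulmxA mulmxE -rmorphM.
  by rewrite grpalg_deltaM mulVg grpalg_delta1 rmorph1 mul1r.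
rewrite sumr_const mulrnAr -mulrnAl -rmorphMn -[_^-1 *+ _]mulr_natr mulVf //.
by rewrite rmorph1 mul1r.
Qed.

End GroupAverage.

Section SkewfieldTrace.
Variables (F : fieldType) (gT : finGroupType) (O : subringClosed F).
Local Notation A := (grpalg F gT).
Local Notation t x := (grpalg_coef x 1%g).
Hypothesis cardG : #|gT|%:R != 0 :> F.
Variable Gam : subringClosed A.
Variables (N : nat) (g : 'I_N -> A).
Hypothesis gGam : forall t, g t \in Gam.
Hypothesis gspan : forall x, x \in Gam ->
  exists c : 'I_N -> F, (forall t, c t \in O) /\ x = \sum_t c t *: g t.
Variables (e : A) (D : falgType F) (w : D -> int) (V : subringClosed D).
Variables (n : nat) (phi : 'M[subring_of V]_n -> A) (delta : 'Hom(D, A)).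
Hypothesis n0 : (0 < n)%N.
Hypothesis iso : matrix_iso phi e (component [set` Gam] e).
Hypothesis ec : forall x, e * x = x * e.
Hypothesis ee : e * e = e.
Hypothesis eGam : e \in Gam.
Hypothesis Gam_full : full_lattice Gam.
Hypothesis Vfull : full_lattice V.
Hypothesis Dunit : forall x : D, x != 0 -> x \is a GRing.unit.
Hypothesis wV : valuation_ring w [set` V].
Hypothesis VO : forall c : F, (c%:A : D) \in V <-> c \in O.
Hypothesis deltaV : forall x : subring_of V, delta (val x) = phi x%:M.
Variable psi : abs_rep A.
Hypothesis psie : psi e = 1%:M.
Local Notation E := (rep_field psi).
Local Notation sigma := (rep_scalar psi).
Local Notation m := (rep_dim psi).
Let o : set A := centre (component [set` Gam] e).
Local Notation U := (Fspan o).

Let psi_inj x : x * e = x -> psi x = 0 -> x = 0.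
Proof. exact: (abs_rep_component_inj iso Vfull ec deltaV Gam_full Dunit psie). Qed.

Let psi_eq x y : x * e = x -> y * e = y -> psi x = psi y -> x = y.
Proof.
move=> xe ye xy; apply/eqP; rewrite -subr_eq0; apply/eqP/psi_inj.
  by rewrite mulrBl xe ye.
by rewrite raddfB /= xy subrr.
Qed.

Lemma mem_skew_center y : y \in U <-> (forall z, y * z = z * y) /\ y * e = y.
Proof.
split=> [yU|[yc ye]].
  split; first apply: Fspan_central yU => x [[x' x'G <-] xc] z.
    have [a a0 azG] := Gam_full z; apply: (scalerI a0); rewrite scalerAr scalerAl.
    have exe : e * x' * e = e * x' by rewrite -mulrA -ec mulrA ee.
    transitivity (e * x' * (e * (a *: z))); first by rewrite mulrA exe.
    rewrite xc; last by exists (a *: z).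
    rewrite [e * (a *: z)]ec -!mulrA.
    by rewrite [e * (e * _)]mulrA ee.
  by apply: Fspan_unit yU => _ [[x' _ <-] _]; rewrite -mulrA -ec mulrA ee.
have [a a0 ayG] := Gam_full y; apply: (Fspan_scale a0); split.
  by exists (a *: y); rewrite // ec -scalerAl ye.
by move=> z _; rewrite -scalerAl -scalerAr yc.
Qed.

Let Uc y : y \in U -> forall z, y * z = z * y.
Proof. by case/mem_skew_center. Qed.

Let Ue y : y \in U -> y * e = y.
Proof. by case/mem_skew_center. Qed.

Lemma skew_center_mul y z : y \in U -> z \in U -> y * z \in U.
Proof.
move=> yU zU; apply/mem_skew_center; split; last by rewrite -mulrA Ue.
by apply: central_mul; apply: Uc.
Qed.

Lemma skew_center_e : e \in U.
Proof. exact/mem_skew_center. Qed.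

Lemma delta_center d : (forall d', d * d' = d' * d) -> delta d \in U.
Proof.
move=> dc; apply/mem_skew_center; split; last exact: (delta_unit iso Vfull deltaV).
exact: (delta_central iso Vfull ec deltaV Gam_full).
Qed.

Lemma skew_centerP y : y \in U -> exists d, y = delta d /\ forall d', d * d' = d' * d.
Proof.
move=> yU; have [d [dE dc]] := central_delta n0 iso Vfull ec deltaV Gam_full (Uc yU).
by exists d; rewrite -dE Ue.
Qed.

(* The image of the centre in E. It is closed under inverses, so it contains the entries
   of the inverse of a Gram matrix of the reduced trace form; hence a basis of the
   matrix ring over E taken from psi(A) is already a basis of eA over the centre. *)
Definition center_value : {pred E} :=
  [pred a | `[< exists2 y, y \in U & psi y = a%:M >]].

Fact center_value_subring_closed : subring_closed center_value.
Proof.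
split=> [|a b /asboolP[y yU ya] /asboolP[z zU zb]|a b /asboolP[y yU ya] /asboolP[z zU zb]];
  apply/asboolP.
- by exists e => //; apply: skew_center_e.
- by exists (y - z); [apply: rpredB | rewrite !raddfB /= ya zb].
- by exists (y * z); [apply: skew_center_mul | rewrite rmorphM ya zb scalar_mxM].
Qed.

HB.instance Definition _ :=
  GRing.isSubringClosed.Build E center_value center_value_subring_closed.

Lemma center_valueV a : a \in center_value -> a^-1 \in center_value.
Proof.
move=> /asboolP[y yU ya]; have [->|a0] := eqVneq a 0.
  by rewrite invr0; apply/asboolP; exists 0; rewrite ?mem0v // !raddf0.
have [d [yd dc]] := skew_centerP yU.
have d0 : d != 0.
  apply: contra_neq a0 => d0; apply: (@abs_rep_inj1 _ _ psi).
  by rewrite -ya yd d0 linear0 !raddf0.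
apply/asboolP; exists (delta d^-1).
  apply: delta_center => d'; apply: (mulIr (Dunit d0)); apply: (mulrI (Dunit d0)).
  by rewrite -!mulrA mulVr ?Dunit // mulr1 !mulrA divrr ?Dunit // mul1r dc.
have : psi (delta d) *m psi (delta d^-1) = 1%:M.
  by rewrite mulmxE -rmorphM -(deltaM iso Vfull deltaV) divrr ?Dunit // (delta1 iso deltaV).
rewrite -yd ya mul_scalar_mx => /(congr1 ( *:%R a^-1)).
by rewrite scalerA mulVf // scale1r scalemx1.
Qed.

(** The reduced trace of eA, realised inside A: by [trace_avg] the average has a psi-value a with m
    a = tr psi(x), hence the factor m. *)
Definition redtrace (x : A) : A := m%:R *: (grpalg_avg x * e).

Lemma redtrace_rep x : psi (redtrace x) = (\tr (psi x))%:M.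
Proof.
have [a pa] : exists a, psi (grpalg_avg x) = a%:M.
  by apply: abs_rep_center => y; apply: grpalg_avg_central.
rewrite (trace_avg cardG pa) /redtrace rep_funZ rmorphM pa psie mulr1.
by rewrite scale_scalar_mx rmorph_nat.
Qed.

Lemma redtrace_center x : redtrace x \in U.
Proof.
apply/rpredZ/mem_skew_center; split; last by rewrite -mulrA ee.
by apply: central_mul => // z; apply: grpalg_avg_central.
Qed.

Lemma redtrace_lin c x y : redtrace (c *: x + y) = c *: redtrace x + redtrace y.
Proof.
rewrite /redtrace grpalg_avg_lin mulrDl scalerDr -scalerAl !scalerA.
by rewrite [c * _]mulrC.
Qed.

Lemma skew_center_basis : exists (a : 'I_(m * m) -> A) (kappa : 'I_(m * m) -> A -> A),
  free_over e U a kappa.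
Proof.
have [a ua] := exists_matrix_basis psi.
have ug := gram_unit ua; set G := \matrix_(k, l) \tr (psi (a k * a l)) in ug.
set B := \matrix_k mxvec _ in ua.
have GT i j : invmx G i j \in center_value.
  apply: invmx_mem => [x|p q]; first exact: center_valueV.
  rewrite mxE; apply/asboolP; exists (redtrace (a p * a q)); first exact: redtrace_center.
  exact: redtrace_rep.
have gamP (kl : 'I_(m * m) * 'I_(m * m)) :
    exists y, y \in U /\ psi y = (invmx G kl.1 kl.2)%:M.
  by have /asboolP[y yU yE] := GT kl.1 kl.2; exists y.
have [gam gamE] := choice gamP.
(* Coordinates come from pairing x with the a_l under the reduced trace form and applying the
   inverse Gram matrix, whose entries gam lifts to the centre. *)
pose kappa k x := \sum_l redtrace (x * a l) * gam (l, k).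
have kappaU k x : kappa k x \in U.
  apply: rpred_sum => l _; apply: skew_center_mul; first exact: redtrace_center.
  exact: (gamE _).1.
pose co x : 'rV[E]_(m * m) := \row_l \tr (psi (x * a l)) *m invmx G.
have psi_kappa k x : psi (kappa k x) = (co x 0 k)%:M.
  rewrite /kappa rmorph_sum mxE raddf_sum; apply: eq_bigr => l _ /=.
  by rewrite rmorphM redtrace_rep (gamE _).2 -mulmxE -scalar_mxM mxE.
have co_basis (c : 'rV[E]_(m * m)) x : psi x = \sum_k c 0 k *: psi (a k) -> co x = c.
  move=> xE; apply: (row_free_inj (A := G)); first by rewrite row_free_unit.
  rewrite /= mulmxKV //; apply/rowP => l; rewrite !mxE rmorphM xE -mulmxE mulmx_suml raddf_sum.
  by apply: eq_bigr => k _; rewrite -scalemxAl /= mxtraceZ mxE rmorphM.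
have kappa_e k x : kappa k x * e = kappa k x by apply: Ue.
exists a, kappa; split=> // [k c x y|x|k j y yU].
- rewrite /kappa scaler_sumr -big_split; apply: eq_bigr => l _ /=.
  have -> : (c *: x + y) * a l = c *: (x * a l) + y * a l by rewrite mulrDl -scalerAl.
  by rewrite redtrace_lin mulrDl [c *: (_ * _)]scalerAl.
- apply: psi_eq; first by rewrite -mulrA ee.
    rewrite mulr_suml; apply: eq_bigr => k _.
    by rewrite -mulrA -ec mulrA kappa_e.
  have [c cE] : exists c : 'rV[E]_(m * m), psi x = \sum_l c 0 l *: psi (a l).
    exists (mxvec (psi x) *m invmx B).
    apply: (can_inj mxvecK); rewrite linear_sum -[LHS](mulmxKV ua) mulmx_sum_row.
    by apply: eq_bigr => l _; rewrite linearZ /= rowK.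
  rewrite rmorphM psie mulr1 cE rmorph_sum; apply: eq_bigr => k _.
  by rewrite rmorphM psi_kappa (co_basis c) // -mulmxE mul_scalar_mx.
- have [b yb] := abs_rep_center psi (Uc yU).
  apply: psi_eq; rewrite ?mulrnAl ?Ue // psi_kappa.
  rewrite (co_basis (\row_l (b *+ (l == j)))).
    by rewrite mxE raddfMn /= raddfMn /= yb.
  rewrite rmorphM yb -mulmxE mul_scalar_mx (bigD1 j) //= big1 ?addr0.
    by rewrite mxE eqxx.
  by move=> k' /negPf kj; rewrite mxE kj mulr0n scale0r.
Qed.

Variable s : nat.
Hypothesis dimD : \dim {:D} = (s ^ 2 * \dim 'Z({:D}))%N.

(** The F-dimension of eA is m^2 dim U by the basis over the centre and n^2 dim D by the matrix
    units over delta(D). Since delta identifies the centre of D with U, this gives m^2 = (n s)^2. *)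
Lemma skew_rep_dim : m = (n * s)%N.
Proof.
have [a [kappa fr]] := skew_center_basis.
have fr' : free_over e (limg delta) (fun kl : 'I_n * 'I_n => munit phi kl.1 kl.2)
    (fun kl => mentry phi kl.1 kl.2).
  split=> [[k l] c x y|[k l] x|x|[k l] [p q] y /memv_imgP[d _ ->]] /=.
  - by rewrite mentryD mentryZ.
  - have [d ->] := mentry_delta iso ec deltaV Gam_full k l x.
    by rewrite memv_img ?memvf.
  - by rewrite (mentry_decomp iso ec) pair_bigA.
  - rewrite (mentry_mul_munit iso) ?(delta_unit iso Vfull deltaV) // => p' q'.
    exact: (delta_munit iso Vfull deltaV).
have ker0 W : (W :&: lker delta = 0)%VS.
  apply/eqP; rewrite -subv0; apply/subvP => x; rewrite memv_cap memv_ker memv0.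
  by case/andP => _ /eqP dx; apply/eqP/(delta_inj n0 iso Vfull deltaV).
have dU : \dim U = \dim 'Z({:D}).
  rewrite -(limg_dim_eq (ker0 'Z({:D})%VS)); congr (\dim _); apply/vspaceP => y.
  apply/idP/memv_imgP => [/skew_centerP[d [yd dc]]|[d]].
    exists d => //; rewrite memv_cap memvf /=; apply/centvP => d' _; exact: dc.
  rewrite memv_cap => /andP[_ /centvP dc] ->; apply: delta_center => d'.
  by rewrite dc ?memvf.
have limg_e x : x \in limg delta -> x * e = x.
  by case/memv_imgP => d _ ->; apply: (delta_unit iso Vfull deltaV).
have := free_over_dim ec ee Ue limg_e fr fr'.
rewrite dU (limg_dim_eq (ker0 _)) dimD card_prod !card_ord.
have Z0 : (0 < \dim 'Z({:D}))%N.
  rewrite lt0n dimv_eq0; apply/eqP => Z0; have : (1 : D) \in 'Z({:D})%VS.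
    by rewrite memv_cap memvf /=; apply/centvP => d _; rewrite mul1r mulr1.
  by rewrite Z0 memv0 oner_eq0.
rewrite [(n * n * _)%N]mulnA => /eqP; rewrite eqn_pmul2r // !mulnn -expnMn.
by rewrite eqn_exp2r // => /eqP.
Qed.

(** The reduced trace of gam is delta d with d central, and its psi-value is up to sign a
    coefficient of a characteristic polynomial, hence integral; so d lies in V. The identity holds
    because averaging does not change t against central elements, and m = n s. *)
Lemma skew_reduced_trace gam : gam \in Gam -> exists2 zeta, o zeta &
  forall y, y \in U -> (n * s)%:R * t (y * gam) = t (y * zeta).
Proof.
move=> gG; exists (redtrace gam); last first.
  move=> y yU; rewrite -skew_rep_dim /redtrace -scalerAr grpalg_coefZ.
  rewrite -[grpalg_avg gam * e]ec mulrA Ue // grpalg_coef1_avg //; exact: Uc.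
have [d [dE dc]] := skew_centerP (redtrace_center gam).
have dV : d \in V.
  apply: (delta_integral gGam gspan iso Vfull Dunit wV VO deltaV psie
           (c := fun r : 'I_1 => \tr (psi gam)) (gam := fun r => 1)) => [r|r|].
  - apply/integral_memP; pose H : 'M[A]_1 := gam%:M.
    have trE : \tr (psi gam) = - (char_poly (blockrep psi H))`_(\sum_(i < 1) m).-1.
      rewrite char_poly_trace ?big_ord1 ?rep_dim_gt0 // opprK mxtrace_mxblock big_ord1.
      by rewrite mxE eqxx mulr1n.
    rewrite trE rpredN; apply/integral_memP/(integral_char_poly gGam gspan) => i j.
    by rewrite !ord1 mxE eqxx mulr1n.
  - exact: rpred1.
  - by rewrite big_ord1 rmorph1 scalemx1 -dE redtrace_rep.
split; last by move=> z _; apply: (Uc (redtrace_center gam)).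
by rewrite dE -[d]/(val (Subring_of dV)) deltaV; apply: (miso_image iso).
Qed.

End SkewfieldTrace.

(** * Fitting invariants *)

Lemma det_reindex (R : comNzRingType) n1 n2 (f : 'I_n1 -> 'I_n2) (M : 'M[R]_n2) :
  n1 = n2 -> injective f -> \det (mxsub f f M) = \det M.
Proof.
move=> n12; subst n2 => finj; pose s := perm finj.
have -> : mxsub f f M = row_perm s (col_perm s M).
  by apply/matrixP => i j; rewrite !mxE !permE.
rewrite row_permE col_permE !det_mulmx !det_perm odd_permV [\det M * _]mulrC.
exact: signrMK.
Qed.

Lemma RankC_inj m b (i j : 'I_b) (x y : 'I_m) :
  tagnat.Rank (p_ := fun=> m) i x = tagnat.Rank (p_ := fun=> m) j y ->
  i = j /\ x = y :> nat.
Proof.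
move=> e; have ij : i = j by have := congr1 tagnat.sig1 e; rewrite !tagnat.Rank1K.
split=> //; have := congr1 (@nat_of_ord _) e.
by rewrite !tagnat.RankEsum ij => /addnI.
Qed.

Lemma sigC_inj m b (s s' : 'I_(\sum_(i < b) m)) :
  tagnat.sig1 s = tagnat.sig1 s' -> tagnat.sig2 s = tagnat.sig2 s' :> nat -> s = s'.
Proof.
by move=> e1 e2; apply: ord_inj; rewrite tagnat.rect [RHS]tagnat.rect e1 e2.
Qed.

Section BlockDeterminant.
Variables (T : Type) (R : comNzRingType) (m : nat) (f : T -> 'M[R]_m).
Local Notation bl b1 b2 H := (\mxblock_(i < b1, j < b2) f (H i j)).

Lemma mxblock_Rank b1 b2 (H : 'M[T]_(b1, b2)) i j (x y : 'I_m) :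
  bl b1 b2 H (tagnat.Rank (p_ := fun=> m) i x) (tagnat.Rank (p_ := fun=> m) j y) = f (H i j) x y.
Proof.
have := mxblockK (fun (i : 'I_b1) (j : 'I_b2) => f (H i j)) i j.
by move/matrixP/(_ x y) => <-; rewrite [RHS]mxE.
Qed.

Definition block_index b1 b2 (u : 'I_(\sum_(i < b1) m + \sum_(i < b2) m)) :
    'I_(\sum_(i < b1 + b2) m) :=
  match split u with
  | inl s => tagnat.Rank (p_ := fun=> m) (lshift b2 (tagnat.sig1 s)) (tagnat.sig2 s)
  | inr s => tagnat.Rank (p_ := fun=> m) (rshift b1 (tagnat.sig1 s)) (tagnat.sig2 s)
  end.

(** The index types of the two sides have equal size but different shape, so the matrices agree only
    after the renumbering [block_index]. *)
Lemma det_mxblock_block_mx b1 b2 (A1 : 'M[T]_b1) (B1 : 'M_(b1, b2)) (C1 : 'M_(b2, b1))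
    (D1 : 'M_b2) :
  \det (bl (b1 + b2) (b1 + b2) (block_mx A1 B1 C1 D1)) =
  \det (block_mx (bl b1 b1 A1) (bl b1 b2 B1) (bl b2 b1 C1) (bl b2 b2 D1)).
Proof.
rewrite -(@det_reindex _ _ _ (@block_index b1 b2)).
- congr (\det _); apply/matrixP => u v; rewrite [LHS]mxE /block_index.
  rewrite -[in RHS](splitK u) -[in RHS](splitK v).
  case: (split u) => u'; case: (split v) => v' /=; rewrite mxblock_Rank.
  + by rewrite !block_mxEul [RHS]mxE.
  + by rewrite !block_mxEur [RHS]mxE.
  + by rewrite !block_mxEdl [RHS]mxE.
  + by rewrite !block_mxEdr [RHS]mxE.
- by rewrite !sum_nat_const !card_ord mulnDl.
- move=> u v uv; apply: (can_inj splitK); move: uv; rewrite /block_index.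
  case: (split u) => u'; case: (split v) => v' /RankC_inj[e1 e2].
  + by congr inl; apply: sigC_inj e2; apply: (@lshift_inj b1 b2).
  + by move/eqP: e1; rewrite eq_lrshift.
  + by move/eqP: e1; rewrite eq_rlshift.
  + by congr inr; apply: sigC_inj e2; apply: (@rshift_inj b1 b2).
Qed.

End BlockDeterminant.

Section ReducedNormBlocks.
Variables (F : fieldType) (A : falgType F).

(** [nr] picks an element satisfying [is_nr]. Equal determinants give equal predicates and hence the
    same choice, even for matrices of different sizes and even if nothing satisfies them. *)
Lemma nr_ext b b' (H : 'M[A]_b) (H' : 'M[A]_b') :
  (forall (E : fieldType) m (psi : {rmorphism A -> 'M[E]_m}),
     \det (\mxblock_(i < b, j < b) psi (H i j)) =
     \det (\mxblock_(i < b', j < b') psi (H' i j))) ->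
  nr H = nr H'.
Proof.
move=> HH'; rewrite /nr; congr xget; apply/predeqP => z; split=> -[zc nz]; split=> //.
  by move=> e pe E m psi sp; rewrite -HH'; apply: (nz e pe).
by move=> e pe E m psi sp; rewrite HH'; apply: (nz e pe).
Qed.

Lemma mxblock_rmorph1 (E : fieldType) m (psi : {rmorphism A -> 'M[E]_m}) b :
  \mxblock_(i < b, j < b) psi ((1%:M : 'M[A]_b) i j) = 1%:M.
Proof.
rewrite -(mxdiagZ (p_ := fun=> m)); apply: eq_mxblock => i j.
by rewrite mxE; case: eqP => _; rewrite ?rmorph1 ?rmorph0 // conform_mx_id.
Qed.

Lemma mxblock_rmorph0 (E : fieldType) m (psi : {rmorphism A -> 'M[E]_m}) b b' :
  \mxblock_(i < b, j < b') psi ((0 : 'M[A]_(b, b')) i j) = 0.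
Proof. by rewrite -mxblock0; apply: eq_mxblock => i j; rewrite mxE rmorph0. Qed.

Lemma nr_lblock b1 b2 (H : 'M[A]_b1) (C : 'M[A]_(b2, b1)) :
  nr (block_mx H 0 C 1%:M) = nr H.
Proof.
apply: nr_ext => E m psi; rewrite det_mxblock_block_mx.
by rewrite mxblock_rmorph0 mxblock_rmorph1 det_lblock det1 mulr1.
Qed.

Lemma nr_ublock b1 b2 (H : 'M[A]_b2) (B : 'M[A]_(b1, b2)) :
  nr (block_mx 1%:M B 0 H) = nr H.
Proof.
apply: nr_ext => E m psi; rewrite det_mxblock_block_mx.
by rewrite mxblock_rmorph0 mxblock_rmorph1 det_ublock det1 mul1r.
Qed.

End ReducedNormBlocks.

Section MulSpan.
Variables (A : nzRingType).

Lemma mul_span0 (R S : set A) : mul_span R S 0.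
Proof. by exists 0%N, (fun=> 0), (fun=> 0); split; rewrite ?big_ord0 // => -[]. Qed.

Lemma mul_span_mul (R S : set A) r s : R r -> S s -> mul_span R S (r * s).
Proof.
by move=> Rr Ss; exists 1%N, (fun=> r), (fun=> s); split; rewrite ?big_ord1.
Qed.

Lemma mul_spanD (R S : set A) x y :
  mul_span R S x -> mul_span R S y -> mul_span R S (x + y).
Proof.
move=> [n [r [s [Rr Ss ->]]]] [n' [r' [s' [Rr' Ss' ->]]]].
pose cat (u : 'I_n -> A) (u' : 'I_n' -> A) (i : 'I_(n + n')) :=
  match split i with inl j => u j | inr j => u' j end.
exists (n + n')%N, (cat r r'), (cat s s'); split=> [i|i|].
- by rewrite /cat; case: split.
- by rewrite /cat; case: split.
- rewrite big_split_ord /=; congr (_ + _); apply: eq_bigr => i _; rewrite /cat.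
    by case: splitP => j ij; [congr (r _ * s _); apply: ord_inj | have := ltn_ord i;
      rewrite [X in (X < _)%N]ij ltnNge leq_addr].
  case: splitP => j ij; last by congr (r' _ * s' _); apply/ord_inj/(@addnI n); rewrite -ij.
  by have := ltn_ord j; rewrite -ij ltnNge leq_addr.
Qed.

Lemma mul_span_ind (R S : set A) (P : A -> Prop) : P 0 ->
    (forall x y, P x -> P y -> P (x + y)) -> (forall r s, R r -> S s -> P (r * s)) ->
  forall x, mul_span R S x -> P x.
Proof.
move=> P0 PD PM _ [n [r [s [Rr Ss ->]]]].
by elim/big_rec: _ => // i y _; apply: PD; apply: PM.
Qed.

Lemma mul_span_mono (R R' S S' : set A) :
  R `<=` R' -> S `<=` S' -> mul_span R S `<=` mul_span R' S'.
Proof.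
move=> RR SS x; apply: mul_span_ind => [|y z|r s /RR Rr /SS Ss].
- exact: mul_span0.
- exact: mul_spanD.
- exact: mul_span_mul.
Qed.

Lemma mul_span_scale (R S : set A) c x :
  (forall r, R r -> R (c * r)) -> mul_span R S x -> mul_span R S (c * x).
Proof.
move=> cR; move: x; apply: mul_span_ind => [|x y xP yP|r s Rr Ss].
- by rewrite mulr0; apply: mul_span0.
- by rewrite mulrDr; apply: mul_spanD.
- by rewrite mulrA; apply: mul_span_mul => //; apply: cR.
Qed.

End MulSpan.

Section FittingFamily.
Variables (F : fieldType) (A : falgType F) (L : subringClosed A).
Local Notation Lam := (subring_of L).

Lemma Fit_mx0 a b (h : 'M[Lam]_(a, b)) : Fit_mx h 0.
Proof. by rewrite /Fit_mx; case: ifP => // _; apply: mul_span0. Qed.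

Lemma Fit_mxD a b (h : 'M[Lam]_(a, b)) x y : Fit_mx h x -> Fit_mx h y -> Fit_mx h (x + y).
Proof.
rewrite /Fit_mx; case: ifP => _; first exact: mul_spanD.
by move=> -> ->; rewrite /= addr0.
Qed.

Lemma Fit_mxM a b (h : 'M[Lam]_(a, b)) c x :
  centre [set` L] c -> Fit_mx h x -> Fit_mx h (c * x).
Proof.
move=> [cL cc]; rewrite /Fit_mx; case: ifP => _; last by move=> ->; rewrite /= mulr0.
apply: mul_span_scale => r; apply: mul_span_scale => {}r [rL rc]; split.
  exact: rpredM.
by move=> y yL; rewrite -mulrA rc // !mulrA cc.
Qed.

Lemma Fit_mx_sub a b a' b' (h : 'M[Lam]_(a, b)) (h' : 'M[Lam]_(a', b')) :
    (b <= a -> b' <= a')%N ->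
    (forall f : 'I_b -> 'I_a, {homo f : i j / (i < j)%N} ->
       exists2 f' : 'I_b' -> 'I_a', {homo f' : i j / (i < j)%N} &
         nrL (rowsub f' h') = nrL (rowsub f h)) ->
  Fit_mx h `<=` Fit_mx h'.
Proof.
move=> le ff'; rewrite /Fit_mx; case: ifP => [/le -> | _ x ->]; last exact: (Fit_mx0 h').
apply: mul_span_mono => // _ [f /ff'[f' f'h <-] <-].
by exists f'.
Qed.

Section CommonPresentation.
Variables (a1 b1 a2 b2 : nat) (h1 : 'M[Lam]_(a1, b1)) (h2 : 'M[Lam]_(a2, b2)).
Variables (X : 'M[Lam]_(b2, b1)) (Y : 'M[Lam]_(b1, b2)).

(* Relations on the generators of both presentations; X and Y express the generators of
   one presentation through those of the other. *)
Definition common_presentation : 'M[Lam]_(b1 + (a2 + (a1 + b2)), b1 + b2) :=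
  col_mx (row_mx 1%:M (- Y)) (col_mx (row_mx 0 h2)
    (col_mx (row_mx h1 0) (row_mx (- X) 1%:M))).

Lemma common_presentation_size : (b1 + b2 <= b1 + (a2 + (a1 + b2)))%N.
Proof. by rewrite leq_add2l addnA leq_addl. Qed.

(** Select the rows of h1 given by f, followed by all rows (-X, 1): the result is block triangular
    with an identity block. The groups of rows in [common_presentation] are ordered so that this
    selection and the one for h2 are both increasing. *)
Lemma Fit_common_l : Fit_mx h1 `<=` Fit_mx common_presentation.
Proof.
apply: Fit_mx_sub => [_|f fh]; first exact: common_presentation_size.
exists (fun u => match split u with
  | inl i => rshift b1 (rshift a2 (lshift b2 (f i)))
  | inr j => rshift b1 (rshift a2 (rshift a1 j)) end).
  move=> u v; case: (splitP u) => i ui; case: (splitP v) => j vj; rewrite /= ui vj !ltn_add2l.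
  - exact: fh.
  - by move=> _; rewrite ltn_addr.
  - by rewrite ltnNge ltnW // ltn_addr.
  - by [].
rewrite /nrL.
have -> : rowsub (fun u => match split u with
  | inl i => rshift b1 (rshift a2 (lshift b2 (f i)))
  | inr j => rshift b1 (rshift a2 (rshift a1 j)) end) common_presentation =
  block_mx (rowsub f h1) 0 (- X) 1%:M.
  apply/matrixP => u v; rewrite mxE -[u in RHS]splitK -[v]splitK /common_presentation /block_mx.
  by case: (split u) => i; case: (split v) => j;
    rewrite /= !(col_mxEd, col_mxEu) !(row_mxEl, row_mxEr) ?mxE.
by rewrite map_block_mx map_mx0 map_mx1 nr_lblock.
Qed.

Lemma Fit_common_r : Fit_mx h2 `<=` Fit_mx common_presentation.
Proof.
apply: Fit_mx_sub => [_|f fh]; first exact: common_presentation_size.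
exists (fun u => match split u with
  | inl i => lshift _ i
  | inr j => rshift b1 (lshift _ (f j)) end).
  move=> u v; case: (splitP u) => i ui; case: (splitP v) => j vj; rewrite /= ui vj ?ltn_add2l //.
  - by move=> _; rewrite ltn_addr.
  - by rewrite ltnNge ltnW // ltn_addr.
  - exact: fh.
rewrite /nrL.
have -> : rowsub (fun u => match split u with
  | inl i => lshift _ i
  | inr j => rshift b1 (lshift _ (f j)) end) common_presentation =
  block_mx 1%:M (- Y) 0 (rowsub f h2).
  apply/matrixP => u v; rewrite mxE -[u in RHS]splitK -[v]splitK /common_presentation /block_mx.
  by case: (split u) => i; case: (split v) => j;
    rewrite /= !(col_mxEd, col_mxEu) !(row_mxEl, row_mxEr) ?mxE.
by rewrite map_block_mx map_mx0 map_mx1 nr_ublock.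
Qed.

End CommonPresentation.

Variable M : lmodType Lam.

Lemma Fit_family_directed I1 I2 : Fit_family M I1 -> Fit_family M I2 ->
  exists I, [/\ Fit_family M I, I1 `<=` I & I2 `<=` I].
Proof.
move=> [a1 [b1 [h1 [[p1 [s1 k1]] ->]]]] [a2 [b2 [h2 [[p2 [s2 k2]] ->]]]].
have lift c1 c2 (q1 : {linear 'rV[Lam]_c1 -> M}) (q2 : {linear 'rV[Lam]_c2 -> M}) :
    (forall x, exists v, q1 v = x) -> exists Z : 'M[Lam]_(c2, c1), forall v, q1 (v *m Z) = q2 v.
  move=> sq; have /choice[z zP] : forall j : 'I_c2, exists v, q1 v = q2 (delta_mx 0 j).
    by move=> j; apply: sq.
  exists (\matrix_j z j) => v; rewrite mulmx_sum_row {2}[v]row_sum_delta !linear_sum.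
  by apply: eq_bigr => j _; rewrite rowK !linearZ /= zP.
have [X XP] := lift _ _ p1 p2 s1; have [Y YP] := lift _ _ p2 p1 s2.
exists (Fit_mx (common_presentation h1 h2 X Y)); split; last exact: Fit_common_r.
  exists (b1 + (a2 + (a1 + b2)))%N, (b1 + b2)%N, (common_presentation h1 h2 X Y); split=> //.
  pose q := ((p1 \o lsubmx) \+ (p2 \o rsubmx)) : {linear 'rV[Lam]_(b1 + b2) -> M}.
  have qE v w : q (row_mx v w) = p1 v + p2 w by rewrite /q /= row_mxKl row_mxKr.
  exists q; split=> [x|v].
    by have [v <-] := s1 x; exists (row_mx v 0); rewrite qE linear0 addr0.
  rewrite -[v]hsubmxK; set v1 := lsubmx v; set v2 := rsubmx v; rewrite qE; split=> [pv|[u]].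
    (* Subtracting v2 times the rows (-X, 1) from (v1, v2) leaves v1 + v2 X, a relation for p1 and
       hence of the form u h1. *)
    have /k1[u uE] : p1 (v1 + v2 *m X) = 0 by rewrite linearD /= XP.
    exists (row_mx 0 (row_mx 0 (row_mx u v2))).
    rewrite /common_presentation !mul_row_col !mul0mx !add0r !mul_mx_row add_row_mx.
    by rewrite mulmx0 mulmx1 add0r mulmxN -uE addrK.
  rewrite -[u]hsubmxK -[rsubmx u]hsubmxK -[rsubmx (rsubmx u)]hsubmxK.
  move: (lsubmx u) (lsubmx (rsubmx u)) (lsubmx (rsubmx (rsubmx u))) (rsubmx (rsubmx (rsubmx u))).
  move=> u1 u2 u3 u4; rewrite /common_presentation !mul_row_col !mul_mx_row !add_row_mx.
  rewrite !mulmx0 !mulmx1 !add0r => /eq_row_mx[-> ->].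
  have ph1 : p1 (u3 *m h1) = 0 by apply/k1; exists u3.
  have ph2 : p2 (u2 *m h2) = 0 by apply/k2; exists u2.
  rewrite !linearD /= ph1 ph2 !add0r !mulmxN !linearN /= XP YP.
  by rewrite addrACA subrr add0r addNr.
exact: Fit_common_l.
Qed.

End FittingFamily.

(** * Noetherianity of lattices and the greatest Fitting invariant *)

Section Noetherian.
Variables (F : fieldType) (O : subringClosed F) (v : F -> int).
Hypothesis vO : valuation_ring v [set` O].

Definition lattice_submodule N (P : set 'rV[F]_N) : Prop :=
  [/\ P 0, forall x y, P x -> P y -> P (x + y) & forall c x, c \in O -> P x -> P (c *: x)].

Let Funit (x : F) : x != 0 -> x \is a GRing.unit. Proof. by rewrite unitfE. Qed.

(* The generators s are characterised by: every submodule containing s contains P. *)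
Lemma lattice_submodule_fg N (P : set 'rV[F]_N) :
    lattice_submodule P -> (forall x i, P x -> x 0 i \in O) ->
  exists2 s : seq 'rV[F]_N, forall x, x \in s -> P x &
    forall Q : set 'rV[F]_N, lattice_submodule Q -> (forall x, x \in s -> Q x) -> P `<=` Q.
Proof.
move=> Pm PO.
(* Induction on k, where the first N - k coordinates vanish on R; k = N is the claim. *)
suff gen k (R : set 'rV[F]_N) : lattice_submodule R -> (forall x i, R x -> x 0 i \in O) ->
    (forall x (i : 'I_N), R x -> (i + k < N)%N -> x 0 i = 0) ->
  exists2 s : seq 'rV[F]_N, forall x, x \in s -> R x &
    forall Q : set 'rV[F]_N, lattice_submodule Q -> (forall x, x \in s -> Q x) -> R `<=` Q.
  by apply: (gen N) => // x i _; rewrite ltnNge leq_addl.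
elim: k R => [|k IH] R Rm RO Rz.
  exists [::] => // Q [Q0 _ _] _ x Rx; suff -> : x = 0 by [].
  by apply/rowP => i; rewrite mxE Rz // addn0.
have [kN|kN] := leqP N k; first by apply: IH => // x i _; rewrite ltnNge (leq_trans kN) ?leq_addl.
have iP : (N - k.+1 < N)%N by rewrite ltn_subrL (leq_ltn_trans _ kN).
pose i0 := Ordinal iP; pose R' := [set x | R x /\ x 0 i0 = 0].
have [R0 RD RZ] := Rm.
have R'm : lattice_submodule R'.
  split=> [|x y [Rx x0] [Ry y0]|c x cO [Rx x0]]; split; rewrite ?mxE ?x0 ?y0 ?addr0 ?mulr0 //.
  - exact: RD.
  - exact: RZ.
have [||s sR' genR'] := IH R' R'm.
- by move=> x i [Rx _]; apply: RO.
- move=> x i [Rx x0];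
  rewrite -[(_ < _)%N]/((i + k).+1 <= N)%N -addnS leq_eqVlt => /orP[/eqP ik|]; last by move/Rz;
    apply.
  by rewrite (_ : i = i0) //; apply: ord_inj; rewrite /= -[in RHS]ik addnK.
have [[p0 [Rp0 p00]]|noR] := pselect (exists p, R p /\ p 0 i0 != 0); last first.
  exists s => [x /sR'[]//|Q Qm sQ x Rx]; apply: genR' => //; split=> //.
  by apply: contrapT => /eqP x0; apply: noR; exists x.
(* A vector of R whose coordinate at i0 has least valuation generates the projection of R to that
   coordinate; subtracting a multiple of it leads into R'. *)
have exn : exists n, `[< exists p, [/\ R p, p 0 i0 != 0 & `|v (p 0%R i0)|%N = n] >].
  by exists `|v (p0 0%R i0)|%N; apply/asboolP; exists p0.
case: (ex_minnP exn) => n /asboolP[p [Rp p0i vp]] minp.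
exists (p :: s) => [x|Q Qm sQ x Rx].
  by rewrite inE => /orP[/eqP->//|/sR'[]].
have [Q0 QD QZ] := Qm.
have Op1 : (-1 : F) \in O by rewrite rpredN rpred1.
set c := x 0 i0 / p 0 i0.
have cO : c \in O.
  have [x0|x0] := eqVneq (x 0 i0) 0; first by rewrite /c x0 mul0r rpred0.
  have pos y : y != 0 -> y \in O -> 0 <= v y.
    by move=> y0 /(valuation_ringE vO)[/eqP|//]; rewrite (negPf y0).
  apply/(valuation_ringE vO); right; rewrite /c (valuationM vO) ?invr_eq0 //.
  rewrite (valuationV Funit vO) // subr_ge0.
  rewrite -[v (p _ _)]gez0_abs ?pos ?RO // -[v (x _ _)]gez0_abs ?pos ?RO //.
  by rewrite lez_nat vp; apply: minp; apply/asboolP; exists x.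
have -> : x = (x + - c *: p) + c *: p by rewrite scaleNr subrK.
apply: QD; last by apply: QZ => //; apply: sQ; rewrite mem_head.
apply: genR' => // [y ys|]; first by apply: sQ; rewrite inE ys orbT.
split; last by rewrite !mxE mulNr mulfVK // subrr.
by apply: RD => //; apply: RZ => //; rewrite rpredN.
Qed.

End Noetherian.

Section MaximalFitting.
Variables (F : fieldType) (O : subringClosed F) (v : F -> int).
Hypothesis vO : valuation_ring v [set` O].
Variables (A : falgType F) (L : subringClosed A).
Variables (N : nat) (g : 'I_N -> A).
Hypothesis gspan : forall x, x \in L ->
  exists c : 'I_N -> F, (forall t, c t \in O) /\ x = \sum_t c t *: g t.
Hypothesis OL : forall c : F, c \in O -> c%:A \in L.
Variable M : lmodType (subring_of L).
Hypothesis FitL : forall I x, Fit_family M I -> I x -> x \in L.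

Lemma Fit_family_submodule I : Fit_family M I ->
  lattice_submodule O [set x : 'rV[F]_N | I (\sum_t x 0 t *: g t)].
Proof.
move=> [a [b [h [_ ->]]]]; split=> [|x y Ix Iy|c x cO Ix] /=.
- rewrite big1 => [|t _]; first exact: Fit_mx0.
  by rewrite mxE scale0r.
- rewrite (_ : \sum_t _ = \sum_t x 0 t *: g t + \sum_t y 0 t *: g t); first exact: Fit_mxD.
  by rewrite -big_split; apply: eq_bigr => t _; rewrite mxE scalerDl.
- rewrite (_ : \sum_t _ = c%:A * \sum_t x 0 t *: g t).
    apply: Fit_mxM => //; split; first exact: OL.
    by move=> y _; rewrite -scalerAl -scalerAr mul1r mulr1.
  by rewrite -scalerAl mul1r scaler_sumr; apply: eq_bigr => t _; rewrite mxE scalerA.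
Qed.

(** Coordinates with respect to g need not be unique, so P is the preimage in O^N of the union of
    the family. Directedness makes P a submodule, and then puts its finitely many generators into a
    single member. *)
Lemma exists_greatest_Fit I0 : Fit_family M I0 ->
  exists2 I, Fit_family M I & forall I', Fit_family M I' -> I' `<=` I.
Proof.
move=> FI0.
pose P := [set x : 'rV[F]_N | (forall t, x 0 t \in O) /\
             exists2 I, Fit_family M I & I (\sum_t x 0 t *: g t)].
have PmL I : Fit_family M I -> lattice_submodule O [set x : 'rV[F]_N | I (\sum_t x 0 t *: g t)].
  exact: Fit_family_submodule.
have Pm : lattice_submodule O P.
  split=> [|x y [xO [I1 F1 I1x]] [yO [I2 F2 I2y]]|c x cO [xO [I FI Ix]]]; split.
  - by move=> t; rewrite mxE rpred0.
  - by exists I0 => //; have [] := PmL _ FI0.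
  - by move=> t; rewrite mxE rpredD.
  - have [I [FI I1I I2I]] := Fit_family_directed F1 F2; exists I => //.
    by have [_ ID _] := PmL _ FI; apply: ID; [apply: I1I | apply: I2I].
  - by move=> t; rewrite mxE rpredM.
  - by exists I => //; have [_ _ IZ] := PmL _ FI; apply: IZ.
have [|s sP genP] := lattice_submodule_fg vO Pm; first by move=> x i [].
have [I FI sI] : exists2 I, Fit_family M I & forall x, x \in s -> I (\sum_t x 0 t *: g t).
  elim: s sP {genP} => [|x s IH] sP; first by exists I0.
  have [|I1 F1 sI1] := IH; first by move=> y ys; apply: sP; rewrite inE ys orbT.
  have [_ [I2 F2 xI2]] := sP x (mem_head x s).
  have [I [FI I1I I2I]] := Fit_family_directed F1 F2; exists I => // y.
  by rewrite inE => /orP[/eqP->|/sI1/I1I//]; apply: I2I.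
exists I => // I' FI' x I'x; have [c [cO xE]] := gspan (FitL FI' I'x).
have cE : x = \sum_t (\row_t c t) 0 t *: g t by rewrite xE; apply: eq_bigr => t _; rewrite mxE.
rewrite cE; apply: (genP _ (PmL _ FI) sI); split=> [t|]; first by rewrite mxE.
by exists I' => //; rewrite -cE.
Qed.

Lemma Fitmax_greatest I : Fit_family M I -> I `<=` Fitmax M.
Proof.
move=> FI; have [I1 F1 maxI1] := exists_greatest_Fit FI.
rewrite /Fitmax; case: xgetP => [J _ [FJ maxJ]|/(_ I1)]; last first.
  by case; split=> // I' FI' I1I'; apply/seteqP; split=> //; apply: maxI1.
by have <- := maxJ _ F1 (maxI1 _ FJ); apply: maxI1.
Qed.

End MaximalFitting.

(** * Base change of presentations to the larger order *)

Section Quotients.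
Local Open Scope quotient_scope.

Lemma exists_quotient (W : zmodType) (K : set W) :
    K 0 -> (forall x y, K x -> K y -> K (x - y)) ->
  exists (Q : zmodType) (pi : {additive W -> Q}), forall x, pi x = 0 <-> K x.
Proof.
move=> K0 KB; pose P : {pred W} := [pred x | `[< K x >]].
have Pz : zmod_closed P.
  split; first exact/asboolP.
  by move=> x y /asboolP Kx /asboolP Ky; apply/asboolP/KB.
pose PZ : zmodClosed W := HB.pack P (GRing.isZmodClosed.Build W P Pz).
pose Q : zmodType := Quotient.quot PZ.
exists Q, (\pi_(Quotient.quot PZ) : {additive W -> Q}) => x.
have -> : (\pi_(Quotient.quot PZ) x = 0 :> Q) <-> (x - 0 \in PZ).
  rewrite Quotient.idealrBE -[0 : Q](raddf0 \pi_(Quotient.quot PZ)).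
  by split=> [->//|/eqP].
by rewrite subr0; split=> [/asboolP|Kx]; [|apply/asboolP].
Qed.

End Quotients.

Section TensorPresentation.
Variables (F : fieldType) (A : falgType F) (L L' : subringClosed A) (LL' : {subset L <= L'}).
Variables (M : lmodType (subring_of L)) (N : lmodType (subring_of L')).
Variable t : subring_of L' -> M -> N.
Hypothesis tens : is_tensor LL' t.
Local Notation wd := (subring_widen LL').

Lemma widenD x y : wd (x + y) = wd x + wd y. Proof. exact: val_inj. Qed.
Lemma widenM x y : wd (x * y) = wd x * wd y. Proof. exact: val_inj. Qed.
Lemma widen0 : wd 0 = 0. Proof. exact: val_inj. Qed.
Lemma widen1 : wd 1 = 1. Proof. exact: val_inj. Qed.

Lemma widen_sum I (r : seq I) (P : pred I) (f : I -> subring_of L) :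
  wd (\sum_(i <- r | P i) f i) = \sum_(i <- r | P i) wd (f i).
Proof.
by elim/big_rec2: _ => [|i y x _ <-]; [exact: widen0 | rewrite widenD].
Qed.

Lemma tensDl g g' m : t (g + g') m = t g m + t g' m.
Proof. by case: tens => -[tD _ _] _ _ _; apply: tD. Qed.

Lemma tensDr g m m' : t g (m + m') = t g m + t g m'.
Proof. by case: tens => -[_ tD _] _ _ _; apply: tD. Qed.

Lemma tens_widen g l m : t (g * wd l) m = t g (l *: m).
Proof. by case: tens => -[_ _ tl] _ _ _; apply: tl. Qed.
Lemma tensZ g g' m : t (g * g') m = g *: t g' m.
Proof. by case: tens => _ tz _ _; apply: tz. Qed.

Lemma tens0l m : t 0 m = 0.
Proof. by apply: (addrI (t 0 m)); rewrite -tensDl !addr0. Qed.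

Lemma tens0r g : t g 0 = 0.
Proof. by apply: (addrI (t g 0)); rewrite -tensDr !addr0. Qed.

Lemma tens_suml I (r : seq I) (P : pred I) f m :
  t (\sum_(i <- r | P i) f i) m = \sum_(i <- r | P i) t (f i) m.
Proof.
by elim/big_rec2: _ => [|i y x _ <-]; [exact: tens0l | rewrite tensDl].
Qed.

Lemma tens_sumr g I (r : seq I) (P : pred I) f :
  t g (\sum_(i <- r | P i) f i) = \sum_(i <- r | P i) t g (f i).
Proof.
by elim/big_rec2: _ => [|i y x _ <-]; [exact: tens0r | rewrite tensDr].
Qed.

(** The quotient map modulo K and the zero map agree on pure tensors, so the uniqueness clause of
    [is_tensor] identifies them. *)
Lemma tensor_ind (K : set N) : K 0 -> (forall x y, K x -> K y -> K (x - y)) ->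
  (forall g m, K (t g m)) -> forall x, K x.
Proof.
move=> K0 KB Kt x; have [Q [pi piP]] := exists_quotient K0 KB.
case: tens => _ _ _ uniq; apply/piP.
have := uniq Q pi (GRing.null_fun Q) _ x; rewrite /= => -> //.
by move=> g m; apply/piP/Kt.
Qed.

(** Right exactness of the tensor product, from the universal property alone. For the kernel, let pi
    be the projection to the cokernel Q of h over L'. The balanced map sending (g, y) to the class
    of g lift(y) induces u from N to Q with u q = pi, so q v = 0 puts v into the row span of h. *)
Lemma tensor_presentation a b (h : 'M[subring_of L]_(a, b)) :
  is_presentation M h -> is_presentation N (map_mx wd h).
Proof.
case=> p [ps pk]; pose m j := p (delta_mx 0 j).
have pE v : p v = \sum_j v 0 j *: m j.
  by rewrite {1}[v]row_sum_delta linear_sum; apply: eq_bigr => j _; rewrite linearZ.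
pose q (v : 'rV[subring_of L']_b) : N := \sum_j t (v 0 j) (m j).
have q_lin : linear q.
  move=> c u v; rewrite /q scaler_sumr -big_split; apply: eq_bigr => j _ /=.
  by rewrite !mxE tensDl tensZ.
pose qL : {linear 'rV[subring_of L']_b -> N} :=
  HB.pack q (GRing.isLinear.Build (subring_of L') _ N _ q q_lin).
have qt g v : t g (p v) = q (g *: map_mx wd v).
  rewrite pE tens_sumr /q; apply: eq_bigr => j _.
  by rewrite !mxE -tens_widen.
have qB u v : q (u - v) = q u - q v by apply: (raddfB qL).
exists qL; split=> [x|v].
  apply: (tensor_ind (K := [set x | exists v, qL v = x])) => [|y z [u <-] [v <-]|g y].
  - by exists 0; rewrite linear0.
  - by exists (u - v); rewrite linearB.
  - by have [v <-] := ps y; exists (g *: map_mx wd v); rewrite qt.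
split=> [qv|[u ->]]; last first.
  rewrite /= /q; under eq_bigr => j _.
    rewrite mxE tens_suml; under eq_bigr do rewrite mxE tens_widen.
    over.
  rewrite exchange_big big1 //= => i _; rewrite -tens_sumr.
  rewrite [X in t _ X](_ : _ = p (row i h)); last by rewrite pE; apply: eq_bigr => j _;
    rewrite mxE.
  by rewrite (_ : p _ = 0) ?tens0r //; apply/pk; exists (delta_mx 0 i); rewrite -rowE.
pose K := [set v : 'rV[subring_of L']_b | exists u : 'rV_a, v = u *m map_mx wd h].
have K0 : K 0 by exists 0; rewrite mul0mx.
have KB x y : K x -> K y -> K (x - y).
  by move=> [u ->] [u' ->]; exists (u - u'); rewrite mulmxBl.
have [Q [pi piP]] := exists_quotient K0 KB.
have [lift liftP] := choice ps.
have map_wdM u : map_mx wd (u *m h) = map_mx wd u *m map_mx wd h :> 'rV_b.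
  apply/rowP => j; rewrite !mxE widen_sum; apply: eq_bigr => i _.
  by rewrite widenM !mxE.
have ker_pi g w : p w = 0 -> pi (g *: map_mx wd w) = 0.
  move=> /pk[u ->]; apply/piP; exists (g *: map_mx wd u).
  by rewrite map_wdM scalemxAl.
have wdD u w : map_mx wd (u + w) = map_mx wd u + map_mx wd w :> 'rV_b.
  by apply/rowP => j; rewrite !mxE widenD.
have wdB u w : map_mx wd (u - w) = map_mx wd u - map_mx wd w :> 'rV_b.
  by apply: (addIr (map_mx wd w)); rewrite -wdD !subrK.
(* Makes the choice of [lift] harmless: two preimages of one element differ by a relation. *)
have same_pi g u w : p u = p w -> pi (g *: map_mx wd u) = pi (g *: map_mx wd w).
  move=> uw; apply/eqP; rewrite -subr_eq0 -raddfB /= -scalerBr -wdB.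
  by rewrite ker_pi // linearB /= uw subrr.
pose f g y := pi (g *: map_mx wd (lift y)).
have [] := tens => _ _ /(_ Q f)[|u uE _].
  split=> [g g' y|g y y'|g l y]; rewrite /f.
  - by rewrite scalerDl raddfD.
  - by rewrite -raddfD /= -scalerDr -wdD; apply: same_pi; rewrite linearD /= !liftP.
  - rewrite -scalerA (_ : wd l *: _ = map_mx wd (l *: lift y)).
      by apply: same_pi; rewrite linearZ /= !liftP.
    by apply/rowP => j; rewrite !mxE widenM.
apply/piP; transitivity (u (q v)); last by rewrite [q v]qv raddf0.
rewrite /q raddf_sum {1}[v]row_sum_delta raddf_sum; apply: eq_bigr => j _ /=.
rewrite uE /f -[delta_mx 0 j](_ : map_mx wd (delta_mx 0 j) = _).
  by apply: same_pi; rewrite liftP.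
by apply/rowP => i; rewrite !mxE; case: andP => _; [apply: widen1 | apply: widen0].
Qed.

End TensorPresentation.

Section Widening.
Variables (F : fieldType) (A : falgType F) (L L' : subringClosed A) (LL' : {subset L <= L'}).
Hypothesis cLL' : centre [set` L] `<=` centre [set` L'].
Local Notation wd := (subring_widen LL').

Lemma nrL_widen b (H : 'M[subring_of L]_b) : nrL (map_mx wd H) = nrL H.
Proof. by rewrite /nrL; congr nr; apply/matrixP => i j; rewrite !mxE. Qed.

(** Invertible matrices over L stay invertible over L', central elements stay central by [cLL'], and
    the reduced norm is taken in A in either case. *)
Lemma Fit_mx_widen a b (h : 'M[subring_of L]_(a, b)) : Fit_mx h `<=` Fit_mx (map_mx wd h).
Proof.
rewrite /Fit_mx; case: ifP => _; last by []. apply: mul_span_mono.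
  apply: mul_span_mono => // _ [c [H [H' [HH' H'H ->]]]].
  have wdM p q r (X : 'M_(p, q)) (Y : 'M_(q, r)) : map_mx wd (X *m Y) = map_mx wd X *m map_mx
    wd Y.
    apply/matrixP => i j; rewrite !mxE widen_sum; apply: eq_bigr => k _.
    by rewrite widenM !mxE.
  have wd1 p : map_mx wd (1%:M : 'M_p) = 1%:M.
    by apply/matrixP => i j; rewrite !mxE; case: eqP => _; [apply: widen1 | apply: widen0].
  by exists c, (map_mx wd H), (map_mx wd H'); rewrite -!wdM HH' H'H !wd1 nrL_widen.
move=> _ [f fh <-]; exists f => //; rewrite -nrL_widen; congr nrL.
by apply/matrixP => i j; rewrite !mxE.
Qed.

End Widening.

(** * From adjoints to annihilation by Fitting invariants *)

Section Annihilation.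
Variables (F : fieldType) (A : falgType F) (L : subringClosed A).
Hypothesis cL : forall x, centre [set` L] x -> forall y : A, x * y = y * x.
Hypothesis adj : forall b (H : 'M[A]_b) z, (forall i j, H i j \in L) -> is_nr H z ->
  exists2 Y : 'M[A]_b, (forall i j, Y i j \in L) & Y *m H = z%:M /\ z \in L.

Lemma nrL_adjoint b (H : 'M[subring_of L]_b) :
  exists (l : subring_of L) (Y : 'M[subring_of L]_b),
    [/\ val l = nrL H, Y *m H = l%:M & forall y : A, val l * y = y * val l].
Proof.
rewrite /nrL /nr; case: xgetP => [z _ nrz|_]; last first.
  (* If no reduced norm exists, [nr] has its default value 0, for which the zero matrix is an
     adjoint. *)
  exists 0, 0; split=> [||y].
  - exact: (rmorph0 (val : subring_of L -> A)).
  - by rewrite mul0mx raddf0.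
  - by rewrite [val _](rmorph0 (val : subring_of L -> A)) mul0r mulr0.
have [|Y YL [YH zL]] := adj _ nrz; first by move=> i j; rewrite mxE; apply: valP.
exists (Subring_of zL), (\matrix_(i, j) Subring_of (YL i j)); split=> [||y] //=.
  apply/matrixP => i j; apply: val_inj; have /matrixP/(_ i j) := YH.
  rewrite !mxE => e; rewrite [LHS](rmorph_sum (val : subring_of L -> A)).
  rewrite [RHS](rmorphMn (val : subring_of L -> A)) [RHS]/= -e; apply: eq_bigr => k _.
  by rewrite !mxE [LHS]rmorphM.
by case: nrz => -[_ zc] _; apply: zc.
Qed.

Definition annihilates (M : lmodType (subring_of L)) (x : A) : Prop :=
  exists l : subring_of L,
    [/\ val l = x, forall y : A, x * y = y * x & forall m : M, l *: m = 0].

Lemma U_ring_center x : U_ring L x -> x \in L /\ forall y : A, x * y = y * x.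
Proof.
move: x; rewrite /U_ring;
  apply: mul_span_ind => [|u v [uL uc] [vL vc]|r _ rc [b [H [_ [_ _ ->]]]]].
- by split=> [|y]; rewrite ?rpred0 ?mul0r ?mulr0.
- by split=> [|y]; [apply: rpredD | rewrite mulrDl mulrDr uc vc].
- have [l [_ [<- _ lc]]] := nrL_adjoint H; split; last by apply: central_mul lc; apply: cL.
  by rewrite rpredM ?(valP l) //; case: rc.
Qed.

Lemma Fit_mx_annihilates (M : lmodType (subring_of L)) a b (h : 'M[subring_of L]_(a, b)) x :
  is_presentation M h -> Fit_mx h x -> annihilates M x.
Proof.
case=> p [ps pk].
have ann0 : annihilates M 0.
  exists 0; split=> [|y|m]; last exact: scale0r.
  - exact: (rmorph0 (val : subring_of L -> A)).
  - by rewrite mul0r mulr0.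
rewrite /Fit_mx; case: ifP => _ ; last by move=> ->.
move: x; apply: mul_span_ind => [//|u w [lu [<- uc lu0]] [lw [<- wc lw0]]|r _
  /U_ring_center[rL rc] [f _ <-]].
  exists (lu + lw); split=> [|y|m]; first exact: rmorphD.
    by rewrite mulrDl mulrDr uc wc.
  by rewrite scalerDl lu0 lw0 addr0.
have [l [Y [<- Yh lc]]] := nrL_adjoint (rowsub f h).
exists (Subring_of rL * l); split=> [||m]; first exact: rmorphM.
  exact: central_mul.
rewrite -scalerA; have [v <-] := ps m; rewrite -linearZ /=.
suff -> : p (l *: v) = 0 by rewrite scaler0.
(* [rowsub f h] is [rowsub f 1%:M] times h, so v Y times it is a combination of the rows of h. It
   equals v times the scalar matrix of l, and centrality of l moves the scalar to the left. *)
apply/pk; exists (v *m Y *m rowsub f 1%:M); rewrite -[RHS]mulmxA -rowsubE -mulmxA Yh.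
apply/rowP => j; rewrite !mxE (bigD1 j) //= big1 ?addr0 => [|k kj].
  by rewrite mxE eqxx mulr1n; apply: val_inj; rewrite !rmorphM /= lc.
by rewrite mxE (negPf kj) mulr0.
Qed.

Lemma Fit_family_annihilates (M : lmodType (subring_of L)) I x :
  Fit_family M I -> I x -> annihilates M x.
Proof. by move=> [a [b [h [hM ->]]]]; apply: Fit_mx_annihilates. Qed.

End Annihilation.

(** * The group ring inside the order, and the analysis of one component *)

Section GroupRing.
Variables (F : fieldType) (gT : finGroupType) (O : subringClosed F).
Local Notation A := (grpalg F gT).
Local Notation Lam := (grpring gT O).

Lemma grpring_delta g : grpalg_delta F g \in Lam.
Proof.
by apply/forallP => h; rewrite grpalg_coef_delta; case: eqP => _; rewrite ?rpred1 ?rpred0.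
Qed.

Lemma grpring_scalar c : c \in O -> (c%:A : A) \in Lam.
Proof.
move=> cO; apply/forallP => h; rewrite grpalg_coefZ grpalg_coef_one.
by case: eqP => _; rewrite ?mulr1 ?mulr0 ?rpred0.
Qed.

Lemma grpring_center x : centre [set` Lam] x -> forall y : A, x * y = y * x.
Proof.
move=> [_ xc] y; rewrite [y]grpalg_sum_delta mulr_sumr mulr_suml.
apply: eq_bigr => g _; rewrite -scalerAr -[(_ *: _) * x]scalerAl xc //.
exact: grpring_delta.
Qed.

Variable Gam : subringClosed A.
Hypothesis LamGam : {subset Lam <= Gam}.
Hypothesis Gam_order : is_order O 1 [set` Gam].
Hypothesis Oval : forall x : F, x \in O \/ x^-1 \in O.

Lemma order_generators : exists N (g : 'I_N -> A), (forall t, g t \in Gam) /\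
  forall x, x \in Gam -> exists c : 'I_N -> F, (forall t, c t \in O) /\ x = \sum_t c t *: g t.
Proof.
have [_ _ [N [g GE]] _] := Gam_order; exists N, g; split=> [t|x xG].
  suff : [set` Gam] (g t) by [].
  rewrite GE -[g t]mul1r; apply: mul_span_mul; last by exists t.
  by exists 1; rewrite ?scale1r //=; apply: rpred1.
have : [set` Gam] x by [].
rewrite GE => {xG}; move: x;
  apply: mul_span_ind => [|x y [c [cO ->]] [d [dO ->]]|_ _ [c cO <-] [t _ <-]].
- exists (fun=> 0); split=> [t|]; first exact: rpred0.
  by rewrite big1 // => t _; rewrite scale0r.
- exists (fun t => c t + d t); split=> [t|]; first exact: rpredD.
  by rewrite -big_split; apply: eq_bigr => t _; rewrite scalerDl.
- exists (fun t' => c *+ (t' == t)); split=> [t'|]; first by rewrite rpredMn.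
  rewrite (bigD1 t) //= big1 ?addr0 => [|t' /negPf ->]; last by rewrite mulr0n scale0r.
  by rewrite eqxx mulr1n -scalerAl mul1r.
Qed.

Lemma order_scale c x : c \in O -> x \in Gam -> c *: x \in Gam.
Proof.
by move=> cO xG; rewrite -[x]mul1r scalerAl rpredM //; apply/LamGam/grpring_scalar.
Qed.

Lemma order_full : full_lattice Gam.
Proof.
move=> x; have [_ _ _ spanE] := Gam_order.
have : mul_span (scalars A setT) [set` Gam] x by rewrite spanE; exists x; rewrite ?mul1r.
move=> [k [r [s [rF sG ->]]]].
have rE i : exists c : F, r i = c%:A by have [c _ <-] := rF i; exists c.
have [c cE] := choice rE.
have [a [a0 aO ac]] := common_denominator c Oval.
exists a => //; rewrite scaler_sumr rpred_sum // => i _.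
rewrite cE -scalerAl mul1r scalerA order_scale //.
exact: sG.
Qed.

Lemma order_center x : centre [set` Gam] x -> forall y : A, x * y = y * x.
Proof.
move=> [_ xc] y; have [a a0 ayG] := order_full y; apply: (scalerI a0).
by rewrite scalerAr scalerAl xc.
Qed.

Lemma grpring_center_sub : centre [set` Lam] `<=` centre [set` Gam].
Proof.
move=> x xc; split; first by case: xc => /LamGam.
by move=> y _; apply: grpring_center.
Qed.

(** The coefficient of r x at g is that of r x g^-1 at 1, and Gam is stable under multiplication by
    group elements. *)
Lemma conductor_grpring (r x : A) :
  (forall gam, gam \in Gam -> grpalg_coef (r * gam) 1%g \in O) ->
  x \in Gam -> r * x \in Lam.
Proof.
move=> rO xG; apply/forallP => g; rewrite grpalg_coef1E -mulrA rO // rpredM //.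
exact/LamGam/grpring_delta.
Qed.

Section Component.
Hypothesis cardG : #|gT|%:R != 0 :> F.
Hypothesis Ouni : exists p : F, [/\ p != 0, p \in O & p^-1 \notin O].
Variables (e : A) (n s : nat) (o : set A).
Hypothesis e_center : centre [set` Gam] e.
Hypothesis ee : e * e = e.
Hypothesis e0 : e <> 0.
Hypothesis type_e : commutative_type e (component [set` Gam] e) n s o \/
  skewfield_type O e (component [set` Gam] e) n s o.

(** Collects what the theorem needs from a component, uniformly in its type. In the skewfield case
    any psi not vanishing on e will do, since psi sends a central idempotent to 0 or 1. *)
Lemma component_analysis :
  [/\ forall b (H : 'M[A]_b) z, (forall i j, H i j \in Gam) -> is_nr H z ->
        exists Y : 'M[A]_b,
          [/\ forall i j, Y i j \in Gam, Y *m H = (z * e)%:M & z * e \in Gam],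
      forall y gam, inv_different O o y -> gam \in Gam ->
        grpalg_coef ((#|gT|%:R / (n * s)%:R) *: y * gam) 1%g \in O
    & forall y, inv_different O o y -> forall z, y * z = z * y].
Proof.
have eG : e \in Gam by case: e_center.
have ec : forall x, e * x = x * e := order_center e_center.
have Gfull := order_full.
have [N [g [gG gspan]]] := order_generators.
case: type_e => [[R [phi [n0 iso oE sE]]]|].
  have Uc := commutative_Fspan_center iso ec Gfull.
  have cI : #|{: 'I_n * 'I_n}| = ((n * 1) ^ 2)%N by rewrite card_prod !card_ord muln1 mulnn.
  rewrite sE oE; split=> [b H z HG nrz|y gam yo gamG|y [yU _]].
  - apply: (commutative_adjoint n0 iso ec ee Gfull _ eG HG nrz) => x x0.
    exact: exists_abs_rep.
  - apply: (inv_different_conductor cI (commutative_free_over iso ec Gfull) Uc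
      (commutative_Fspan_unit iso ec) (commutative_Fspan_mul iso) _ yo gamG).
    by rewrite muln1; apply: (commutative_reduced_trace iso ec Gfull).
  - exact: Uc.
case=> D [w [V [phi [[Dunit wV VO] [n0 iso phiF] oE dimD]]]].
have Vfull := valuation_ring_full Dunit wV VO Ouni.
have [delta deltaV] := exists_skewfield_embedding iso phiF Oval VO Vfull.
have [psi psi0] := exists_abs_rep cardG (introN eqP e0).
have psie : psi e = 1%:M.
  by have [pe|//] := abs_rep_idem psi ec ee; rewrite pe eqxx in psi0.
rewrite oE.
have memU := mem_skew_center ec ee Gfull.
have Uc y : y \in Fspan (centre (component [set` Gam] e)) -> forall z, y * z = z * y.
  by case/memU.
have Ue y : y \in Fspan (centre (component [set` Gam] e)) -> y * e = y.
  by case/memU.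
split=> [b H z HG nrz|y gam yo gamG|y [yU _]]; last exact: Uc.
  exact: (skewfield_adjoint gG gspan n0 iso ec ee eG Gfull Vfull Dunit wV VO deltaV psie HG nrz).
have [a [kappa fr]] := skew_center_basis cardG n0 iso ec ee Gfull Vfull Dunit deltaV psie.
have mE := skew_rep_dim cardG n0 iso ec ee Gfull Vfull Dunit deltaV psie dimD.
have cI : #|'I_(rep_dim psi * rep_dim psi)| = ((n * s) ^ 2)%N by rewrite card_ord mE mulnn.
apply: (inv_different_conductor (Gam := [set` Gam]) cI fr Uc Ue _ _ yo gamG).
  exact: (skew_center_mul ec ee Gfull).
exact: (skew_reduced_trace cardG gG gspan n0 iso ec ee Gfull Vfull Dunit wV VO deltaV psie dimD).
Qed.

End Component.
End GroupRing.

(** * Annihilation *)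

Section Conductor.
Variables (F : fieldType) (A : falgType F) (L L' : subringClosed A) (LL' : {subset L <= L'}).
Variables (M : lmodType (subring_of L)) (N : lmodType (subring_of L')).
Variable t : subring_of L' -> M -> N.
Hypothesis tens : is_tensor LL' t.

(* g (x) m |-> (r g) m is a well-defined map from the tensor product to M, even
   though M itself need not embed in the tensor product. *)
Lemma conductor_annihilates (r x : A) (m : M) :
    (forall y, r * y = y * r) -> (forall g, g \in L' -> r * g \in L) ->
    annihilates N x -> forall l : subring_of L, val l = r * x -> l *: m = 0.
Proof.
move=> rc rL [lx [lxE xc lx0]] l lE.
pose c (g : subring_of L') : subring_of L := Subring_of (rL _ (valP g)).
have [_ _ univ _] := tens.
have [|u uE] := univ M (fun g y => c g *: y).
  split=> [g g' y|g y y'|g l' y]; last 1 first.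
  - by rewrite scalerA; congr (_ *: _); apply: val_inj; rewrite /= mulrA.
  - by rewrite -scalerDl; congr (_ *: _); apply: val_inj; rewrite /= mulrDr.
  - exact: scalerDr.
have -> : l = c lx by apply: val_inj; rewrite lE -lxE.
by rewrite -uE -[lx]mulr1 (tensZ tens) lx0 raddf0.
Qed.

End Conductor.

Theorem theorem6p15
    (gT : finGroupType) (F : fieldType) (O : subringClosed F)
    (Odvr : complete_dvr O) (cardG : #|gT|%:R != 0 :> F)
    (Gam : subringClosed (grpalg F gT)) (Gamnice : nice_Fitting_order O Gam)
    (LamGam : {subset grpring gT O <= Gam})
    (k : nat) (e : 'I_k -> grpalg F gT) (n s : 'I_k -> nat)
    (o : 'I_k -> set (grpalg F gT))
    (Gamdec : Fitting_decomposition O Gam e n s o)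
    (M : lmodType (subring_of (grpring gT O))) (Mfg : finitely_generated M)
    (N : lmodType (subring_of Gam)) (t : subring_of Gam -> M -> N)
    (Ntensor : is_tensor LamGam t) :
  let J := Jideal O #|gT| n s o in
  mul_span J (Fitmax M) `<=` mul_span J (Fitmax N) /\
  mul_span J (Fitmax N) `<=` Ann_centre M.
Proof.
move=> J; have [v vO] := complete_dvr_valuation Odvr.
have Funit (x : F) : x != 0 -> x \is a GRing.unit by rewrite unitfE.
have Oval := valuation_total Funit vO.
have Ouni := exists_uniformizer Funit vO.
have [Gord _] := Gamnice.
have [[ecent eM e1] etype enz] := Gamdec.
have ee i : e i * e i = e i by rewrite eM eqxx.
have comp i := component_analysis LamGam Gord Oval cardG Ouni (ecent i) (ee i) (enz i).1
  (etype i).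
(* The adjoints of the components add up, since z is the sum of the z e_i. *)
have adj b (H : 'M[grpalg F gT]_b) z : (forall i j, H i j \in Gam) -> is_nr H z ->
    exists2 Y : 'M_b, (forall i j, Y i j \in Gam) & Y *m H = z%:M /\ z \in Gam.
  move=> HG nrz; have zE : z = \sum_i z * e i by rewrite -mulr_sumr e1 mulr1.
  have Yi i : exists Y : 'M[grpalg F gT]_b,
      [/\ forall i j, Y i j \in Gam, Y *m H = (z * e i)%:M & z * e i \in Gam].
    by have [adji _ _] := comp i; apply: adji.
  have [Y YP] := choice Yi.
  exists (\sum_i Y i) => [i j|].
    by rewrite summxE rpred_sum // => l _; have [-> ] := YP l.
  split; last by rewrite zE rpred_sum // => i _; have [] := YP i.
  rewrite mulmx_suml [in RHS]zE raddf_sum; apply: eq_bigr => i _.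
  by have [] := YP i.
have Gc := order_center LamGam Gord Oval.
have annN := Fit_family_annihilates Gc adj.
have J_central r : J r -> forall z, r * z = z * r.
  move=> [y yP ->] z; rewrite mulr_suml mulr_sumr; apply: eq_bigr => i _.
  have [_ _ yc] := comp i; rewrite -scalerAl -scalerAr; congr (_ *: _).
  exact: yc.
have J_conductor r g : J r -> g \in Gam -> r * g \in grpring gT O.
  move=> [y yP ->] gG; apply: conductor_grpring gG => // g' g'G.
  rewrite mulr_suml grpalg_coef_sum rpred_sum // => i _.
  by have [_ yO _] := comp i; apply: yO.
split.
  (* [Fitmax M] is either the Fitting invariant of some presentation h or the default [set0], which
     has no elements. The base change of h belongs to the family for N, whose maximal element is its
     greatest. *)
  apply: mul_span_mono => // x; rewrite {1}/Fitmax.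
  case: xgetP => [_ _ [[a [b [h [hM ->]]]] _] hx|//].
  have hN := tensor_presentation Ntensor hM.
  have [K [g [_ gspan]]] := order_generators Gord.
  apply: (Fitmax_greatest vO gspan _ _ (I := Fit_mx (map_mx (subring_widen LamGam) h))).
  - by move=> c cO; apply/LamGam/grpring_scalar.
  - by move=> I y FI Iy; have [l [<- _ _]] := annN _ _ _ FI Iy; apply: valP.
  - by exists a, b, (map_mx (subring_widen LamGam) h).
  - by apply: Fit_mx_widen hx; apply: grpring_center_sub.
apply: mul_span_ind => [|x y|r x Jr].
- split; last by exists 0; [exact: (rmorph0 (val : subring_of (grpring gT O) -> _)) | move=> m;
  exact: scale0r].
  by split=> [|y _]; rewrite /= ?rpred0 ?mul0r ?mulr0.
- move=> [[xL xc] [lx lxE x0]] [[yL yc] [ly lyE y0]]; split.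
    by split=> [|z zL]; [exact: rpredD | rewrite mulrDl mulrDr xc ?yc].
  exists (lx + ly) => [|m]; last by rewrite scalerDl x0 y0 addr0.
  by rewrite -lxE -lyE; exact: (rmorphD (val : subring_of (grpring gT O) -> _)).
rewrite {1}/Fitmax; case: xgetP => [I _ [FI _] Ix|//].
have annx := annN _ _ _ FI Ix; have [l [lE xc _]] := annx.
have rxL : r * x \in grpring gT O by apply: J_conductor => //; rewrite -lE; apply: valP.
split; first by split=> // z _; apply: central_mul => //; apply: J_central.
exists (Subring_of rxL) => // m.
apply: (conductor_annihilates Ntensor m (J_central _ Jr) _ annx) => // g.
exact: J_conductor.
Qed.
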